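(* Let $(X_n)_{n\ge0}$ be a transient nearest neighbour random walk on the directed cover $\mathcal{T}$ of $G$ with transition data $p_G(i,j)$, $p(-i)$. Suppose that the Markov chain on $G$ with transition matrix $Q=(q(i,j))_{i,j\in G}$, $q(i,j)=\frac{1-F(-j)}{1-F(-i)}\,p(i,j)\,\overline{G}_i(1)$, is positive recurrent with invariant probability measure $\nu$. Let $$\Lambda:=\sum_{i\in G}\nu(i)\frac{F'(-i|1)}{F(-i)}.$$ For a bounded weight function $w:G\times G\to\mathbb{R}$ let $l$ be the associated length function on $\mathcal{T}$. Then: 1. If $\Lambda<\infty$, then for each bounded weight function $w$ $$\lim_{n\to\infty}\frac{l(X_n)}{n}=\Bigl(\sum_{i,j\in G}w(i,j)\nu(i)q(i,j)\Bigr)\cdot\Bigl(\sum_{i\in G}\nu(i)\frac{F'(-i|1)}{F(-i)}\Bigr)^{-1}\quad\text{almost surely.}$$ In this case the rate of escape with respect to the natural distance exists and is positive, i.e. $\lim_{n\to\infty}|X_n|/n>0$ almost surely. 2. If the spectral radius of $(X_n)$ is strictly smaller than $1$, then $\Lambda<\infty$. 3. If $\Lambda=\infty$, then $\liminf_{n\to\infty}\frac{l(X_n)}{n}=0$ almost surely.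
   Context: $G$ is a countable directed graph, strongly connected, of bounded geometry (uniformly bounded vertex degrees), without multiple edges; $i_0\in G$. The directed cover $\mathcal{T}$ of $G$ rooted in $i_0$ is the rooted tree with vertices labelled by $\tau:\mathcal{T}\to G$: the root $o$ has label $i_0$, and recursively a vertex with label $i$ has exactly one direct descendant with label $j$ for each edge $(i,j)$ of $G$ and no others. $x^-$ denotes the direct ancestor of $x\neq o$, and $|x|$ the graph distance from $o$ to $x$. Given are transition probabilities $p_G(i,j)$ on $G$ (stochastic, with $p_G(i,j)>0$ iff there is an edge from $i$ to $j$) and backward probabilities $p(-i)\in(0,1)$, $i\in G$, such that for some $\varepsilon\in(0,1)$, $\varepsilon<p(-i)<1-\varepsilon$ for all $i$. Put $p(i,j)=(1-p(-i))p_G(i,j)$. A loop is added at the root. The random walk $(X_n)$ on $\mathcal{T}$ starts at $o$ and has transition probabilities $p(x,y)=p(\tau(x),\tau(y))$ if $y^-=x$; $p(x,x^-)=p(-\tau(x))$ for $x\ne o$; $p(o,o)=p(-i_0)$; and $0$ otherwise. Length function: for bounded $w:G\times G\to\mathbb{R}$ (possibly with negative values), $l(o)=0$ and $l(x)=l(x^-)+w(\tau(x^-),\tau(x))$ for $x\neq o$; for $w\equiv1$ one gets $l(x)=|x|$. Generating functions: for $i\in G$ and any $x\in\mathcal{T}\setminus\{o\}$ with $\tau(x)=i$ (the choice is irrelevant), $F(-i|z)=\sum_{n\ge0}\mathbb{P}[X_n=x^-,\ X_m\ne x^-\ \forall m<n\mid X_0=x]z^n$, $\overline{G}_i(z)=\sum_{n\ge0}\mathbb{P}[X_n=x,\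 X_m\neq x^-\ \forall m<n\mid X_0=x]z^n$, and $F(-i)=F(-i|1)$; $F'$ is the derivative in $z$. Also $G(x,y|z)=\sum_{n\ge0}\mathbb{P}[X_n=y\mid X_0=x]z^n$; the spectral radius of $(X_n)$ is $1/R$, where $R$ is the radius of convergence of $G(o,o|z)$.
   Formalization: Item 3 as printed fails for negative weights (e.g. w = -1); what is proved is liminf |l(X_n)|/n = 0 a.s. for every bounded w, and liminf l(X_n)/n = 0 a.s. for every bounded w ≥ 0. *)

(* Defs.v *)
From HB Require Import structures.
From mathcomp Require Import all_boot all_order all_algebra.
From mathcomp Require Import all_classical all_reals all_analysis.
Import Order.TTheory GRing.Theory Num.Theory.
Import numFieldNormedType.Exports.

Set Implicit Arguments.
Unset Strict Implicit.
Unset Printing Implicit Defensive.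

Local Open Scope classical_set_scope.
Local Open Scope ring_scope.

Section Graphs.
Variables (V : eqType) (e : rel V).

Definition strongly_connected : Prop :=
  forall x y : V, exists2 s : seq V, path e x s & last x s = y.

Definition bounded_geometry : Prop :=
  exists N : nat, forall x : V,
    ([set y | e x y] #<= `I_N)%card /\ ([set y | e y x] #<= `I_N)%card.

Definition joined_in (x y : V) (n : nat) : Prop :=
  exists2 s : seq V, path e x s & size s = n /\ last x s = y.

Definition graph_dist (x y : V) : nat :=
  get [set n | joined_in x y n /\ forall m, joined_in x y m -> (n <= m)%N].

End Graphs.

Section Chains.
Variables (R : realType) (T : countType) (t : T -> T -> R).

Fixpoint traj_weight (x : T) (s : seq T) : R :=
  if s is y :: s' then t x y * traj_weight y s' else 1.

(* P[A | X_0 = x] for the chain with transition function t and an event A that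
   is determined by (X_0, ..., X_n): the total weight of the trajectories
   x = y_0, y_1, ..., y_n in A.  (A is evaluated at sequences that are constant
   equal to x after time n; those coordinates must be irrelevant for A.) *)
Definition prob_from (x : T) (n : nat) (A : set (nat -> T)) : \bar R :=
  (\esum_(s in [set s : n.-tuple T | A (nth x (x :: s))])
     (traj_weight x s)%:E)%E.

Definition first_return (x : T) (n : nat) : \bar R :=
  prob_from x n [set Y | Y n = x /\ forall m, (0 < m < n)%N -> Y m <> x].

Definition return_prob (x : T) : \bar R :=
  (\sum_(1 <= n <oo) first_return x n)%E.

Definition mean_return_time (x : T) : \bar R :=
  (\sum_(1 <= n <oo) n%:R%:E * first_return x n)%E.

Definition transient : Prop := forall x : T, (return_prob x < 1)%E.

Definition positive_recurrent : Prop :=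
  forall x : T, return_prob x = 1%E /\ (mean_return_time x < +oo)%E.

Definition invariant_probability (nu : T -> R) : Prop :=
  [/\ forall i, 0 <= nu i,
      (\esum_(i in [set: T]) (nu i)%:E = 1)%E &
      forall j, (\esum_(i in [set: T]) (nu i * t i j)%:E = (nu j)%:E)%E].

Definition green_coef (x y : T) (n : nat) : \bar R :=
  prob_from x n [set Y | Y n = y].

(* X is a Markov chain with transition function t started at x0; the Markov
   property is written without dividing by the probability of the past. *)
Definition markov_chain (d : measure_display) (Omega : measurableType d)
    (P : probability Omega R) (X : nat -> Omega -> T) (x0 : T) : Prop :=
  [/\ forall n x, measurable (X n @^-1` [set x]),
      P (X 0%N @^-1` [set x0]) = 1%E &
      forall (n : nat) (s : nat -> T),
        P [set omega | forall k, (k <= n.+1)%N -> X k omega = s k] =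
        (P [set omega | forall k, (k <= n)%N -> X k omega = s k]
           * (t (s n) (s n.+1))%:E)%E].

End Chains.

Section GeneratingFunctions.
Variable R : realType.
Implicit Types (a : nat -> \bar R) (z : R).

(* Power series with nonnegative coefficients, used at z >= 0; the values lie
   in [0, +oo].  The derivative is taken termwise, so that at z = 1 it is the
   limit of the derivatives at z < 1, possibly +oo. *)
Definition gen_fun a z : \bar R := (\sum_(0 <= n <oo) a n * (z ^+ n)%:E)%E.

Definition gen_fun_deriv a z : \bar R :=
  (\sum_(0 <= n <oo) a n.+1 * (n.+1%:R * z ^+ n)%:E)%E.

Definition convergence_radius a : \bar R :=
  ereal_sup [set r%:E | r in [set r : R | 0 <= r /\ (gen_fun a r < +oo)%E]].

End GeneratingFunctions.

Section SignedSums.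
Variables (R : realType) (T : choiceType).

(* Value of an absolutely convergent series of real numbers. *)
Definition real_sum (f : T -> R) : R :=
  fine (\esum_(i in [set: T]) (EFin \o f)^\+ i
        - \esum_(i in [set: T]) (EFin \o f)^\- i)%E.

End SignedSums.

Section Cover.
Variables (G : countType) (E : rel G) (i0 : G).

(* Directed cover of (G, E) rooted in i0: the vertex reached from the root
   along the edges i0 -> j1 -> ... -> jn is stored with the most recent label
   first, as [:: jn; ...; j1]. *)
Fixpoint is_vertex (s : seq G) : bool :=
  if s is j :: s' then E (head i0 s') j && is_vertex s' else true.

Record directed_cover := Vertex { word : seq G; wordP : is_vertex word }.

HB.instance Definition _ := [isSub for word].
HB.instance Definition _ := [Countable of directed_cover by <:].

Definition tree_root : directed_cover := @Vertex [::] isT.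

Definition label (x : directed_cover) : G := head i0 (word x).

Lemma is_vertex_behead (s : seq G) : is_vertex s -> is_vertex (behead s).
Proof. by case: s => //= j s /andP[]. Qed.

(* The direct ancestor x^-; by convention the root is sent to itself. *)
Definition parent (x : directed_cover) : directed_cover :=
  Vertex (is_vertex_behead (wordP x)).

Definition is_child (x y : directed_cover) : bool :=
  (y != tree_root) && (parent y == x).

Definition tree_adj : rel directed_cover :=
  [rel x y | is_child x y || is_child y x].

Definition height (x : directed_cover) : nat :=
  graph_dist tree_adj tree_root x.

Fixpoint word_length (R : realType) (w : G -> G -> R) (s : seq G) : R :=
  if s is j :: s' then word_length w s' + w (head i0 s') j else 0.

Definition length_fun (R : realType) (w : G -> G -> R) (x : directed_cover) : R :=
  word_length w (word x).

End Cover.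

Arguments tree_root {G E i0}.
Arguments directed_cover {G} E i0.

Section Walk.
Variables (R : realType) (G : countType) (E : rel G) (i0 : G).
(* pb i stands for p(-i) *)
Variables (pG : G -> G -> R) (pb : G -> R).

Definition forward (i j : G) : R := (1 - pb i) * pG i j.

Definition cover_walk (x y : directed_cover E i0) : R :=
  if is_child x y then forward (label x) (label y)
  else if (x != tree_root) && (y == parent x) then pb (label x)
  else if (x == tree_root) && (y == tree_root) then pb i0
  else 0.

Definition spectral_radius : \bar R :=
  ((convergence_radius (green_coef cover_walk tree_root tree_root))^-1)%E.

Definition F_coef (x : directed_cover E i0) (n : nat) : \bar R :=
  prob_from cover_walk x n
    [set Y | Y n = parent x /\ forall m, (m < n)%N -> Y m <> parent x].

Definition Gbar_coef (x : directed_cover E i0) (n : nat) : \bar R :=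
  prob_from cover_walk x n
    [set Y | Y n = x /\ forall m, (m < n)%N -> Y m <> parent x].

(* rep i is the chosen vertex x <> o with label i *)
Variable rep : G -> directed_cover E i0.

Definition Fback (i : G) (z : R) : \bar R := gen_fun (F_coef (rep i)) z.

Definition Fback' (i : G) (z : R) : \bar R := gen_fun_deriv (F_coef (rep i)) z.

Definition Gbar (i : G) (z : R) : \bar R := gen_fun (Gbar_coef (rep i)) z.

Definition qmat (i j : G) : R :=
  (1 - fine (Fback j 1)) / (1 - fine (Fback i 1))
    * forward i j * fine (Gbar i 1).

Definition Lambda (nu : G -> R) : \bar R :=
  (\esum_(i in [set: G]) (nu i)%:E * (Fback' i 1 / Fback i 1))%E.

End Walk.

(* Main.v *)
(** Let W_k be the k-th exit point of the walk, i.e. the vertex at distance k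
    from the root that is visited after the last visit of its ancestor W_(k-1),
    and let L_k be the time of the last visit of W_k.  Cutting trajectories at
    the times L_k shows that the triples (label of W_k, L_k - L_(k-1) - 1, label
    of W_(k+1)) form a Markov chain: its label part has transition matrix Q, its
    invariant law is nu followed by one step, and since
    F(-i|z) = p(-i) z Gbar_i(z), the mean of L_k - L_(k-1) under this law is
    Lambda.  The ergodic theorem gives L_k / k -> Lambda and the limit of
    l(W_k) / k, and |l(X_m) - l(X_n)| = O(|m - n|) allows one to interpolate.
    If Lambda is infinite, L_k / k -> +oo whereas l(W_k) = O(k).

    The ergodic theorem for a countable chain comes from the Poisson equation
    for the truncated hitting times of a state: its martingale part satisfies an
    exponential inequality, and its error term is small in mean, hence along the
    trajectory by the maximal inequality.  This bounds the frequencies of visits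
    from below, which suffices for lower bounds of nonnegative averages; upper
    bounds follow by passing to K - f and by the maximal inequality for the tails.

    If G(o,o|r) is finite for some r > 1, then loops at a vertex x of label i that
    avoid the ancestor have probability at most r^-m in m steps, uniformly in i,
    so F'(-i|1)/F(-i) is bounded. *)

Require Import Defs.
From HB Require Import structures.
From mathcomp Require Import all_boot all_order all_algebra.
From mathcomp Require Import all_classical all_reals all_analysis.
From mathcomp Require Import ring lra zify.
Import Order.TTheory GRing.Theory Num.Theory.
Import numFieldNormedType.Exports.

Set Implicit Arguments.
Unset Strict Implicit.
Unset Printing Implicit Defensive.

Local Open Scope classical_set_scope.
Local Open Scope ring_scope.

(** * Sums over countable types *)

(** Exit times are not stopping times: whether a vertex is left for good depends on the whole
    future. Conditioning on never returning to the ancestor is an h-transform with h = 1 - F(-i),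
    the escape probability, which is the origin of the quotient (1 - F(-j)) / (1 - F(-i)) in Q.
    Events about exit points are therefore written as an event of the past intersected with
    non-return, and probabilities are compared by products instead of conditional laws. Putting the
    time spent and the next label into the state makes holding times and weights functions of a
    single state. The exit chain does not start in its invariant law. Hitting times are truncated
    because the full ones need not be integrable under the invariant law, and because the
    exponential inequality requires bounded increments. *)

Section Esum.
Variable R : realType.
Local Open Scope ereal_scope.

Lemma esum_le_term (T : choiceType) (a : T -> \bar R) (x : T) :
  (forall y, 0 <= a y) -> a x <= \esum_(y in [set: T]) a y.
Proof.
move=> a0; rewrite -[X in X <= _](@esum_set1 R T x a)//.
rewrite esum_mkcond; apply: le_esum => y _.
by case: ifP.
Qed.

Lemma esum_only (T : choiceType) (a : T -> \bar R) (x : T) :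
  0 <= a x -> (forall y, y != x -> a y = 0) -> \esum_(y in [set: T]) a y = a x.
Proof.
move=> ax0 a0; rewrite -[X in _ = X](@esum_set1 R T x a)//.
rewrite [in RHS]esum_mkcond; apply: eq_esum => y _.
case: ifPn => //; rewrite notin_setE /= => yx; rewrite a0//.
by apply/eqP.
Qed.

(** Finite subsums give one inequality; the other is the same inequality for the inverse constant,
    applied to the scaled family. *)
Lemma esumZl (T : choiceType) (S : set T) (c : R) (a : T -> \bar R) :
  (0 <= c)%R -> (forall x, S x -> 0 <= a x) ->
  \esum_(x in S) (c%:E * a x) = c%:E * \esum_(x in S) a x.
Proof.
move=> c0 a0; rewrite esum_mkcond [in RHS]esum_mkcond.
pose b x := if x \in S then a x else 0.
have b0 x : 0 <= b x by rewrite /b; case: ifPn => // /[!inE] /a0.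
rewrite (@eq_esum R T setT _ (fun x => c%:E * b x)); last first.
  by move=> x _; rewrite /b; case: ifP => // _; rewrite mule0.
rewrite -/b {a0}.
have le (c' : R) (b' : T -> \bar R) : (0 <= c')%R -> (forall x, 0 <= b' x) ->
    \esum_(x in [set: T]) (c'%:E * b' x) <= c'%:E * \esum_(x in [set: T]) b' x.
  move=> c'0 b'0; apply: ge_ereal_sup => _ [X [finX XS] <-].
  rewrite -ge0_mule_fsumr// lee_wpmul2l//.
  by apply: ereal_sup_ubound; exists X.
apply/eqP; rewrite eq_le le//=.
have : (0 == c)%R || (0 < c)%R by rewrite -le_eqVlt.
move=> {}/orP[/eqP <-|{}c0].
  by rewrite mul0e; apply: esum_ge0 => *; rewrite mul0e.
have eb : \esum_(x in [set: T]) b x =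
    \esum_(x in [set: T]) ((c^-1)%:E * (c%:E * b x)).
  by apply: eq_esum => x _; rewrite muleA -EFinM mulVf ?gt_eqF// mul1e.
apply: (@le_trans _ _ (c%:E * ((c^-1)%:E * \esum_(x in [set: T]) (c%:E * b x)))).
  rewrite eb; apply: lee_wpmul2l; first by rewrite lee_fin ltW.
  apply: (le _ (fun x => c%:E * b x)) => [|x].
    by rewrite invr_ge0 ltW.
  by rewrite mule_ge0// lee_fin ltW.
by rewrite muleA -EFinM mulfV ?gt_eqF// mul1e.
Qed.

(** The factor may be +oo here; then the sum is +oo as soon as one term is positive, and 0 otherwise
    by 0 * +oo = 0. *)
Lemma esumZr (T : choiceType) (c : \bar R) (a : T -> \bar R) :
  0 <= c -> (forall x, 0 <= a x) ->
  \esum_(x in [set: T]) (a x * c) = (\esum_(x in [set: T]) a x) * c.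
Proof.
case: c => [c|_ a0|//]; first rewrite lee_fin => c0 a0.
  by under eq_esum do rewrite muleC; rewrite esumZl// muleC.
have [allz|] := pselect (forall x, a x = 0).
  by rewrite !esum1 ?mul0e// => x _; rewrite allz ?mul0e.
move=> /existsNP[x ax0].
have ax : 0 < a x by rewrite lt_def a0 andbT; apply/eqP.
have ea : 0 < \esum_(x in [set: T]) a x by apply: lt_le_trans ax (esum_le_term _ a0).
rewrite gt0_muley//; apply/eqP; rewrite -leye_eq.
apply: (@le_trans _ _ (a x * +oo)); first by rewrite gt0_muley.
by apply: (esum_le_term (a := fun x => a x * +oo)) => y; rewrite mule_ge0.
Qed.

Lemma esum_pair (T1 T2 : choiceType) (a : T1 * T2 -> \bar R) :
  (forall z, 0 <= a z) ->
  \esum_(z in [set: T1 * T2]) a z =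
  \esum_(x in [set: T1]) \esum_(y in [set: T2]) a (x, y).
Proof.
move=> a0; rewrite (@esum_esum R T1 T2 setT (fun=> setT) (fun x y => a (x, y)))//.
rewrite (_ : setT `*`` _ = setT); last by apply/seteqP; split.
by apply: eq_esum => -[].
Qed.

Lemma esum_swap (T1 T2 : choiceType) (a : T1 -> T2 -> \bar R) :
  (forall x y, 0 <= a x y) ->
  \esum_(x in [set: T1]) \esum_(y in [set: T2]) a x y =
  \esum_(y in [set: T2]) \esum_(x in [set: T1]) a x y.
Proof.
move=> a0.
rewrite -(@esum_pair T1 T2 (fun z => a z.1 z.2))//.
rewrite -(@esum_pair T2 T1 (fun z => a z.2 z.1))//.
rewrite (@reindex_esum R (T2 * T1)%type (T1 * T2)%type setT setT
  (fun z => (z.2, z.1)))//.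
split=> //; first by move=> [x y] [x' y'] _ _ /= [-> ->].
by move=> [x y] _ /=; exists (y, x).
Qed.

Lemma esum_tail (T : choiceType) (a : T -> \bar R) (delta : R) :
  (forall x, 0 <= a x) -> \esum_(x in [set: T]) a x < +oo -> (0 < delta)%R ->
  exists2 A : set T, finite_set A & \esum_(x in ~` A) a x <= delta%:E.
Proof.
move=> a0 afin d0.
have afn : \esum_(x in [set: T]) a x \is a fin_num.
  by rewrite ge0_fin_numE// esum_ge0.
have : \esum_(x in [set: T]) a x - delta%:E < \esum_(x in [set: T]) a x.
  by rewrite lteBlDr// lteDl// lte_fin.
move=> /ereal_sup_gt[_ [A [finA _] <-]] h; exists A => //.
have := @esumID R T A setT a (fun x _ => a0 x); rewrite !setTI => e.
move: h; rewrite -esum_fset// => h.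
rewrite lteBlDr// in h.
have Afn : \esum_(x in A) a x \is a fin_num.
  rewrite ge0_fin_numE ?esum_ge0//; apply: le_lt_trans afin.
  by rewrite e leeDl// esum_ge0.
move: h; rewrite e lteD2lE// => h'; exact: ltW h'.
Qed.

End Esum.

(** * Countable unions and fibres in a probability space *)

Section CountableMeasure.
Context d (Omega : measurableType d) (R : realType).
Variable P : probability Omega R.
Local Open Scope ereal_scope.

Lemma measurable_bigcup_count (T : countType) (D : set T) (F : T -> set Omega) :
  (forall x, D x -> measurable (F x)) -> measurable (\bigcup_(x in D) F x).
Proof.
move=> mF.
rewrite (_ : \bigcup_(x in D) F x =
  \bigcup_n (if unpickle n is Some x then if x \in D then F x else set0 else set0)).
  apply: bigcupT_measurable => n; case: unpickle => // x.
  by case: ifPn => // /[!inE]; exact: mF.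
apply/seteqP; split.
  move=> w [x Dx Fx]; exists (pickle x) => //; rewrite pickleK ifT//.
  by rewrite inE.
move=> w [n _]; case: unpickle => [x|//].
by case: ifPn => // /[!inE] Dx Fx; exists x.
Qed.

Lemma measure_bigcup_count (T : countType) (F : T -> set Omega) :
  (forall x, measurable (F x)) -> trivIset setT F ->
  P (\bigcup_x F x) = \esum_(x in [set: T]) P (F x).
Proof.
move=> mF tF.
(* [pickle_inv] is defined only on the range of [pickle], so each F x is listed exactly once and
   disjointness is preserved. *)
pose G n := if pickle_inv n is Some x then F x else set0 : set Omega.
have mG n : measurable (G n) by rewrite /G; case: pickle_inv.
rewrite (_ : \bigcup_x F x = \bigcup_n G n); last first.
  apply/seteqP; split.
    by move=> w [x _ Fx]; exists (pickle x) => //; rewrite /G pickleK_inv.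
  by move=> w [n _]; rewrite /G; case: pickle_inv => // x Fx; exists x.
rewrite measure_bigcup//; last first.
  move=> m n _ _; rewrite /G.
  have := @pickle_invK T m; have := @pickle_invK T n; rewrite /obind/oapp.
  case: pickle_inv => [y|]; case: pickle_inv => [x|] => /=; try by move=> _ _ [w []].
  by move=> <- <- [w [Fx Fy]]; congr pickle; apply: tF => //; exists w.
rewrite nneseries_esum// set_mem_set.
rewrite (esumID (range (@pickle T)))// setTI setTI [X in _ + X]esum1 ?adde0; last first.
  move=> n /= nr; rewrite /G; have := @pickle_invK T n.
  rewrite /obind/oapp; case: pickle_inv => [x /= xn|_]; last exact: measure0.
  by case: nr; exists x.
rewrite (@reindex_esum R T nat setT _ (@pickle T)).
  by apply: eq_esum => x _; rewrite /G pickleK_inv.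
split=> //.
Qed.

Lemma measure_fibers (T : countType) (Z : Omega -> T) (A : set Omega) :
  measurable A -> (forall x, measurable (Z @^-1` [set x])) ->
  P A = \esum_(x in [set: T]) P (A `&` Z @^-1` [set x]).
Proof.
move=> mA mZ; rewrite -measure_bigcup_count.
- congr (P _); apply/seteqP; split=> [w Aw|w [x _ []//]].
  by exists (Z w).
- by move=> x; apply: measurableI.
- by move=> x y _ _ [w [[_ <-] [_ <-]]].
Qed.

Lemma probability_setD_sub (A B : set Omega) : measurable A -> measurable B ->
  B `<=` A -> P (A `\` B) = P A - P B.
Proof.
move=> mA mB BA; have := @measureD _ _ _ P A B mA mB.
by rewrite setIidr// => -> //; rewrite ltey_eq fin_num_measure.
Qed.

Lemma negligible_bigcup_count (T : countType) (F : T -> set Omega) :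
  (forall x, P.-negligible (F x)) -> P.-negligible (\bigcup_x F x).
Proof.
move=> nF; pose G n := if unpickle n is Some x then F x else set0 : set Omega.
apply: (@negligibleS _ _ _ _ (\bigcup_n G n)).
  by move=> w [x _ Fx]; exists (pickle x) => //; rewrite /G pickleK.
apply: negligible_bigcup => n; rewrite /G.
by case: unpickle => [x|]; [exact: nF|exact: negligible_set0].
Qed.

End CountableMeasure.

(** * Countable Markov chains *)

Section Expectation.
Variables (R : realType) (T : countType) (t : T -> T -> R).
Hypothesis t0 : forall x y, 0 <= t x y.
Local Open Scope ereal_scope.

(** Expectation of Phi(X_1, ..., X_n) for the chain started in x. The recursion on the first step
    gives first-step analysis by computation and avoids a measure on path space. *)
Fixpoint expect_from (n : nat) (x : T) (Phi : seq T -> \bar R) : \bar R :=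
  if n is m.+1 then
    \esum_(y in [set: T]) (t x y)%:E * expect_from m y (fun s => Phi (y :: s))
  else Phi [::].

Implicit Types (Phi Psi : seq T -> \bar R) (B : pred T).

Lemma expect_ge0 n x Phi : (forall s, 0 <= Phi s) -> 0 <= expect_from n x Phi.
Proof.
elim: n x Phi => //= n IH x Phi Phi0; apply: esum_ge0 => y _.
by rewrite mule_ge0 ?lee_fin// IH.
Qed.

Lemma le_expect n x Phi Psi : (forall s, size s = n -> Phi s <= Psi s) ->
  expect_from n x Phi <= expect_from n x Psi.
Proof.
elim: n x Phi Psi => [|n IH] x Phi Psi le /=; first exact: le.
apply: le_esum => y _; rewrite lee_wpmul2l ?lee_fin// IH// => s sn.
by rewrite le//= sn.
Qed.

Lemma eq_expect n x Phi Psi : (forall s, size s = n -> Phi s = Psi s) ->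
  expect_from n x Phi = expect_from n x Psi.
Proof.
by move=> e; apply/eqP; rewrite eq_le !le_expect// => s /e ->.
Qed.

Lemma expectD n x Phi Psi : (forall s, 0 <= Phi s) -> (forall s, 0 <= Psi s) ->
  expect_from n x (fun s => Phi s + Psi s) =
  expect_from n x Phi + expect_from n x Psi.
Proof.
elim: n x Phi Psi => //= n IH x Phi Psi Phi0 Psi0.
rewrite -esumD; first last.
- by move=> y _; rewrite mule_ge0 ?lee_fin// expect_ge0.
- by move=> y _; rewrite mule_ge0 ?lee_fin// expect_ge0.
by apply: eq_esum => y _; rewrite IH// muleDr// ge0_adde_def// inE expect_ge0.
Qed.

Lemma expectZ n x (c : R) Phi : (0 <= c)%R -> (forall s, 0 <= Phi s) ->
  expect_from n x (fun s => c%:E * Phi s) = c%:E * expect_from n x Phi.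
Proof.
elim: n x Phi => //= n IH x Phi c0 Phi0.
rewrite -esumZl//; last by move=> y _; rewrite mule_ge0 ?lee_fin// expect_ge0.
by apply: eq_esum => y _; rewrite IH// muleCA.
Qed.

Lemma esum_traj_weight n x Phi : (forall s, 0 <= Phi s) ->
  \esum_(s in [set: n.-tuple T]) ((traj_weight t x s)%:E * Phi s) =
  expect_from n x Phi.
Proof.
elim: n x Phi => [|n IH] x Phi Phi0 /=.
  rewrite (esum_only (x := [tuple])) ?mul1e//.
  by move=> s /eqP; rewrite tuple0.
rewrite (@reindex_esum R (T * n.-tuple T)%type _ setT setT
  (fun z => [tuple of z.1 :: z.2])); last first.
  split=> //.
    move=> [y s] [y' s'] _ _ /= /(congr1 val) /= [-> e].
    by congr pair; exact: val_inj.
  move=> s _ /=; exists (thead s, [tuple of behead s]) => //=.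
  by rewrite [RHS]tuple_eta.
rewrite esum_pair; last first.
  move=> [y s] /=; rewrite mule_ge0// lee_fin.
  have : (0 <= traj_weight t y s)%R by elim: (val s) y => //= z r IHr y; rewrite mulr_ge0.
  by move=> ?; rewrite mulr_ge0.
apply: eq_esum => y _ /=; rewrite -IH// -esumZl//.
  by apply: eq_esum => s _; rewrite EFinM muleA.
move=> s _; rewrite mule_ge0// lee_fin.
by elim: (val s) y => //= z r IHr y; rewrite mulr_ge0.
Qed.

Lemma prob_from_expect n x (A : set (nat -> T)) :
  prob_from t x n A =
  expect_from n x (fun s => (`[< A (nth x (x :: s)) >])%:R%:E).
Proof.
rewrite -esum_traj_weight; last by move=> s; rewrite lee_fin.
rewrite /prob_from esum_mkcond; apply: eq_esum => s _.
case: asboolP => h; first by rewrite mule1 ifT// inE.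
by rewrite mule0 ifN// notin_setE.
Qed.

(** Taboo probability: B is avoided at times 0, ..., n - 1, but not necessarily at n. With B = {y}
    it gives first hitting probabilities, with B the ancestor of x the coefficients of F and of
    Gbar. *)
Definition taboo B x y n : \bar R :=
  expect_from n x
    (fun s => ((last x s == y) && all (predC B) (belast x s))%:R%:E).

Lemma taboo_ge0 B x y n : 0 <= taboo B x y n.
Proof. by apply: expect_ge0 => s; rewrite lee_fin. Qed.

Lemma taboo0 B x y : taboo B x y 0 = (x == y)%:R%:E.
Proof. by rewrite /taboo /= andbT. Qed.

Lemma tabooS B x y n : taboo B x y n.+1 =
  if B x then 0 else \esum_(z in [set: T]) (t x z)%:E * taboo B z y n.
Proof.
rewrite /taboo /=; case: ifPn => Bx.
  apply: esum1 => z _; rewrite (@eq_expect _ _ _ (fun=> 0%:E * 0)) ?expectZ ?mul0e ?mule0//.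
  by move=> s _; rewrite andbF.
by apply: eq_esum => z _; congr (_ * _); apply: eq_expect => s _.
Qed.

Lemma taboo_pathP B x y z n (s : seq T) : size s = n ->
  reflect (nth z (x :: s) n = y /\ forall m, (m < n)%N -> ~~ B (nth z (x :: s) m))
          ((last x s == y) && all (predC B) (belast x s)).
Proof.
move=> sn; apply: (iffP andP).
  move=> [/eqP <- /(all_nthP z)]; rewrite size_belast sn => Ym.
  split; first by rewrite -sn (last_nth z).
  by move=> m mn; rewrite lastI nth_rcons size_belast sn mn; exact: Ym.
move=> [Yn Ym]; split; first by rewrite -Yn -sn (last_nth z).
apply/(all_nthP z) => m; rewrite size_belast sn => mn /=.
by have := Ym _ mn; rewrite lastI nth_rcons size_belast sn mn.
Qed.

Lemma prob_from_taboo B x y n :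
  prob_from t x n [set Y | Y n = y /\ forall m, (m < n)%N -> ~~ B (Y m)] =
  taboo B x y n.
Proof.
rewrite prob_from_expect; apply: eq_expect => s sn; congr (nat_of_bool _)%:R%:E.
by apply/idP/idP => [/asboolP/(taboo_pathP _ _ _ _ sn)//|/(taboo_pathP _ _ _ x sn)/asboolP].
Qed.

(** A first return ignores the visit at time 0, which [taboo] would forbid; splitting off the first
    step reconciles the two. *)
Lemma first_return_taboo x n : first_return t x n.+1 =
  \esum_(y in [set: T]) (t x y)%:E * taboo (pred1 x) y x n.
Proof.
rewrite /first_return prob_from_expect /=; apply: eq_esum => y _; congr (_ * _).
apply: eq_expect => s sn; congr (nat_of_bool _)%:R%:E.
apply/idP/idP => [/asboolP /= [Yn Ym]|/(taboo_pathP _ _ _ x sn) [Yn Ym]].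
  apply/(taboo_pathP _ _ _ x sn); split=> // m mn; apply/eqP.
  exact: (Ym m.+1).
apply/asboolP; split=> // -[//|m] mn /=.
by apply/eqP; apply: Ym.
Qed.

Hypothesis t1 : forall x, \esum_(y in [set: T]) (t x y)%:E = 1.

Lemma expect_cst n x (c : R) : (0 <= c)%R -> expect_from n x (fun=> c%:E) = c%:E.
Proof.
elim: n x => //= n IH x c0.
under eq_esum do rewrite IH// muleC.
by rewrite esumZl ?t1 ?mule1// => y _; rewrite lee_fin.
Qed.

Lemma expect_take n x Phi : (forall s, 0 <= Phi s) -> (forall s, Phi s \is a fin_num) ->
  expect_from n.+1 x (fun s => Phi (take n s)) = expect_from n x Phi.
Proof.
elim: n x Phi => [|n IH] x Phi Phi0 Phif.
  rewrite /=; under eq_esum do rewrite muleC -(fineK (Phif _)).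
  rewrite esumZl ?t1 ?mule1 ?fineK//; first by rewrite fine_ge0.
  by move=> y _; rewrite lee_fin.
rewrite [LHS]/= [RHS]/=; apply: eq_esum => y _; congr (_ * _).
by rewrite -(IH y (fun s => Phi (y :: s))).
Qed.

(** As y lies in B, the summands are the probabilities of entering B for the first time at time k
    and in y; these events are disjoint. *)
Lemma sum_taboo_le1 B x y n : B y -> \sum_(0 <= k < n) taboo B x y k <= 1.
Proof.
move=> By; elim: n x => [|n IH] x; first by rewrite big_geq// lee_fin.
rewrite big_nat_recl// taboo0.
have [Bx|Bx] := boolP (B x).
  rewrite big1_seq ?adde0; first by case: eqP => _; rewrite lee_fin.
  by move=> k _; rewrite tabooS Bx.
have /negPf -> : x != y by apply: contraNneq Bx => ->.
rewrite add0e; under eq_bigr do rewrite tabooS (negPf Bx).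
rewrite -esum_sum; last first.
  by move=> z k _ _; rewrite mule_ge0 ?taboo_ge0 ?lee_fin.
rewrite -(t1 x); apply: le_esum => z _.
rewrite -ge0_sume_distrr; last by move=> k _; exact: taboo_ge0.
by rewrite -[leRHS]mule1 lee_wpmul2l ?lee_fin.
Qed.

Lemma nneseries_taboo_le1 B x y : B y -> \sum_(0 <= k <oo) taboo B x y k <= 1.
Proof.
move=> By; apply: lime_le.
  by apply: is_cvg_nneseries => k _ _; exact: taboo_ge0.
by apply: nearW => n; exact: sum_taboo_le1.
Qed.

End Expectation.

(** * Restarting a process at an event of the past *)

Section MarkovAt.
Context d (Omega : measurableType d) (R : realType).
Variable P : probability Omega R.
Variables (T : countType) (t : T -> T -> R) (Z : nat -> Omega -> T).
Hypothesis t0 : forall x y, 0 <= t x y.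
Hypothesis mZ : forall n x, measurable (Z n @^-1` [set x]).
Local Open Scope ereal_scope.

(* On H, which forces Z_n = x, the process restarts at time n as a chain from
   x; H plays the role of an event of the past. *)
Definition markov_at (n : nat) (x : T) (H : set Omega) : Prop :=
  [/\ measurable H, H `<=` Z n @^-1` [set x] &
      forall m (s : nat -> T), s 0%N = x ->
        P (H `&` [set w | forall k, (k <= m)%N -> Z (n + k)%N w = s k]) =
        P H * (\prod_(k < m) t (s k) (s k.+1))%:E].

Lemma markov_at_set0 n x : markov_at n x set0.
Proof. by split=> // m s _; rewrite set0I measure0 mul0e. Qed.

Lemma markov_at_step n x y H : markov_at n x H ->
  markov_at n.+1 y (H `&` Z n.+1 @^-1` [set y]) /\
  P (H `&` Z n.+1 @^-1` [set y]) = P H * (t x y)%:E.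
Proof.
move=> [mH Hx HP].
have step : P (H `&` Z n.+1 @^-1` [set y]) = P H * (t x y)%:E.
  have := HP 1%N (fun k => if k is 0 then x else y) erefl.
  rewrite big_ord1 => <-; congr (P _); apply/seteqP; split.
    move=> w [Hw /= Zy]; split=> // -[|[|//]] _; rewrite ?addn0 ?addn1//.
    exact: Hx.
  by move=> w [Hw /= Zy]; split=> //=; rewrite -addn1 Zy.
split=> //; split; first exact: measurableI.
  by move=> w [].
move=> m s sy.
have := HP m.+1 (fun k => if k is k'.+1 then s k' else x) erefl.
rewrite step -muleA -EFinM big_ord_recl sy => <-; congr (P _).
apply/seteqP; split.
  move=> w [[Hw /= Zy] Zs]; split=> // -[|k] km; first by rewrite addn0; exact: Hx.
  by rewrite addnS -addSn Zs.
move=> w [Hw /= Zs]; split.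
  by split=> //=; rewrite -addn1 Zs.
by move=> k km; rewrite addSn -addnS Zs.
Qed.

(** The restart property is linear in the measure of H, so it passes to disjoint unions with the
    same time and state. *)
Lemma markov_at_bigcup (I : countType) n x (F : I -> set Omega) :
  (forall i, markov_at n x (F i)) -> trivIset setT F ->
  markov_at n x (\bigcup_i F i).
Proof.
move=> HF tF; have mF i : measurable (F i) by case: (HF i).
split; first exact: measurable_bigcup_count.
  by move=> w [i _]; case: (HF i) => _ Fx _ /Fx.
move=> m s sx; have p0 : (0 <= \prod_(k < m) t (s k) (s k.+1))%R.
  by apply: prodr_ge0.
rewrite setI_bigcupl !measure_bigcup_count//.
- rewrite [RHS]muleC -esumZl//; apply: eq_esum => i _.
  by have [_ _ h] := HF i; rewrite (h m s sx) muleC.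
- move=> i; apply: measurableI => //.
  rewrite (_ : [set w | _] = \bigcap_(k in `I_m.+1) Z (n + k)%N @^-1` [set s k]).
    by apply: bigcap_measurable => //; exists 0%N.
  by [].
- by move=> i j _ _ [w [[? _] [? _]]]; apply: tF => //; exists w.
Qed.

Fixpoint traj (n m : nat) (w : Omega) : seq T :=
  if m is m'.+1 then Z n.+1 w :: traj n.+1 m' w else [::].

Lemma markov_at_expect n m x H (A : pred (seq T)) : markov_at n x H ->
  measurable (H `&` [set w | A (traj n m w)]) /\
  P (H `&` [set w | A (traj n m w)]) =
  P H * expect_from t m x (fun s => (A s)%:R%:E).
Proof.
elim: m n x H A => [|m IH] n x H A HH.
  have [mH _ _] := HH; rewrite /=; case: (A [::]).
    by rewrite mule1 (_ : [set w | true] = setT) ?setIT//; apply/seteqP; split.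
  rewrite mule0 (_ : [set w | false] = set0) ?setI0 ?measure0//.
  by apply/seteqP; split.
have E : H `&` [set w | A (traj n m.+1 w)] = \bigcup_y ((H `&` Z n.+1 @^-1` [set y])
    `&` [set w | A (y :: traj n.+1 m w)]).
  apply/seteqP; split=> [w [Hw /= Aw]|w [y _ [[Hw /= <-] Aw]]//].
  by exists (Z n.+1 w).
have S y := IH n.+1 y _ (fun s => A (y :: s)) (markov_at_step y HH).1.
have M y := (S y).1.
rewrite E; split; first exact: measurable_bigcup_count.
rewrite measure_bigcup_count//; last first.
  by move=> y z _ _ [w [[[_ <-] _] [[_ <-] _]]].
have [mH _ _] := HH.
have Pf : P H \is a fin_num by exact: fin_num_measure.
rewrite /= -(fineK Pf) -esumZl ?fine_ge0//; last first.
  by move=> y _; rewrite mule_ge0 ?lee_fin// expect_ge0.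
apply: eq_esum => y _.
by rewrite (S y).2 (markov_at_step y HH).2 -muleA fineK.
Qed.

(** The new event is again an admissible past, so that stages (wait, step, loop) can be chained. *)
Lemma markov_at_taboo n m (x y : T) H (B : pred T) : markov_at n x H ->
  let H' := H `&` [set w | Z (n + m)%N w = y /\ forall q, (q < m)%N -> ~~ B (Z (n + q)%N w)] in
  markov_at (n + m) y H' /\ P H' = P H * taboo t B x y m.
Proof.
elim: m n x H => [|m IH] n x H HH /=; have [mH Hx _] := HH.
  rewrite addn0 taboo0; have [xy|xy] := eqVneq x y.
    rewrite -xy mule1 (_ : _ `&` _ = H)//.
    by apply/seteqP; split=> [w []//|w Hw]; split=> //; split=> //; exact: Hx.
  rewrite mule0 (_ : _ `&` _ = set0) ?measure0.
    by split=> //; exact: markov_at_set0.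
  apply/seteqP; split=> // w [/Hx /= -> [/eqP]].
  by rewrite (negPf xy).
rewrite tabooS//; case: ifPn => Bx.
  rewrite mule0 (_ : _ `&` _ = set0) ?measure0.
    by split=> //; exact: markov_at_set0.
  apply/seteqP; split=> // w [/Hx /= Zx [_ /(_ 0%N erefl)]].
  by rewrite addn0 Zx Bx.
pose F z := (H `&` Z n.+1 @^-1` [set z]) `&`
  [set w | Z (n.+1 + m)%N w = y /\ forall q, (q < m)%N -> ~~ B (Z (n.+1 + q)%N w)].
have S z := IH n.+1 z _ (markov_at_step z HH).1.
have -> : H `&` [set w | Z (n + m.+1)%N w = y /\
    (forall q, (q < m.+1)%N -> ~~ B (Z (n + q)%N w))] = \bigcup_z F z.
  apply/seteqP; split.
    move=> w [Hw [Zy ZB]]; exists (Z n.+1 w) => //; split=> //; split.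
      by rewrite addSnnS.
    by move=> q qm; rewrite addSnnS ZB.
  move=> w [z _ [[Hw /= Zz] [Zy ZB]]]; split=> //; split; first by rewrite -addSnnS.
  move=> [|q] qm; first by rewrite addn0 (Hx _ Hw).
  by rewrite -addSnnS ZB.
have tF : trivIset setT F by move=> u v _ _ [w [[[_ <-] _] [[_ <-] _]]].
split.
  apply: markov_at_bigcup => // z.
  by rewrite -addSnnS; exact: (S z).1.
rewrite measure_bigcup_count//; last by move=> z; case: (S z) => -[].
have Pf : P H \is a fin_num by exact: fin_num_measure.
rewrite -(fineK Pf) -esumZl ?fine_ge0//; last first.
  by move=> z _; rewrite mule_ge0 ?lee_fin// taboo_ge0.
apply: eq_esum => z _.
by rewrite (S z).2 (markov_at_step z HH).2 -muleA fineK.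
Qed.

(** Decomposition by the first hitting time of y, which makes the union disjoint. *)
Lemma markov_at_hit n (x y : T) H : markov_at n x H ->
  let H' := H `&` [set w | exists q, Z (n + q)%N w = y] in
  measurable H' /\ P H' = P H * \sum_(0 <= k <oo) taboo t (pred1 y) x y k.
Proof.
move=> HH; have [mH Hx _] := HH.
pose F m := H `&` [set w | Z (n + m)%N w = y /\ forall q, (q < m)%N -> ~~ pred1 y (Z (n + q)%N w)].
have S m := markov_at_taboo m y (pred1 y) HH.
have mF m : measurable (F m) by case: (S m) => -[].
rewrite /= (_ : _ `&` _ = \bigcup_m F m); last first.
  apply/seteqP; split=> [w [Hw /= exq]|w [q _ [Hw [Zq _]]]]; last first.
    by split=> //; exists q.
  have exq' : exists q, Z (n + q)%N w == y by case: exq => q /eqP; exists q.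
  exists (ex_minn exq') => //; split=> //=; case: ex_minnP => q /eqP Zq min.
  by split=> // r rq; apply/negP => /min; rewrite leqNgt rq.
split; first exact: bigcupT_measurable.
rewrite measure_bigcup_count//; last first.
  move=> i j _ _ [w [[_ [/eqP Zi ni]] [_ [/eqP Zj nj]]]].
  apply/eqP; case: ltngtP => // [/nj|/ni]; first by rewrite /= Zi.
  by rewrite /= Zj.
have Pf : P H \is a fin_num by exact: fin_num_measure.
rewrite nneseries_esumT; last by move=> k; exact: taboo_ge0.
rewrite -(fineK Pf) -esumZl ?fine_ge0//; last by move=> k _; exact: taboo_ge0.
by apply: eq_esum => m _; rewrite (S m).2 fineK.
Qed.

Lemma markov_at_return n x H : markov_at n x H ->
  let H' := H `&` [set w | exists q, Z (n + q.+1)%N w = x] in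
  measurable H' /\ P H' = P H * return_prob t x.
Proof.
move=> HH; have [mH Hx _] := HH.
pose F y := (H `&` Z n.+1 @^-1` [set y]) `&`
  [set w | exists q, Z (n.+1 + q)%N w = x].
have S y := markov_at_hit x (markov_at_step y HH).1.
have mF y : measurable (F y) by case: (S y).
rewrite /= (_ : _ `&` _ = \bigcup_y F y); last first.
  apply/seteqP; split=> [w [Hw [q Zq]]|w [y _ [[Hw /= _] [q Zq]]]].
    by exists (Z n.+1 w) => //; split=> //; exists q; rewrite addSnnS.
  by split=> //; exists q; rewrite -addSnnS.
split; first exact: measurable_bigcup_count.
rewrite measure_bigcup_count//; last first.
  by move=> y z _ _ [w [[[_ <-] _] [[_ <-] _]]].
have Pf : P H \is a fin_num by exact: fin_num_measure.
under eq_esum => y _ do rewrite (S y).2 (markov_at_step y HH).2 -muleA -(fineK Pf).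
have tb0 y : 0 <= \sum_(0 <= k <oo) taboo t (pred1 x) y x k.
  by apply: nneseries_ge0 => k _ _; exact: taboo_ge0.
rewrite esumZl ?fine_ge0//; last by move=> y _; rewrite mule_ge0 ?lee_fin.
rewrite fineK//; congr (_ * _).
rewrite /return_prob -nneseries_addn; last first.
  by move=> k; rewrite /first_return prob_from_expect// expect_ge0// => r; rewrite lee_fin.
under [RHS]eq_eseriesr => k _ do rewrite addn1 first_return_taboo//.
rewrite [RHS]nneseries_esumT; last first.
  by move=> k; apply: esum_ge0 => y _; rewrite mule_ge0 ?lee_fin ?taboo_ge0.
rewrite esum_swap; last by move=> k y; rewrite mule_ge0 ?lee_fin ?taboo_ge0.
apply: eq_esum => y _; rewrite esumZl//; last by move=> k _; rewrite taboo_ge0.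
by rewrite nneseries_esumT// => k; rewrite taboo_ge0.
Qed.

Lemma markov_at_avoid n (x y : T) H :
  (forall x, \esum_(y in [set: T]) (t x y)%:E = 1) -> markov_at n x H ->
  let H' := H `&` [set w | forall q, Z (n + q)%N w <> y] in
  measurable H' /\
  P H' = P H * (1 - \sum_(0 <= k <oo) taboo t (pred1 y) x y k).
Proof.
move=> t1 HH; have [mH Hx _] := HH; have [mK PK] := markov_at_hit y HH.
rewrite /= (_ : _ `&` _ = H `\` (H `&` [set w | exists q, Z (n + q)%N w = y])).
  split; first exact: measurableD.
  rewrite probability_setD_sub//.
  rewrite PK muleBr ?mule1 ?fin_num_measure// fin_num_adde_defr//.
apply/seteqP; split=> [w [Hw /= Zy]|w [Hw nHZ]]; split=> //.
  by move=> [_ [q]]; exact: Zy.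
by move=> q Zq; apply: nHZ; split=> //; exists q.
Qed.

Lemma markov_at_no_return n x H : markov_at n x H ->
  let H' := H `&` [set w | forall q, Z (n + q.+1)%N w <> x] in
  measurable H' /\ P H' = P H * (1 - return_prob t x).
Proof.
move=> HH; have [mH Hx _] := HH; have [mK PK] := markov_at_return HH.
rewrite /= (_ : _ `&` _ = H `\` (H `&` [set w | exists q, Z (n + q.+1)%N w = x])).
  split; first exact: measurableD.
  rewrite probability_setD_sub//.
  rewrite PK muleBr ?mule1 ?fin_num_measure// fin_num_adde_defr//.
apply/seteqP; split=> [w [Hw /= Zy]|w [Hw nHZ]]; split=> //.
  by move=> [_ [q]]; exact: Zy.
by move=> q Zq; apply: nHZ; split=> //; exists q.
Qed.

(** Passes from the product form of the Markov property to [markov_at]. The event B allows a process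
    that is Markov only after restriction to B, as the exit chain is on each first exit event. *)
Lemma markov_at_init (B : set Omega) (x : T) : measurable B ->
  (forall (n : nat) (s : nat -> T),
     P (B `&` [set w | forall k, (k <= n.+1)%N -> Z k w = s k]) =
     P (B `&` [set w | forall k, (k <= n)%N -> Z k w = s k])
       * (t (s n) (s n.+1))%:E) ->
  markov_at 0 x (B `&` Z 0%N @^-1` [set x]).
Proof.
move=> mB law; split; [exact: measurableI|by move=> w []|].
move=> m s sx; have E k : (B `&` Z 0%N @^-1` [set x]) `&`
    [set w | forall i, (i <= k)%N -> Z (0 + i)%N w = s i] =
    B `&` [set w | forall i, (i <= k)%N -> Z i w = s i].
  apply/seteqP; split=> [w [[Bw _] Zs]//|w [Bw /= Zs]]; split=> //; split=> //=.
  by rewrite Zs.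
rewrite E; elim: m => [|m IH].
  rewrite big_ord0 mule1; congr (P (B `&` _)).
  apply/seteqP; split=> [w /= /(_ 0%N)->//|w /= Zx i]; rewrite leqn0 => /eqP ->.
  by rewrite sx.
by rewrite law IH big_ord_recr /= EFinM muleA.
Qed.

End MarkovAt.

(** * The ergodic theorem *)

Section MaximalSum.
Variables (R : realType) (T : countType) (f : T -> R) (lam : R).
Hypotheses (f0 : forall x, 0 <= f x) (lam0 : 0 <= lam).

(* The maximum over the prefixes l' of l, including the empty one, of the sum
   of [f - lam] over l'. *)
Fixpoint max_sum (l : seq T) : R :=
  if l is z :: l' then Num.max 0 (f z - lam + max_sum l') else 0.

Lemma max_sum_ge0 l : 0 <= max_sum l.
Proof. by case: l => //= z l; rewrite le_max lexx. Qed.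

Lemma max_sum_take n l : max_sum (take n l) <= max_sum l.
Proof.
elim: l n => [|z l IH] [|n] //=; first by rewrite le_max lexx.
by rewrite ge_max !le_max lexx /= lerD2l IH orbT.
Qed.

Lemma sum_le_max_sum k l : (k <= size l)%N ->
  \sum_(z <- take k l) (f z - lam) <= max_sum l.
Proof.
elim: l k => [|z l IH] [|k] //= kl; rewrite ?big_nil//; first by rewrite le_max lexx.
by rewrite big_cons le_max lerD2l IH ?orbT.
Qed.

(* Garsia's inequality behind the maximal ergodic theorem. *)
Lemma max_sum_cons z l :
  max_sum (z :: l) + lam * (0 < max_sum (z :: l))%R%:R <= f z + max_sum l.
Proof.
rewrite [max_sum (z :: l)]/=; have [le0|gt0] := leP (f z - lam + max_sum l) 0.
  by rewrite ltxx mulr0 addr0 addr_ge0// max_sum_ge0.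
by rewrite gt0 mulr1; lra.
Qed.

End MaximalSum.

Section Ergodic.
Variables (R : realType) (T : countType) (t : T -> T -> R) (pi : T -> R).
Hypothesis t0 : forall x y, 0 <= t x y.
Hypothesis t1 : forall x, (\esum_(y in [set: T]) (t x y)%:E = 1)%E.
Hypothesis pi0 : forall x, 0 <= pi x.
Hypothesis pit : forall y, (\esum_(x in [set: T]) (pi x * t x y)%:E = (pi y)%:E)%E.

Definition mean (f : T -> R) : \bar R := (\esum_(x in [set: T]) (pi x * f x)%:E)%E.

Section Maximal.
Variables (f : T -> R) (lam : R).
Hypotheses (f0 : forall x, 0 <= f x) (lam0 : 0 < lam).
Local Open Scope ereal_scope.

(** Expectation of Phi(X_0, ..., X_n) when X_0 is distributed according to pi. *)
Let Epi n (Phi : seq T -> \bar R) :=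
  \esum_(x in [set: T]) (pi x)%:E * expect_from t n x (fun s => Phi (x :: s)).

(** Stationarity: the path without its first point has the law of the shorter path. *)
Let Epi_shift n Phi : (forall s, 0 <= Phi s) ->
  \esum_(x in [set: T]) (pi x)%:E * expect_from t n.+1 x Phi = Epi n Phi.
Proof.
move=> Phi0; rewrite /=.
under eq_esum => x _.
  rewrite -esumZl//; last by move=> y _; rewrite mule_ge0 ?lee_fin ?expect_ge0.
over.
rewrite esum_swap; last first.
  by move=> x y; rewrite !mule_ge0 ?lee_fin ?expect_ge0.
apply: eq_esum => y _.
under eq_esum do rewrite muleA -EFinM muleC.
rewrite (@eq_esum _ _ _ _ (fun x => (pi x * t x y)%:E *
    expect_from t n y (fun s => Phi (y :: s)))); last by move=> x _; rewrite muleC.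
rewrite esumZr ?pit ?expect_ge0// => x.
by rewrite lee_fin mulr_ge0.
Qed.

Let A n := Epi n (fun l => (max_sum f lam l)%:E).
Let I n := Epi n (fun l => (0 < max_sum f lam l)%R%:R%:E).

Let lam_ge0 : (0 <= lam)%R := ltW lam0.

Let max0 l : 0 <= (max_sum f lam l)%:E :> \bar R.
Proof. by rewrite lee_fin max_sum_ge0. Qed.

Let ind0 l : 0 <= (0 < max_sum f lam l)%R%:R%:E :> \bar R.
Proof. by rewrite lee_fin. Qed.

Let mean_ge0 : 0 <= mean f.
Proof. by apply: esum_ge0 => x _; rewrite lee_fin mulr_ge0. Qed.

(** [max_sum_cons] integrated over a stationary path; the maximum over the path without its first
    point has mean A n by [Epi_shift]. *)
Let garsia n : A n.+1 + lam%:E * I n.+1 <= mean f + A n.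
Proof.
rewrite /A -(@Epi_shift n (fun l => (max_sum f lam l)%:E))// /I /Epi -esumZl//; last first.
  by move=> x _; rewrite mule_ge0 ?lee_fin ?expect_ge0.
rewrite /mean -!esumD; first last.
- by move=> x _; rewrite !mule_ge0 ?lee_fin ?expect_ge0//.
- by move=> x _; rewrite mule_ge0 ?lee_fin ?expect_ge0.
- by move=> x _; rewrite mule_ge0 ?lee_fin ?expect_ge0.
- by move=> x _; rewrite lee_fin mulr_ge0.
apply: le_esum => x _; rewrite muleCA -muleDr//; last first.
  by apply: ge0_adde_def; rewrite inE ?mule_ge0 ?lee_fin ?expect_ge0.
rewrite EFinM -muleDr//.
rewrite lee_wpmul2l ?lee_fin// -expectZ// -expectD//; last first.
  by move=> s; rewrite mule_ge0 ?lee_fin.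
rewrite -(expect_cst t0 t1 n.+1 x (f0 x)) -expectD//; last by move=> s; rewrite lee_fin.
apply: le_expect => // s _; rewrite -EFinM -!EFinD lee_fin.
exact: max_sum_cons.
Qed.

Let A_le n : A n <= A n.+1.
Proof.
apply: le_esum => x _; rewrite lee_wpmul2l ?lee_fin//.
rewrite -(@expect_take _ _ _ t0 t1 n x (fun s => (max_sum f lam (x :: s))%:E))//.
apply: le_expect => // s _; rewrite lee_fin.
exact: (max_sum_take f lam n.+1 (x :: s)).
Qed.

Let A_fin n : mean f < +oo -> A n < +oo.
Proof.
move=> ff; elim: n => [|n IH]; last first.
  apply: le_lt_trans (lte_add_pinfty ff IH); apply: le_trans (garsia n).
  rewrite leeDl// mule_ge0 ?lee_fin//; apply: esum_ge0 => x _.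
  by rewrite mule_ge0 ?lee_fin ?expect_ge0.
apply: le_lt_trans ff; apply: le_esum => x _ /=.
rewrite -EFinM lee_fin ler_wpM2l// ge_max f0/= addr0 gerBl.
by [].
Qed.

(** In [garsia], A n is at most A n.+1 and both are finite, so they cancel. Keeping only the summand
    of the starting state x then yields a bound for the chain started in x, with the factor pi x. *)
Lemma maximal_inequality n x :
  (pi x * lam)%:E * expect_from t n.+1 x
    (fun s => (0 < max_sum f lam (x :: s))%R%:R%:E) <= mean f.
Proof.
have [ff|] := ltP (mean f) +oo; last by rewrite leye_eq => /eqP ->; exact: leey.
apply: (@le_trans _ _ (lam%:E * I n.+1)).
  rewrite mulrC EFinM -muleA lee_wpmul2l ?lee_fin//.
  apply: (esum_le_term (a := fun x => (pi x)%:E * expect_from t n.+1 x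
    (fun s => (0 < max_sum f lam (x :: s))%R%:R%:E))) => y.
  by rewrite mule_ge0 ?lee_fin ?expect_ge0.
have := le_trans (garsia n) (leeD2l (mean f) (A_le n)).
rewrite addeC leeD2rE// ge0_fin_numE; first exact: A_fin.
by apply: esum_ge0 => y _; rewrite mule_ge0 ?lee_fin ?expect_ge0.
Qed.

End Maximal.
End Ergodic.

Lemma sum_mkseq (R : nmodType) (T : Type) (g : T -> R) (h : nat -> T) k :
  \sum_(y <- mkseq h k) g y = \sum_(i < k) g (h i).
Proof. by rewrite /mkseq big_map -[X in iota _ X]subn0 big_mkord. Qed.

Lemma take_mkseq (T : Type) (h : nat -> T) k m : (k <= m)%N ->
  take k (mkseq h m) = mkseq h k.
Proof. by move=> km; rewrite /mkseq -map_take take_iota (minn_idPl km). Qed.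

Lemma traj_mkseq d (Omega : measurableType d) (T : countType) (Z : nat -> Omega -> T) n m w :
  traj Z n m w = mkseq (fun i => Z (n + i.+1)%N w) m.
Proof.
elim: m n => [//|m IH] n; rewrite /= IH /mkseq /= addn1; congr (_ :: _).
rewrite (iotaDl 1 0 m) -map_comp; apply: eq_map => i /=.
by rewrite addSnnS.
Qed.

Lemma traj0_mkseq d (Omega : measurableType d) (T : countType) (Z : nat -> Omega -> T) m w :
  Z 0%N w :: traj Z 0 m w = mkseq (Z ^~ w) m.+1.
Proof.
rewrite traj_mkseq /mkseq /= (iotaDl 1 0 m) -map_comp; congr (_ :: _).
Qed.

Section ErgodicPaths.
Context d (Omega : measurableType d) (R : realType).
Variable P : probability Omega R.
Variables (T : countType) (t : T -> T -> R) (pi : T -> R) (Z : nat -> Omega -> T).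
Hypothesis t0 : forall x y, 0 <= t x y.
Hypothesis t1 : forall x, (\esum_(y in [set: T]) (t x y)%:E = 1)%E.
Hypothesis pi0 : forall x, 0 <= pi x.
Hypothesis pit : forall y, (\esum_(x in [set: T]) (pi x * t x y)%:E = (pi y)%:E)%E.
Hypothesis mZ : forall n x, measurable (Z n @^-1` [set x]).
Variables (z : T) (H : set Omega).
Hypotheses (HH : markov_at P t Z 0 z H) (piz : 0 < pi z).

(** For each j the event lies in the one where some partial average of f j exceeds lam, whose
    probability is at most mean (f j) / (pi z * lam); these bounds have infimum 0. *)
Lemma negligible_maximal (f : nat -> T -> R) (lam : R) :
  (forall j x, 0 <= f j x) -> 0 < lam ->
  (forall delta, 0 < delta -> exists j, (mean pi (f j) <= delta%:E)%E) ->
  P.-negligible (H `&` [set w |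
    forall j, exists k, lam * k.+1%:R < \sum_(i < k.+1) f j (Z i w)]).
Proof.
move=> f0 lam0 fj; have [mH Hz _] := HH.
pose A j (s : seq T) := 0 < max_sum (f j) lam (z :: s).
pose U j n := H `&` [set w | A j (traj Z 0 n.+1 w)].
have mU j n : measurable (U j n) by case: (markov_at_expect t0 mZ n.+1 (A j) HH).
have PU j n : ((pi z * lam)%:E * P (U j n) <= mean pi (f j))%E.
  have [_ ->] := markov_at_expect t0 mZ n.+1 (A j) HH.
  apply: le_trans (maximal_inequality t0 t1 pi0 pit (f0 j) lam0 n z).
  rewrite muleCA -[leRHS]mul1e lee_wpmul2r ?probability_le1//.
  apply: mule_ge0; first by rewrite lee_fin mulr_ge0// ltW.
  by apply: expect_ge0 => // s; rewrite lee_fin.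
pose V j := \bigcup_n U j n.
have mV j : measurable (V j) by exact: bigcupT_measurable.
have PV j c : (mean pi (f j) <= c%:E)%E -> (P (V j) <= (c / (pi z * lam))%:E)%E.
  (* The events U j n increase with n since [max_sum] grows with the path, so a bound uniform in n
     passes to the union. *)
  move=> fc; have cvgU : P \o U j @ \oo --> P (V j).
    apply: nondecreasing_cvg_mu => //; first exact: bigcupT_measurable.
    apply/nondecreasing_seqP => n; rewrite subsetEset => w [Hw Aw]; split=> //.
    apply: lt_le_trans Aw _.
    have Zz : z = Z 0%N w by rewrite (Hz _ Hw).
    rewrite Zz !traj0_mkseq -(@take_mkseq _ _ n.+2 n.+3)//.
    exact: max_sum_take.
  rewrite -(cvg_lim _ cvgU)//; apply: lime_le.
    by apply/cvg_ex; exists (P (V j)).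
  apply: nearW => n /=; have pl : 0 < pi z * lam by rewrite mulr_gt0.
  rewrite mulrC EFinM lee_pdivlMl//.
  exact: le_trans fc.
exists (\bigcap_j V j); split.
- exact: bigcapT_measurable.
- apply/eqP; rewrite eq_le measure_ge0 andbT; apply/lee_addgt0Pr => e e0.
  have pl : 0 < pi z * lam by rewrite mulr_gt0.
  have [j fje] := fj _ (mulr_gt0 e0 pl).
  rewrite add0e; apply: le_trans (_ : (P (V j) <= _)%E).
    by apply: le_measure; rewrite ?inE//; [exact: bigcapT_measurable|move=> w; apply].
  by apply: le_trans (PV _ _ fje) _; rewrite mulfK ?gt_eqF.
- move=> w [Hw ex] j _; have [k sk] := ex j; exists k => //; split=> //.
  rewrite /A; have Zz : z = Z 0%N w by rewrite (Hz _ Hw).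
  apply: lt_le_trans (sum_le_max_sum (f j) lam (k := k.+1) _); last first.
    have sz : (k.+1 <= size (traj Z 0 k.+1 w))%N by rewrite traj_mkseq size_mkseq.
    exact: leq_trans sz (leqnSn _).
  rewrite Zz traj0_mkseq take_mkseq// sum_mkseq sumrB subr_gt0.
  by rewrite sumr_const card_ord -[X in X < _]mulr_natr.
Qed.

End ErgodicPaths.

(** * Exponential inequality for the martingale part *)

(** The exponential is at most 1 / (1 - y), and (1 + y + 2 y^2) (1 - y) = 1 + y^2 (1 - 2 y). *)
Lemma expR_le_quadratic (R : realType) (y : R) : y <= 2^-1 ->
  expR y <= 1 + y + 2 * y ^+ 2.
Proof.
move=> y2; have y1 : 0 < 1 - y by lra.
have := expR_ge1Dx (- y); rewrite expRN -lef_pV2 ?posrE ?invr_gt0 ?expR_gt0// invrK.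
move=> /le_trans; apply; rewrite -[_^-1]mul1r ler_pdivrMr//.
have : 0 <= y ^+ 2 * (1 - 2 * y) by rewrite mulr_ge0 ?sqr_ge0//; lra.
nra.
Qed.

Section Deviation.
Variables (R : realType) (T : countType) (t : T -> T -> R).
Hypothesis t0 : forall x y, 0 <= t x y.
Hypothesis t1 : forall x, (\esum_(y in [set: T]) (t x y)%:E = 1)%E.

Definition step_mean (u : T -> R) (x : T) : R :=
  fine (\esum_(y in [set: T]) (t x y * u y)%:E).

Section StepMean.
Variables (u : T -> R) (K : R).
Hypothesis u0 : forall x, 0 <= u x <= K.

Let u_ge0 x : 0 <= u x. Proof. by have /andP[] := u0 x. Qed.
Let u_leK x : u x <= K. Proof. by have /andP[] := u0 x. Qed.

Let esum_leK x : (\esum_(y in [set: T]) (t x y * u y)%:E <= K%:E)%E.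
Proof.
rewrite -[leRHS]mule1 -(t1 x) -esumZl ?(le_trans (u_ge0 x))//; last first.
  by move=> y _; rewrite lee_fin.
by apply: le_esum => y _; rewrite -EFinM lee_fin mulrC ler_wpM2r.
Qed.

Let esum_ge0' x : (0 <= \esum_(y in [set: T]) (t x y * u y)%:E)%E.
Proof. by apply: esum_ge0 => y _; rewrite lee_fin mulr_ge0. Qed.

Lemma step_meanE x :
  (step_mean u x)%:E = (\esum_(y in [set: T]) (t x y * u y)%:E)%E.
Proof.
by rewrite fineK// ge0_fin_numE ?esum_ge0'// (le_lt_trans (esum_leK x)) ?ltry.
Qed.

Lemma step_mean_bound x : 0 <= step_mean u x <= K.
Proof. by rewrite -!lee_fin step_meanE esum_leK esum_ge0'. Qed.

(** The martingale with increments u(X_(k+1)) - E[u(X_(k+1)) | X_k]. *)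
Fixpoint deviation (x : T) (s : seq T) : R :=
  if s is y :: s' then u y - step_mean u x + deviation y s' else 0.

Lemma expect_deviation (th : R) n x : 0 <= th -> th * K <= 2^-1 ->
  (expect_from t n x (fun s => (expR (th * deviation x s))%:E) <=
   ((1 + 2 * (th * K) ^+ 2) ^+ n)%:E)%E.
Proof.
move=> th0 thK; have K0 : 0 <= K := le_trans (u_ge0 x) (u_leK x).
set C := 1 + _; have C0 : 0 <= C by rewrite addr_ge0// mulr_ge0// sqr_ge0.
elim: n x => [|n IH] x /=; first by rewrite mulr0 expR0 expr0.
set v := step_mean u x.
have := step_mean_bound x; rewrite -/v => /andP[v0 vK].
(* By the quadratic bound, exp(th (u y - v)) is at most C - th v + th u y; averaging over y cancels
   the linear terms and leaves the factor C. *)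
apply: (@le_trans _ _ (\esum_(y in [set: T])
    ((C ^+ n)%:E * ((t x y)%:E * (C - th * v + th * u y)%:E)))%E).
  apply: le_esum => y _; rewrite muleCA lee_wpmul2l ?lee_fin//.
  rewrite (@eq_expect _ _ _ t0 _ _ _ (fun s => (expR (th * (u y - v)))%:E *
      (expR (th * deviation y s))%:E)%E); last first.
    by move=> s _; rewrite -EFinM -expRD -mulrDr.
  rewrite expectZ ?expR_ge0//.
  rewrite muleC; apply: lee_pmul => //.
    by apply: expect_ge0 => // s; rewrite lee_fin expR_ge0.
  have uy0 := u_ge0 y; have uyK := u_leK y.
  have dK : th * (u y - v) <= th * K by rewrite ler_wpM2l//; lra.
  have dK' : - (th * K) <= th * (u y - v) by rewrite -mulrN ler_wpM2l//; lra.
  rewrite lee_fin; apply: le_trans (expR_le_quadratic (le_trans dK thK)) _.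
  suff : (th * (u y - v)) ^+ 2 <= (th * K) ^+ 2 by rewrite /C; lra.
  by rewrite -ler_sqrt ?sqr_ge0// !sqrtr_sqr [leRHS]ger0_norm ?mulr_ge0// ler_norml dK' dK.
have tv : (th * v <= C)%R.
  rewrite /C; have := ler_wpM2l th0 vK; have := sqr_ge0 (th * K); lra.
rewrite esumZl ?exprn_ge0//; last first.
  move=> y _; rewrite mule_ge0// lee_fin// addr_ge0 ?mulr_ge0 ?u_ge0//; lra.
rewrite exprSr EFinM lee_wpmul2l ?lee_fin ?exprn_ge0//.
rewrite (@eq_esum _ _ _ _ (fun y => (C - th * v)%:E * (t x y)%:E +
    th%:E * (t x y * u y)%:E)%E); last first.
  by move=> y _; rewrite -!EFinM -EFinD; congr EFin; ring.
rewrite esumD; first last.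
- by move=> y _; rewrite -EFinM lee_fin !mulr_ge0.
- by move=> y _; rewrite -EFinM lee_fin !mulr_ge0//; lra.
rewrite !esumZl//; [|by lra|by move=> y _; rewrite lee_fin|
  by move=> y _; rewrite lee_fin !mulr_ge0].
by rewrite t1 -step_meanE -/v mule1 -EFinM -EFinD lee_fin; lra.
Qed.

End StepMean.
End Deviation.

Lemma geometric_sum_le (R : realType) (rho : R) : 0 <= rho < 1 ->
  (\sum_(0 <= k <oo) (rho ^+ k)%:E <= ((1 - rho)^-1)%:E)%E.
Proof.
move=> /andP[r0 r1]; apply: lime_le.
  by apply: is_cvg_nneseries => k _ _; rewrite lee_fin exprn_ge0.
apply: nearW => n; rewrite sumEFin lee_fin -[leRHS]mul1r ler_pdivlMr ?subr_gt0//.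
rewrite big_mkord mulrC -opprB mulNr -subrX1 opprB lerBlDr lerDl.
exact: exprn_ge0.
Qed.

Section DeviationPaths.
Context d (Omega : measurableType d) (R : realType).
Variable P : probability Omega R.
Variables (T : countType) (t : T -> T -> R) (Z : nat -> Omega -> T).
Hypothesis t0 : forall x y, 0 <= t x y.
Hypothesis t1 : forall x, (\esum_(y in [set: T]) (t x y)%:E = 1)%E.
Hypothesis mZ : forall n x, measurable (Z n @^-1` [set x]).
Variables (z : T) (H : set Omega) (HH : markov_at P t Z 0 z H).
Variables (u : T -> R) (K : R).
Hypothesis u0 : forall x, 0 <= u x <= K.

Lemma deviation_traj n m w :
  deviation t u (Z n w) (traj Z n m w) =
  \sum_(i < m) (u (Z (n + i.+1)%N w) - step_mean t u (Z (n + i)%N w)).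
Proof.
elim: m n => [|m IH] n /=; first by rewrite big_ord0.
rewrite big_ord_recl /= IH addn1 addn0; congr (_ + _).
by apply: eq_bigr => i _; rewrite !addSnnS.
Qed.

(** Chernoff bound with exponent th: the probabilities decay geometrically, and Borel-Cantelli
    applies. *)
Lemma negligible_deviation (delta : R) : 0 < delta ->
  P.-negligible (H `&` [set w | forall n0, exists n, (n0 <= n)%N /\
    delta * n%:R < deviation t u (Z 0%N w) (traj Z 0 n w)]).
Proof.
wlog d1 : delta / delta <= 1 => [wl|].
  move=> d0; have m0 : 0 < Num.min delta 1 by rewrite lt_min d0 ltr01.
  have m1 : Num.min delta 1 <= 1 by rewrite ge_min lexx orbT.
  apply: negligibleS (wl _ m1 m0) => w [Hw ex]; split=> // n0.
  have [n [n0n lt]] := ex n0; exists n; split=> //.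
  by apply: le_lt_trans lt; rewrite ler_wpM2r// ge_min lexx.
move=> d0; have [mH Hz _] := HH.
have K0 : 0 <= K by have /andP[] := u0 z; exact: le_trans.
(* This order of magnitude makes 2 (th K)^2 at most half of th * delta. The assumption delta <= 1
   ensures th K <= 1/2, and K + 1 covers the case K = 0. *)
pose th := delta / (4 * (K + 1) ^+ 2).
have th0 : 0 < th by rewrite divr_gt0// mulr_gt0// exprn_gt0//; lra.
have thE : th * (4 * (K + 1) ^+ 2) = delta.
  by rewrite divfK// mulf_neq0// expf_neq0//; lra.
have thK : th * K <= 2^-1 by nra.
have thd : 2 * (th * K) ^+ 2 < th * delta by nra.
pose C := 1 + 2 * (th * K) ^+ 2; pose rho := C * expR (- (th * delta)).
have rho01 : 0 <= rho < 1.
  apply/andP; split.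
    by rewrite mulr_ge0 ?expR_ge0// addr_ge0// mulr_ge0// sqr_ge0.
  rewrite /rho expRN ltr_pdivrMr ?expR_gt0// mul1r.
  by apply: lt_le_trans (expR_ge1Dx _); rewrite ltrD2l.
pose A n s := delta * n%:R < deviation t u z s.
pose F n := H `&` [set w | A n (traj Z 0 n w)].
have mF n : measurable (F n) by case: (markov_at_expect t0 mZ n (A n) HH).
have PF n : (P (F n) <= (rho ^+ n)%:E)%E.
  have [_ ->] := markov_at_expect t0 mZ n (A n) HH.
  apply: (@le_trans _ _ (expect_from t n z (fun s => (A n s)%:R%:E))).
    rewrite -[leRHS]mul1e lee_wpmul2r ?probability_le1//.
    by apply: expect_ge0 => // s; rewrite lee_fin.
  apply: (@le_trans _ _ (expect_from t n z (fun s =>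
     (expR (- (th * delta)) ^+ n)%:E * (expR (th * deviation t u z s))%:E))%E).
    apply: le_expect => // s _; rewrite -EFinM lee_fin /A.
    case: ltP => [lt|_]; last by rewrite mulr_ge0 ?exprn_ge0 ?expR_ge0.
    rewrite -expRM_natr -expRD -[leLHS]expR0 ler_expR mulNr addrC subr_ge0.
    by rewrite -mulrA ler_wpM2l// ltW.
  rewrite expectZ ?exprn_ge0 ?expR_ge0//.
  rewrite /rho exprMn EFinM muleC lee_wpmul2r ?lee_fin ?exprn_ge0 ?expR_ge0//.
  by apply: (@expect_deviation _ _ _ t0 t1 u K) => //; rewrite ltW.
exists (lim_sup_set F); split.
- by apply: bigcapT_measurable => n; apply: bigcup_measurable => k _.
- apply: lim_sup_set_cvg0 => //; apply: le_lt_trans (ltry (1 - rho)^-1).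
  apply: le_trans (geometric_sum_le rho01).
  by apply: lee_nneseries => // n _; exact: PF.
- move=> w [Hw ex] n0 _; have [n [n0n lt]] := ex n0; exists n => //; split=> //.
  by rewrite /= /A -(Hz _ Hw).
Qed.

End DeviationPaths.

(** * Truncated hitting times and the Poisson equation *)

Section Hitting.
Variables (R : realType) (T : countType) (t : T -> T -> R) (pi : T -> R).
Hypothesis t0 : forall x y, 0 <= t x y.
Hypothesis t1 : forall x, (\esum_(y in [set: T]) (t x y)%:E = 1)%E.
Hypothesis pi0 : forall x, 0 <= pi x.
Hypothesis pi1 : (\esum_(x in [set: T]) (pi x)%:E = 1)%E.
Hypothesis pit : forall y, (\esum_(x in [set: T]) (pi x * t x y)%:E = (pi y)%:E)%E.

Lemma le_step_mean (K : R) (u v : T -> R) x : (forall y, 0 <= u y <= K) ->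
  (forall y, 0 <= v y <= K) -> (forall y, u y <= v y) ->
  step_mean t u x <= step_mean t v x.
Proof.
move=> uK vK uv; rewrite -lee_fin (step_meanE t0 t1 uK) (step_meanE t0 t1 vK).
by apply: le_esum => y _; rewrite lee_fin ler_wpM2l.
Qed.

Lemma step_meanD (K L : R) (u v : T -> R) x : (forall y, 0 <= u y <= K) ->
  (forall y, 0 <= v y <= L) ->
  step_mean t (fun y => u y + v y) x = step_mean t u x + step_mean t v x.
Proof.
move=> uK vL; apply: EFin_inj; rewrite EFinD (step_meanE t0 t1 uK).
have uvK y : 0 <= u y + v y <= K + L.
  by have /andP[u0 uk] := uK y; have /andP[v0 vl] := vL y; rewrite addr_ge0// lerD.
rewrite (step_meanE t0 t1 vL) (step_meanE t0 t1 uvK) -esumD.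
- by apply: eq_esum => y _; rewrite mulrDr EFinD.
- by move=> y _; rewrite lee_fin mulr_ge0//; case/andP: (uK y).
- by move=> y _; rewrite lee_fin mulr_ge0//; case/andP: (vL y).
Qed.

Lemma mean_step_mean (K : R) (u : T -> R) : (forall y, 0 <= u y <= K) ->
  mean pi (step_mean t u) = mean pi u.
Proof.
move=> uK; have u0 y : 0 <= u y by case/andP: (uK y).
rewrite /mean; under eq_esum => x _.
  rewrite EFinM (step_meanE t0 t1 uK) -esumZl//; last by move=> y _; rewrite lee_fin mulr_ge0.
over.
rewrite esum_swap; last by move=> x y; rewrite -EFinM lee_fin !mulr_ge0.
apply: eq_esum => y _; rewrite mulrC EFinM -pit -esumZl//; last first.
  by move=> x _; rewrite lee_fin mulr_ge0.
by apply: eq_esum => x _; rewrite -!EFinM; congr EFin; ring.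
Qed.

Variable a : T.

(* P_x[T_a > N], where T_a is the hitting time of a *)
Fixpoint not_hit (N : nat) (x : T) : R :=
  if x == a then 0 else if N is N'.+1 then step_mean t (not_hit N') x else 1.

(* E_x[min(T_a, N)] *)
Definition hit_time N x : R := \sum_(n < N) not_hit n x.

(* E_a[min(T, N + 1)], where T >= 1 is the return time to a *)
Definition return_mean N : R := 1 + step_mean t (hit_time N) a.

Lemma not_hit_bound N x : 0 <= not_hit N x <= 1.
Proof.
elim: N x => [|N IH] x /=; case: eqP => _; rewrite ?lexx ?ler01//.
exact: (step_mean_bound t0 t1 IH).
Qed.

Lemma not_hit_decr N x : not_hit N.+1 x <= not_hit N x.
Proof.
elim: N x => [|N IH] x.
  rewrite /=; case: eqP => // _.
  by case/andP: (step_mean_bound t0 t1 (not_hit_bound 0) x).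
rewrite [not_hit N.+2 x]/= [not_hit N.+1 x]/=; case: eqP => // _.
exact: (le_step_mean _ (not_hit_bound N.+1) (not_hit_bound N)).
Qed.

Lemma not_hit_anti M N x : (M <= N)%N -> not_hit N x <= not_hit M x.
Proof.
move=> /subnK <-; elim: (N - M)%N => // k IH.
by rewrite addSn; apply: le_trans IH; exact: not_hit_decr.
Qed.

Lemma hit_time_bound N x : 0 <= hit_time N x <= N%:R.
Proof.
rewrite sumr_ge0/=; last by move=> n _; case/andP: (not_hit_bound n x).
rewrite -[N in N%:R]card_ord -sumr_const; apply: ler_sum => n _.
by case/andP: (not_hit_bound n x).
Qed.

Lemma step_mean_hit_time N x :
  step_mean t (hit_time N) x = \sum_(n < N) step_mean t (not_hit n) x.
Proof.
elim: N => [|N IH].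
  rewrite big_ord0 /step_mean esum1// => y _.
  by rewrite /hit_time big_ord0 mulr0.
rewrite big_ord_recr /= -IH -(step_meanD _ (hit_time_bound N) (not_hit_bound N)).
by congr (step_mean t _ x); apply/funext => y; rewrite /hit_time big_ord_recr.
Qed.

(** Away from a, one step shifts the index of [not_hit], so the sum telescopes up to the truncation
    error [not_hit N]. At a the left side reduces to [return_mean N], which is defined to make the
    equation hold. *)
Lemma poisson_equation N x :
  hit_time N x + not_hit N x + return_mean N * (x == a)%:R =
  1 + step_mean t (hit_time N) x.
Proof.
rewrite /return_mean; have [->|xa] := eqVneq x a.
  rewrite mulr1 /hit_time big1; last by move=> n _; case: (val n) => [|k] /=; rewrite eqxx.
  by case: N => [|N]; rewrite /= eqxx !add0r.
rewrite mulr0 addr0 step_mean_hit_time.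
have e n : step_mean t (not_hit n) x = not_hit n.+1 x by rewrite /= (negPf xa).
under [in RHS]eq_bigr do rewrite e.
rewrite /hit_time -(big_ord_recr N (fun n : 'I_N.+1 => not_hit n x))/=.
by rewrite big_ord_recl /= (negPf xa).
Qed.

(** Truncated Kac formula: integrate the Poisson equation against pi and cancel the mean of
    [hit_time N], which is finite thanks to the truncation. *)
Lemma mean_not_hit N :
  (mean pi (not_hit N) + (return_mean N * pi a)%:E = 1)%E.
Proof.
have hN x : 0 <= hit_time N x by case/andP: (hit_time_bound N x).
have nN x : 0 <= not_hit N x by case/andP: (not_hit_bound N x).
have sN x : 0 <= step_mean t (hit_time N) x.
  by case/andP: (step_mean_bound t0 t1 (hit_time_bound N) x).
have rN : 0 <= return_mean N by rewrite addr_ge0.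
have hfin : mean pi (hit_time N) \is a fin_num.
  rewrite ge0_fin_numE; last by apply: esum_ge0 => x _; rewrite lee_fin mulr_ge0.
  apply: le_lt_trans (ltry N%:R); rewrite -[leRHS]mule1 -pi1 -esumZl//; last first.
    by move=> x _; rewrite lee_fin.
  apply: le_esum => x _; rewrite -EFinM lee_fin mulrC ler_wpM2r//.
  by case/andP: (hit_time_bound N x).
have : (mean pi (hit_time N) + (mean pi (not_hit N) + (return_mean N * pi a)%:E) =
        mean pi (hit_time N) + 1)%E.
  rewrite -[in RHS](mean_step_mean (hit_time_bound N)) -pi1.
  have -> : ((return_mean N * pi a)%:E =
      \esum_(x in [set: T]) (pi x * (return_mean N * (x == a)%:R))%:E)%E.
    rewrite (esum_only (x := a)) ?eqxx ?mulr1 1?mulrC// ?lee_fin ?mulr_ge0//.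
    by move=> y /negPf ->; rewrite !mulr0.
  rewrite /mean -!esumD; do ?by move=> x _; rewrite ?adde_ge0 ?lee_fin ?addr_ge0 ?mulr_ge0.
  apply: eq_esum => x _; rewrite -!EFinD; congr EFin.
  have := poisson_equation N x; move: (return_mean N * _) => c e.
  rewrite -!mulrDr addrA e; ring.
move=> e; apply/eqP; rewrite eq_le.
by apply/andP; split; rewrite -(leeD2lE _ _ hfin) e.
Qed.

Hypothesis pia : 0 < pi a.

Lemma return_mean_bound N : 1 <= return_mean N <= (pi a)^-1.
Proof.
rewrite /return_mean lerDl; case/andP: (step_mean_bound t0 t1 (hit_time_bound N) a) => -> _ /=.
rewrite -/(return_mean N) -[_^-1]mul1r ler_pdivlMr// -lee_fin -(mean_not_hit N).
rewrite leeDr//; apply: esum_ge0 => x _; rewrite lee_fin mulr_ge0//.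
by case/andP: (not_hit_bound N x).
Qed.

(* Almost sure recurrence of a: return_mean N is bounded in N. *)
Lemma step_mean_not_hit_small (delta : R) : 0 < delta ->
  exists N, step_mean t (not_hit N) a <= delta.
Proof.
(* The terms decrease in n and their sum stays below (pi a)^-1; with more than (pi a)^-1 / delta of
   them, the last one is at most delta. *)
move=> d0; pose N := Num.truncn ((pi a)^-1 / delta); exists N.
have /andP[_] := return_mean_bound N.+1.
rewrite /return_mean step_mean_hit_time.
have le n : (n < N.+1)%N -> step_mean t (not_hit N) a <= step_mean t (not_hit n) a.
  move=> nN; apply: (le_step_mean _ (not_hit_bound N) (not_hit_bound n)) => y.
  exact: not_hit_anti.
have : \sum_(n < N.+1) step_mean t (not_hit N) a <=
       \sum_(n < N.+1) step_mean t (not_hit n) a.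
  by apply: ler_sum => n _; exact: le.
rewrite sumr_const card_ord -mulr_natr => h1 h2.
have N0 : 0 < N.+1%:R :> R by rewrite ltr0n.
rewrite -(ler_pM2r N0); apply: le_trans (ltW _ : (pi a)^-1 <= _); first by lra.
rewrite mulrC -ltr_pdivrMr//; exact: Num.Theory.truncnS_gt.
Qed.

(** Smallness propagates along edges, because t x y * [not_hit N y] is one term of the mean over the
    successors of x. *)
Lemma not_hit_small s (delta : R) : path (fun x y => 0 < t x y) a s -> 0 < delta ->
  exists N, not_hit N (last a s) <= delta.
Proof.
(* The induction carries the mean after one step: [not_hit] itself vanishes at a and would say
   nothing about the successors of a. *)
suff small x : (forall delta, 0 < delta -> exists N, step_mean t (not_hit N) x <= delta) ->
    path (fun x y => 0 < t x y) x s -> s != [::] -> 0 < delta ->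
    exists N, not_hit N (last x s) <= delta.
  move=> ps d0; have [->|s0] := eqVneq s [::].
    by exists 0%N; rewrite /= eqxx ltW.
  by apply: small => //; exact: step_mean_not_hit_small.
elim: s x delta => [//|y s IH] x delta small /= /andP[txy ps] _ d0.
have smally e : 0 < e -> exists N, not_hit N y <= e.
  move=> e0; have [N Ne] := small _ (mulr_gt0 e0 txy); exists N.
  rewrite -(ler_pM2r txy) mulrC; apply: le_trans _ Ne.
  rewrite -lee_fin (step_meanE t0 t1 (not_hit_bound N)).
  apply: (esum_le_term (a := fun y => (t x y * not_hit N y)%:E)) => z.
  by rewrite lee_fin mulr_ge0//; case/andP: (not_hit_bound N z).
have [->|s0] := eqVneq s [::]; first exact: smally.
apply: IH => // e e0; have [N Ne] := smally _ e0.
(* If the path comes back to a, the induction restarts from the recurrence of a. *)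
have [ya|ya] := eqVneq y a; first by rewrite ya; exact: step_mean_not_hit_small.
exists N; have := le_trans (not_hit_decr N y) Ne.
by rewrite /= (negPf ya).
Qed.

Hypothesis irr : forall x, 0 < pi x ->
  exists2 s, path (fun x y => 0 < t x y) a s & last a s = x.

(** A finite set carries all but delta / 2 of the mass; on its points of positive mass one N serves
    for all, since [not_hit] decreases in N. *)
Lemma mean_not_hit_small (delta : R) : 0 < delta ->
  exists N, (mean pi (not_hit N) <= delta%:E)%E.
Proof.
move=> d0; have d2 : 0 < delta / 2 by rewrite divr_gt0.
have [A finA tA] : exists2 A : set T, finite_set A &
    (\esum_(x in ~` A) (pi x)%:E <= (delta / 2)%:E)%E.
  by apply: esum_tail => //; rewrite pi1 ltry.
have [s As] := (finite_seqP A).1 finA.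
have [N HN] : exists N, forall x, x \in s -> 0 < pi x -> not_hit N x <= delta / 2.
  elim: s {As} => [|x s [N IH]]; first by exists 0%N.
  have [M HM] : exists M, 0 < pi x -> not_hit M x <= delta / 2.
    have [pix|pix] := ltP 0 (pi x); last by exists 0%N.
    by have [r pr <-] := irr pix; have [M] := not_hit_small pr d2; exists M.
  exists (maxn M N) => y; rewrite inE => /orP[/eqP ->|ys] piy.
    by apply: le_trans (HM piy); rewrite not_hit_anti// leq_maxl.
  by apply: le_trans (IH _ ys piy); rewrite not_hit_anti// leq_maxr.
exists N; have n0 x : 0 <= not_hit N x by case/andP: (not_hit_bound N x).
have n1 x : not_hit N x <= 1 by case/andP: (not_hit_bound N x).
rewrite /mean (esumID A)//; last by move=> x _; rewrite lee_fin mulr_ge0.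
rewrite !setTI [delta in leRHS]splitr EFinD; apply: leeD.
  apply: (@le_trans _ _ (\esum_(x in A) ((delta / 2)%:E * (pi x)%:E))%E).
    apply: le_esum => x Ax; rewrite -EFinM lee_fin mulrC.
    have [pix|pix] := ltP 0 (pi x); last first.
      by rewrite (le_anti (_ : pi x <= 0 <= pi x)) ?mulr0// pix pi0.
    by rewrite ler_wpM2r// HN//; move: Ax; rewrite As.
  rewrite esumZl ?(ltW d2)//; last by move=> x _; rewrite lee_fin.
  rewrite -[leRHS]mule1; apply: lee_wpmul2l; first by rewrite lee_fin ltW.
  rewrite -pi1 [X in (_ <= X)%E](esumID A); last by move=> x _; rewrite lee_fin.
  by rewrite setTI leeDl// esum_ge0// => x _; rewrite lee_fin.
apply: le_trans tA; apply: le_esum => x _.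
by rewrite lee_fin -[leRHS]mulr1 ler_wpM2l.
Qed.

End Hitting.

Lemma sum_ord_shift (V : zmodType) (f : nat -> V) n :
  \sum_(i < n) f i.+1 = \sum_(i < n) f i + f n - f 0%N.
Proof.
elim: n => [|n IH]; first by rewrite !big_ord0 add0r subrr.
by rewrite !big_ord_recr /= IH addrAC.
Qed.

(** * Frequencies of visits and ergodic averages *)

Section ErgodicTheorem.
Context d (Omega : measurableType d) (R : realType).
Variable P : probability Omega R.

Variables (T : countType) (t : T -> T -> R) (pi : T -> R) (Z : nat -> Omega -> T).
Hypothesis t0 : forall x y, 0 <= t x y.
Hypothesis t1 : forall x, (\esum_(y in [set: T]) (t x y)%:E = 1)%E.
Hypothesis pi0 : forall x, 0 <= pi x.
Hypothesis pi1 : (\esum_(x in [set: T]) (pi x)%:E = 1)%E.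
Hypothesis pit : forall y, (\esum_(x in [set: T]) (pi x * t x y)%:E = (pi y)%:E)%E.
Hypothesis irr : forall x y, 0 < pi x -> 0 < pi y ->
  exists2 s, path (fun x y => 0 < t x y) x s & last x s = y.
Hypothesis mZ : forall n x, measurable (Z n @^-1` [set x]).
Variables (z : T) (H : set Omega).
Hypotheses (HH : markov_at P t Z 0 z H) (piz : 0 < pi z).

(** Summed along the trajectory, the Poisson equation expresses [return_mean N] times the number of
    visits as n minus the truncation error, minus the martingale, plus a boundary term. Only lower
    bounds result, so one-sided control of the errors suffices. The exceptional sets are indexed by
    integers, hence one null set serves all c. *)
Lemma negligible_frequency a : 0 < pi a ->
  P.-negligible (H `&` [set w | ~ forall c, c < pi a ->
    exists n0, forall n, (n0 <= n)%N -> c * n%:R <= \sum_(i < n) (Z i w == a)%:R]).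
Proof.
move=> pia; pose e k : R := k.+1%:R^-1.
have e0 k : 0 < e k by rewrite invr_gt0 ltr0n.
pose N1 k := H `&` [set w | forall j, exists n,
  e k * n.+1%:R < \sum_(i < n.+1) not_hit t a j (Z i w)].
pose N2 N k := H `&` [set w | forall n0, exists n, (n0 <= n)%N /\
  e k * n%:R < deviation t (hit_time t a N) (Z 0%N w) (traj Z 0 n w)].
have nN1 k : P.-negligible (N1 k).
  apply: (negligible_maximal t0 t1 pi0 pit mZ HH piz) => //.
    by move=> j x; case/andP: (not_hit_bound t0 t1 a j x).
  by move=> delta; apply: mean_not_hit_small => // x; exact: irr.
have nN2 N k : P.-negligible (N2 N k).
  apply: (negligible_deviation t0 t1 mZ HH (K := N%:R)) => //.
  exact: (hit_time_bound t0 t1 a N).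
apply: (@negligibleS _ _ _ _ (\bigcup_k N1 k `|` \bigcup_N \bigcup_k N2 N k)); last first.
  apply: negligibleU; first exact: negligible_bigcup.
  by apply: negligible_bigcup => N; exact: negligible_bigcup.
move=> w [Hw]; apply: contra_notP => /not_orP[n1 n2] c ca.
(* Three errors, each at most e k * n: truncation, martingale, boundary. *)
have [k ek] : exists k, 3 * e k * pi a <= pi a - c.
  have gap : 0 < pi a - c by rewrite subr_gt0.
  exists (Num.truncn (3 * pi a / (pi a - c))).
  rewrite /e mulrAC ler_pdivrMr ?ltr0n// -ler_pdivrMl// mulrC.
  exact/ltW/Num.Theory.truncnS_gt.
have [N HN] : exists N, forall n,
    \sum_(i < n.+1) not_hit t a N (Z i w) <= e k * n.+1%:R.
  apply: contrapT => /forallNP h; apply: n1; exists k => //; split=> // j.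
  by have /existsNP[n /negP] := h j; rewrite -ltNge => ?; exists n.
have [n0 Hn0] : exists n0, forall n, (n0 <= n)%N ->
    deviation t (hit_time t a N) (Z 0%N w) (traj Z 0 n w) <= e k * n%:R.
  apply: contrapT => /forallNP h; apply: n2; exists N => //; exists k => //; split=> // m.
  have /existsNP[n /not_implyP[mn /negP]] := h m.
  by rewrite -ltNge => ?; exists n.
exists (maxn n0 (Num.truncn (N%:R / e k)).+1) => n; rewrite geq_max => /andP[/Hn0 dn Nn].
have Nn' : N%:R <= e k * n%:R.
  rewrite mulrC -ler_pdivrMr//; apply: ltW; apply: lt_le_trans (Num.Theory.truncnS_gt _) _.
  by rewrite ler_nat.
have nh : \sum_(i < n) not_hit t a N (Z i w) <= e k * n%:R.
  by case: n Nn {dn Nn'} => // n _.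
have := deviation_traj t Z (hit_time t a N) 0 n w; rewrite sumrB => dE.
set h := hit_time t a N in dE dn *; set c' := return_mean t a N.
have cB : 1 <= c' <= (pi a)^-1 by apply: return_mean_bound.
have E : \sum_(i < n) h (Z i w) + \sum_(i < n) not_hit t a N (Z i w) +
    c' * \sum_(i < n) (Z i w == a)%:R = n%:R + \sum_(i < n) step_mean t h (Z i w).
  rewrite mulr_sumr -!big_split/= -[in n%:R](card_ord n) -sumr_const -big_split/=.
  by apply: eq_bigr => i _; rewrite /h /c' poisson_equation.
have tel : \sum_(i < n) h (Z i.+1 w) = \sum_(i < n) h (Z i w) + h (Z n w) - h (Z 0%N w).
  exact: (sum_ord_shift (fun i => h (Z i w))).
have hN x : 0 <= h x <= N%:R by exact: hit_time_bound.
have [hn0 _] := andP (hN (Z n w)); have [_ h0N] := andP (hN (Z 0%N w)).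
set S := \sum_(i < n) (Z i w == a)%:R in E *.
have S0 : 0 <= S by apply: sumr_ge0.
have cS : n%:R * (1 - 3 * e k) <= c' * S.
  move: dE; rewrite tel => dE.
  have : \sum_(i < n) step_mean t h (Z (0 + i)%N w) = \sum_(i < n) step_mean t h (Z i w) by [].
  move=> e1; rewrite e1 in dE; lra.
have [c1 c2] := andP cB.
have cS2 : c' * S <= (pi a)^-1 * S by rewrite ler_wpM2r.
(* By the Kac bound, [return_mean N] is at most the inverse of pi a. *)
have : pi a * (n%:R * (1 - 3 * e k)) <= S.
  by rewrite -ler_pdivlMl//; apply: le_trans cS cS2.
have n_ge0 : 0 <= n%:R :> R by [].
have : c * n%:R <= pi a * (1 - 3 * e k) * n%:R by rewrite ler_wpM2r//; lra.
lra.
Qed.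

(** A finite part of the mean already exceeds c, so only frequencies of single states matter. Hence
    the null set does not depend on f, and an infinite mean is allowed. *)
Lemma negligible_mean_lower :
  P.-negligible (H `&` [set w | ~ forall f : T -> R, (forall x, 0 <= f x) ->
    forall c, (c%:E < mean pi f)%E ->
    exists n0, forall n, (n0 <= n)%N -> c * n%:R <= \sum_(i < n) f (Z i w)]).
Proof.
pose F a := H `&` [set w | 0 < pi a /\ ~ forall c, c < pi a ->
    exists n0, forall n, (n0 <= n)%N -> c * n%:R <= \sum_(i < n) (Z i w == a)%:R].
apply: (@negligibleS _ _ _ _ (\bigcup_a F a)); last first.
  apply: negligible_bigcup_count => a; have [pia|pia] := ltP 0 (pi a).
    by apply: negligibleS (negligible_frequency pia) => w [Hw [_ h]].
  rewrite (_ : F a = set0); first exact: negligible_set0.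
  by apply/seteqP; split=> // w [_ [/lt_le_trans/(_ pia)]]; rewrite ltxx.
move=> w [Hw]; apply: contra_notP => nF f f0 c.
have freq a : 0 < pi a -> forall c, c < pi a ->
    exists n0, forall n, (n0 <= n)%N -> c * n%:R <= \sum_(i < n) (Z i w == a)%:R.
  by move=> pia; apply: contrapT => h; apply: nF; exists a.
move=> /ereal_sup_gt[_ [A [finA _] <-]].
rewrite fsbig_finite//= sumEFin lte_fin => cs.
set s := finmap.enum_fset (fset_set A) in cs; have us : uniq s by exact: finmap.fset_uniq.
have approx e : 0 < e -> exists n0, forall n, (n0 <= n)%N ->
    (\sum_(a <- s) pi a * f a - e) * n%:R <=
    \sum_(a <- s) f a * \sum_(i < n) (Z i w == a)%:R.
  elim: s e {cs us} => [|a s IH] e e0.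
    exists 0%N => n _; rewrite !big_nil sub0r mulNr oppr_le0 mulr_ge0//; exact: ltW.
  have e2 : 0 < e / 2 by rewrite divr_gt0.
  have [n0 Hn0] := IH _ e2.
  have [n1 Hn1] : exists n1, forall n, (n1 <= n)%N ->
      (pi a * f a - e / 2) * n%:R <= f a * \sum_(i < n) (Z i w == a)%:R.
    have cnt0 n : 0 <= f a * \sum_(i < n) (Z i w == a)%:R by rewrite mulr_ge0// sumr_ge0.
    have [/eqP paf|paf] := boolP (pi a * f a == 0).
      exists 0%N => n _; apply: le_trans (cnt0 n).
      by rewrite paf sub0r mulNr oppr_le0 mulr_ge0// ltW.
    have pia : 0 < pi a.
      by rewrite lt_def pi0 andbT; apply: contra paf => /eqP ->; rewrite mul0r.
    have fa : 0 < f a.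
      by rewrite lt_def f0 andbT; apply: contra paf => /eqP ->; rewrite mulr0.
    have [|n1 Hn1] := freq a pia (pi a - e / 2 / f a).
      by rewrite ltrBlDr ltrDl divr_gt0.
    exists n1 => n /Hn1 h; rewrite -(ler_pM2l fa) in h; apply: le_trans h.
    by rewrite mulrA mulrBr [f a * (_ / f a)]mulrC divfK ?gt_eqF// [f a * pi a]mulrC.
  exists (maxn n0 n1) => n; rewrite geq_max => /andP[/Hn0 h0 /Hn1 h1].
  rewrite !big_cons; lra.
have e0 : 0 < \sum_(a <- s) pi a * f a - c by rewrite subr_gt0.
have [n0 Hn0] := approx _ e0.
exists n0 => n /Hn0; rewrite opprB addrC subrK => /le_trans; apply.
rewrite [X in X <= _](eq_bigr (fun a => \sum_(i < n) f a * (Z i w == a)%:R)); last first.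
  by move=> a _; rewrite mulr_sumr.
rewrite exchange_big /=; apply: ler_sum => i _.
have [Zs|Zs] := boolP (Z i w \in s).
  rewrite (bigD1_seq (Z i w))//= eqxx mulr1 big1 ?addr0// => a /negPf.
  by rewrite eq_sym => ->; rewrite mulr0.
rewrite big1_seq// => a /= as_; rewrite (_ : _ == a = false) ?mulr0//.
by apply: contraNF Zs => /eqP ->.
Qed.

(** Removing the values of f outside a finite set A j leaves a bounded g, so the lower bound applies
    to K - g. The removed tail f_ j has mean at most e j, which is where finiteness of the mean
    enters. *)
Lemma negligible_mean_upper (f : T -> R) : (forall x, 0 <= f x) ->
  (mean pi f < +oo)%E ->
  P.-negligible (H `&` [set w | ~ forall c, (mean pi f < c%:E)%E ->
    exists n0, forall n, (n0 <= n)%N -> \sum_(i < n) f (Z i w) <= c * n%:R]).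
Proof.
move=> f0 ff; pose e k : R := k.+1%:R^-1.
have e0 k : 0 < e k by rewrite invr_gt0 ltr0n.
have pf0 x : (0 <= (pi x * f x)%:E)%E by rewrite lee_fin mulr_ge0.
have /choice[A HA] : forall j, exists A : seq T,
    (\esum_(x in ~` [set` A]) (pi x * f x)%:E <= (e j)%:E)%E.
  move=> j; have [A finA tA] := esum_tail pf0 ff (e0 j).
  by have [s As] := (finite_seqP A).1 finA; exists s; rewrite -As.
pose f_ j x := if x \in A j then 0 else f x.
have f_0 j x : 0 <= f_ j x by rewrite /f_; case: ifP.
have f_le j x : f_ j x <= f x by rewrite /f_; case: ifP.
have f_mean j : (mean pi (f_ j) <= (e j)%:E)%E.
  apply: le_trans (HA j); rewrite esum_mkcond; apply: le_esum => x _.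
  rewrite /f_; case: ifPn => xA; first by rewrite mulr0; case: ifP => // _; exact: pf0.
  by rewrite ifT// inE /=; exact/negP.
pose N1 k := H `&` [set w | forall j, exists n,
  e k * n.+1%:R < \sum_(i < n.+1) f_ j (Z i w)].
apply: (@negligibleS _ _ _ _ (\bigcup_k N1 k `|` (H `&` [set w | ~ forall f : T -> R,
    (forall x, 0 <= f x) -> forall c, (c%:E < mean pi f)%E ->
    exists n0, forall n, (n0 <= n)%N -> c * n%:R <= \sum_(i < n) f (Z i w)]))); last first.
  apply: negligibleU; last exact: negligible_mean_lower.
  apply: negligible_bigcup => k.
  apply: (negligible_maximal t0 t1 pi0 pit mZ HH piz) => // delta d0.
  exists (Num.truncn delta^-1); apply: le_trans (f_mean _) _.
  rewrite lee_fin /e -[leRHS]invrK lef_pV2 ?posrE ?ltr0n ?invr_gt0//.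
  exact/ltW/Num.Theory.truncnS_gt.
move=> w [Hw]; apply: contra_notP => /not_orP[n1 n2] c fc.
(* The lower bound is used for K - g with j chosen along the trajectory; this is allowed because its
   null set is the same for all functions. *)
have lower g := contrapT (fun h => n2 (conj Hw h)) g.
have mf0 : (0 <= mean pi f)%E by exact: esum_ge0.
have mfin : mean pi f \is a fin_num by rewrite ge0_fin_numE.
move: fc; rewrite -(fineK mfin) lte_fin; set m := fine (mean pi f) => mc.
have gap : 0 < (c - m) / 2 by rewrite divr_gt0// subr_gt0.
have [k ek] : exists k, e k <= (c - m) / 2.
  exists (Num.truncn ((c - m) / 2)^-1).
  rewrite /e -[leRHS]invrK lef_pV2 ?posrE ?ltr0n ?invr_gt0//.
  exact/ltW/Num.Theory.truncnS_gt.
have [j Hj] : exists j, forall n,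
    \sum_(i < n.+1) f_ j (Z i w) <= e k * n.+1%:R.
  apply: contrapT => /forallNP h; apply: n1; exists k => //; split=> // j.
  by have /existsNP[n /negP] := h j; rewrite -ltNge => ?; exists n.
pose g x := f x - f_ j x.
pose K := \sum_(x <- undup (A j)) f x.
have g0 x : 0 <= g x by rewrite subr_ge0.
have gK x : g x <= K.
  rewrite /g /f_; case: ifPn => [xA|_]; last by rewrite subrr sumr_ge0.
  by rewrite subr0 /K (bigD1_seq x) ?mem_undup ?undup_uniq//= lerDl sumr_ge0.
have Kg0 x : 0 <= K - g x by rewrite subr_ge0.
have mKg : ((K - m - (c - m) / 2)%:E < mean pi (fun x => K - g x)%R)%E.
  have KE : (K%:E = mean pi (fun x => K - g x)%R + mean pi g)%E.
    rewrite /mean -esumD; do ?by move=> x _; rewrite lee_fin mulr_ge0.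
    rewrite -[LHS]mule1 -pi1 -esumZl ?sumr_ge0//.
      by apply: eq_esum => x _; rewrite -EFinM -EFinD; congr EFin; ring.
    by move=> x _; rewrite lee_fin.
  have mg : (mean pi g <= m%:E)%E.
    rewrite fineK//; apply: le_esum => x _; rewrite lee_fin ler_wpM2l//.
    by rewrite /g gerBl.
  have : (K%:E <= mean pi (fun x => K - g x)%R + m%:E)%E by rewrite KE leeD2l.
  rewrite -leeBlDr//; apply: lt_le_trans; rewrite -EFinB lte_fin; lra.
have [n0 Hn0] := lower _ Kg0 _ mKg.
exists n0 => n /Hn0; rewrite sumrB sumr_const card_ord -mulr_natr => h.
have fn : \sum_(i < n) f_ j (Z i w) <= e k * n%:R.
  by case: n {h} => [|n]; [rewrite big_ord0 mulr0|exact: Hj].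
have : e k * n%:R <= (c - m) / 2 * n%:R by rewrite ler_wpM2r.
have : \sum_(i < n) f (Z i w) = \sum_(i < n) f_ j (Z i w) + \sum_(i < n) g (Z i w).
  by rewrite -big_split/=; apply: eq_bigr => i _; rewrite /g addrC subrK.
lra.
Qed.

End ErgodicTheorem.

(** * Sequences of linear growth *)

Section LinearGrowth.
Variable R : realType.
Implicit Types (y : nat -> R) (a c : R).

(** The convergence of y n / n to a, written without division. *)
Definition linear_growth y a : Prop := forall delta : R, 0 < delta ->
  exists n0, forall n, (n0 <= n)%N -> `|y n - a * n%:R| <= delta * n%:R.

Lemma linear_growth_bounds y a :
  (forall c, c < a -> exists n0, forall n, (n0 <= n)%N -> c * n%:R <= y n) ->
  (forall c, a < c -> exists n0, forall n, (n0 <= n)%N -> y n <= c * n%:R) ->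
  linear_growth y a.
Proof.
move=> lo up delta d0.
have [|n0 H0] := lo (a - delta); first by lra.
have [|n1 H1] := up (a + delta); first by lra.
exists (maxn n0 n1) => n; rewrite geq_max => /andP[/H0 h0 /H1 h1].
by rewrite ler_norml; apply/andP; split; lra.
Qed.

Lemma eventually_small (delta b : R) : 0 < delta ->
  exists n0, forall n, (n0 <= n)%N -> b <= delta * n%:R.
Proof.
move=> d0; exists (Num.truncn (b / delta)).+1 => n nb.
rewrite mulrC -ler_pdivrMr//; apply: ltW.
by apply: lt_le_trans (Num.Theory.truncnS_gt _) _; rewrite ler_nat.
Qed.

Lemma linear_growth_add y a c : linear_growth y a ->
  linear_growth (fun n => c + y n) a.
Proof.
move=> ya delta d0; have d2 : 0 < delta / 2 by rewrite divr_gt0.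
have [n0 H0] := ya _ d2; have [n1 H1] := eventually_small `|c| d2.
exists (maxn n0 n1) => n; rewrite geq_max => /andP[/H0 h0 /H1 h1].
rewrite -addrA; apply: le_trans (ler_normD _ _) _; lra.
Qed.

Lemma linear_growth_shift y a : linear_growth (fun n => y n.+1) a ->
  linear_growth y a.
Proof.
move=> ya delta d0; have d2 : 0 < delta / 2 by rewrite divr_gt0.
have [n0 H0] := ya _ d2; have [n1 H1] := eventually_small `|a| d2.
exists (maxn n0 n1).+1 => -[//|n]; rewrite ltnS geq_max => /andP[/H0 h0 n1n].
have h1 := H1 n.+1 (leqW n1n).
have -> : y n.+1 - a * n.+1%:R = (y n.+1 - a * n%:R) - a.
  by rewrite -[n.+1]addn1 natrD; ring.
apply: le_trans (ler_normB _ _) _.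
have : delta / 2 * n%:R <= delta / 2 * n.+1%:R by rewrite ler_wpM2l ?ler_nat// ltW.
lra.
Qed.

Lemma linear_growth_cvg y a : linear_growth y a ->
  (fun n => y n / n%:R) @ \oo --> a.
Proof.
move=> ya; apply/cvgrPdist_le => /= e e0; have [n0 H0] := ya _ e0.
exists n0.+1 => // -[//|n] /= n0n.
have np : 0 < n.+1%:R :> R by rewrite ltr0n.
have -> : a - y n.+1 / n.+1%:R = - ((y n.+1 - a * n.+1%:R) / n.+1%:R).
  by rewrite mulrBl mulfK ?gt_eqF// opprB.
rewrite normrN normrM normfV [`|n.+1%:R|]ger0_norm ?(ltW np)// ler_pdivrMr//.
exact: H0 (ltnW n0n).
Qed.

Lemma linear_growth_time_change (e : nat -> nat) y (a b M : R) :
  0 < a -> (forall k, (e k < e k.+1)%N) ->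
  (forall n, `|y n.+1 - y n| <= M) ->
  linear_growth (fun k => (e k)%:R) a -> linear_growth (fun k => y (e k)) b ->
  linear_growth y (b / a).
Proof.
move=> a0 einc ystep ea yb.
have M0 : 0 <= M := le_trans (normr_ge0 _) (ystep 0%N).
have ydist m n : `|y (m + n)%N - y m| <= M * n%:R.
  elim: n => [|n IH]; first by rewrite addn0 subrr normr0 mulr0.
  rewrite addnS -[n.+1%:R]natr1 mulrDr mulr1.
  have -> : y (m + n).+1 - y m = (y (m + n).+1 - y (m + n)%N) + (y (m + n)%N - y m).
    by ring.
  by apply: le_trans (ler_normD _ _) _; rewrite addrC lerD.
have ele k l : (k <= l)%N -> (e k <= e l)%N.
  move=> /subnK <-; elim: (l - k)%N => // r IH.
  by rewrite addSn; apply: leq_trans IH (ltnW (einc _)).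
have ek k : (k <= e k)%N by elim: k => // k IH; apply: leq_ltn_trans IH (einc k).
(* C collects the factors of eta * k in the final estimate: 3 M for the motion between e k and n, 1
   for y (e k), and 2 |b / a| for replacing a * k by n. *)
move=> delta d0; pose C := 3 * M + 1 + 2 * `|b / a|.
have C0 : 0 < C by rewrite /C; have := normr_ge0 (b / a); lra.
pose eta := Num.min (a / 2) (delta * a / (2 * C)).
have eta0 : 0 < eta by rewrite lt_min !divr_gt0 ?mulr_gt0.
have eta1 : eta <= a / 2 by rewrite ge_min lexx.
have eta2 : eta * (2 * C) <= delta * a.
  by rewrite -ler_pdivlMr ?mulr_gt0// ge_min lexx orbT.
have [k0 H0] := ea _ eta0; have [k1 H1] := yb _ eta0.
(* The summand a + eta arises because n is only bounded by e k.+1; for large k it is absorbed into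
   eta * k. *)
have [k2 H2] := eventually_small (a + eta) eta0.
pose K := maxn k0 (maxn k1 k2); exists (e K) => n Kn.
have ex : exists k, (K <= k)%N && (e k <= n)%N by exists K; rewrite leqnn.
have ub k : (K <= k)%N && (e k <= n)%N -> (k <= n)%N.
  by move=> /andP[_]; apply: leq_trans.
case: (ex_maxnP ex ub) => k /andP[Kk ekn] kmax.
have nek : (n < e k.+1)%N.
  rewrite ltnNge; apply/negP => h; have := kmax k.+1.
  by rewrite h (leq_trans Kk) ?leqnSn//= ltnn => /(_ isT).
move: (Kk); rewrite !geq_max => /andP[k0k /andP[k1k k2k]].
have := H0 _ k0k; rewrite ler_norml => /andP[e1 e2].
have := H0 _ (leqW k0k); rewrite ler_norml => /andP[e3 e4].
have y1 := H1 _ k1k; have a1 := H2 _ k2k.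
have kS : k.+1%:R = k%:R + 1 :> R by rewrite -[k.+1]addn1 natrD.
rewrite kS in e3 e4.
have nR1 : (e k)%:R <= n%:R :> R by rewrite ler_nat.
have nR2 : n%:R <= (e k.+1)%:R :> R by rewrite ler_nat ltnW.
have kk0 : 0 <= k%:R :> R by [].
have dn : n%:R - (e k)%:R <= 3 * eta * k%:R by nra.
have yd : `|y n - y (e k)| <= M * (3 * eta * k%:R).
  have := ydist (e k) (n - e k)%N; rewrite subnKC// natrB// => h.
  by apply: le_trans h _; rewrite ler_wpM2l.
have an : `|a * k%:R - n%:R| <= 2 * eta * k%:R.
  by rewrite ler_norml; apply/andP; split; nra.
have -> : y n - b / a * n%:R = (y n - y (e k)) + (y (e k) - b * k%:R) +
    b / a * (a * k%:R - n%:R).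
  by field; rewrite gt_eqF.
apply: le_trans (ler_normD _ _) _; apply: (@le_trans _ _ (C * eta * k%:R)).
  rewrite normrM; have := ler_normD (y n - y (e k)) (y (e k) - b * k%:R).
  have : `|b / a| * `|a * k%:R - n%:R| <= `|b / a| * (2 * eta * k%:R) by rewrite ler_wpM2l.
  rewrite /C; nra.
have kn : a / 2 * k%:R <= n%:R by nra.
have : C * eta * k%:R * 2 <= delta * a * k%:R.
  by have := ler_wpM2r kk0 eta2; lra.
have : delta * (a / 2 * k%:R) <= delta * n%:R by rewrite ler_wpM2l// ltW.
lra.
Qed.

Lemma limn_einf_eq0 (u : nat -> R) : (forall n, 0 <= u n) ->
  (forall (delta : R) n0, 0 < delta -> exists2 n, (n0 <= n)%N & u n <= delta) ->
  limn_einf (fun n => (u n)%:E) = 0%E.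
Proof.
move=> u0 small; rewrite limn_einf_lim; apply: (@cvg_lim _ (@ereal_hausdorff R)).
rewrite (_ : einfs _ = cst 0%E); first exact: cvg_cst.
apply/funext => n; rewrite /einfs /=; apply/eqP; rewrite eq_le; apply/andP; split; last first.
  by apply: le_ereal_inf_tmp => _ [k _ <-]; rewrite lee_fin.
apply/lee_addgt0Pr => delta d0; have [k nk uk] := small _ n d0.
rewrite add0e; apply: le_trans (_ : (u k)%:E <= _)%E; last by rewrite lee_fin.
by apply: ereal_inf_lbound; exists k.
Qed.

(** By Bernoulli's inequality the powers of y > 1 grow at least linearly. *)
Lemma power_bounded_le1 (y B : R) : (forall l, y ^+ l <= B) -> y <= 1.
Proof.
move=> yB; rewrite leNgt; apply/negP => y1; have d0 : 0 < y - 1 by rewrite subr_gt0.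
have bern l : 1 + l%:R * (y - 1) <= y ^+ l.
  elim: l => [|l IH]; first by rewrite mul0r addr0 expr0.
  rewrite exprS -natr1; have l0 : 0 <= l%:R :> R by [].
  have : y * (1 + l%:R * (y - 1)) <= y * y ^+ l by rewrite ler_wpM2l//; lra.
  have : 0 <= l%:R * (y - 1) * (y - 1) by rewrite !mulr_ge0// ltW.
  move: (y * y ^+ l) => v; lra.
have := bern (Num.truncn (B / (y - 1))).+1.
have := Num.Theory.truncnS_gt (B / (y - 1)).
rewrite ltr_pdivrMr// => h1 h2; have := yB (Num.truncn (B / (y - 1))).+1; lra.
Qed.

Lemma weighted_geometric_sum (s : R) n : 0 <= s < 1 ->
  \sum_(m < n) m.+1%:R * s ^+ m <= ((1 - s) ^+ 2)^-1.
Proof.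
move=> /andP[s0 s1]; have d0 : 0 < (1 - s) ^+ 2 by rewrite exprn_gt0// subr_gt0.
rewrite -[leRHS]mul1r ler_pdivlMr//.
have -> : (\sum_(m < n) m.+1%:R * s ^+ m) * (1 - s) ^+ 2 =
    1 - s ^+ n * (1 + n%:R * (1 - s)).
  elim: n => [|n IH]; first by rewrite big_ord0 mul0r mul0r addr0 mulr1 expr0 subrr.
  by rewrite big_ord_recr /= mulrDl IH [s ^+ n.+1]exprS -natr1; ring.
rewrite gerBl mulr_ge0 ?exprn_ge0// addr_ge0// mulr_ge0//; lra.
Qed.

End LinearGrowth.

(** * The directed cover and its random walk *)

Section Tree.
Variables (G : countType) (E : rel G) (i0 : G).
Local Notation T := (directed_cover E i0).
Implicit Types (x y : T) (i j : G) (u v : seq G).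

(** If (label x, j) is not an edge, the value is the root by default; in sums over j such terms
    carry forward weight 0. *)
Definition child x j : T := insubd tree_root (j :: word x).

Lemma word_child x j : E (label x) j -> word (child x j) = j :: word x.
Proof.
move=> xj; rewrite -[word _]/(val _) /child val_insubd.
by rewrite ifT//= -/(label x) xj wordP.
Qed.

Lemma label_child x j : E (label x) j -> label (child x j) = j.
Proof. by move=> xj; rewrite /label word_child. Qed.

Lemma word_inj x y : word x = word y -> x = y.
Proof. exact: (@val_inj _ _ T). Qed.

Lemma word_parent x : word (parent x) = behead (word x).
Proof. by []. Qed.

Lemma parent_child x j : E (label x) j -> parent (child x j) = x.
Proof. by move=> xj; apply: word_inj; rewrite word_parent word_child. Qed.

Lemma child_neq_root x j : E (label x) j -> child x j != tree_root.
Proof. by move=> xj; apply/eqP => /(congr1 (@word _ _ _)); rewrite word_child. Qed.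

Lemma is_child_child x j : E (label x) j -> is_child x (child x j).
Proof. by move=> xj; rewrite /is_child child_neq_root// parent_child/=. Qed.

Lemma word_neq0 x : (x != tree_root) = (word x != [::]).
Proof.
apply/idP/idP; apply: contraNneq; first by move=> x0; apply/eqP/word_inj.
by move=> ->.
Qed.

Lemma is_childP x y : reflect (E (label x) (label y) /\ y = child x (label y))
  (is_child x y).
Proof.
apply: (iffP andP) => [[]|[xy ->]]; last first.
  by rewrite child_neq_root// parent_child.
rewrite word_neq0 => y0 /eqP <-.
have yE : word y = label y :: word (parent y).
  by rewrite /label word_parent; case: (word y) y0.
have e : E (label (parent y)) (label y).
  by have := wordP y; rewrite yE /= => /andP[].
by split=> //; apply: word_inj; rewrite word_child.
Qed.

Lemma size_word_child x y : is_child x y -> size (word y) = (size (word x)).+1.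
Proof. by move=> /is_childP[xy ->]; rewrite word_child. Qed.

Lemma parent_neq x : x != tree_root -> parent x != x.
Proof.
rewrite word_neq0; apply: contraNneq => /(congr1 (@word _ _ _)).
rewrite word_parent; case: (word x) => //= j s /(congr1 size)/= /esym/eqP.
by rewrite -[X in X == _]addn1 -[X in _ == X]addn0 eqn_add2l.
Qed.

Lemma is_child_parent x : x != tree_root -> is_child (parent x) x.
Proof. by rewrite /is_child => ->/=. Qed.

Lemma not_child_parent x : is_child x (parent x) = false.
Proof.
apply/negP => /size_word_child; rewrite word_parent size_behead; lia.
Qed.

(** Coordinates on the cone below x by words, latest label first; they identify the cones of
    vertices with equal labels. *)
Fixpoint graft u x : T := if u is j :: u' then child (graft u' x) j else x.

Fixpoint graftable x u : bool :=
  if u is j :: u' then E (label (graft u' x)) j && graftable x u' else true.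

Lemma word_graft x u : graftable x u -> word (graft u x) = u ++ word x.
Proof. by elim: u => //= j u IH /andP[uj xu]; rewrite word_child// IH. Qed.

Lemma label_graft x u : graftable x u -> label (graft u x) = head (label x) u.
Proof. by case: u => //= j u /andP[uj xu]; rewrite label_child. Qed.

Lemma graftable_label x y u : label x = label y -> graftable x u -> graftable y u.
Proof.
move=> xy; elim: u => //= j u IH /andP[uj xu]; rewrite IH// andbT.
by rewrite label_graft ?IH// -xy -label_graft.
Qed.

Lemma graft_root_word x : exists2 u, graftable tree_root u & graft u tree_root = x.
Proof.
case: x => s xs; exists s; last first.
  apply: word_inj; rewrite word_graft ?cats0//=.
  elim: s xs => //= j s IH /andP[sj /[dup] vs /IH us]; rewrite us andbT.
  by rewrite label_graft//= ; case: s sj {IH vs us}.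
elim: s xs => //= j s IH /andP[sj /IH us]; rewrite us andbT.
by rewrite label_graft//=; case: s sj {IH us}.
Qed.

Lemma length_child (R : realType) (w : G -> G -> R) (x : T) j : E (label x) j ->
  length_fun w (child x j) = length_fun w x + w (label x) j.
Proof. by move=> xj; rewrite /length_fun word_child. Qed.

Lemma length_bound (R : realType) (wt : G -> G -> R) (M : R) (x : T) :
  (forall i j, `|wt i j| <= M) ->
  `|length_fun wt x| <= M * (size (word x))%:R.
Proof.
move=> wM; rewrite /length_fun; elim: (word x) => [|j s IH] /=.
  by rewrite normr0 mulr0.
rewrite -[(size s).+1%:R]natr1 mulrDr mulr1.
by apply: le_trans (ler_normD _ _) _; rewrite lerD.
Qed.

Lemma length_ge0 (R : realType) (w : G -> G -> R) (x : T) : (forall i j, 0 <= w i j) ->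
  0 <= length_fun w x.
Proof.
by move=> w0; rewrite /length_fun; elim: (word x) => //= j s IH; rewrite addr_ge0.
Qed.

Lemma path_tree_adj (x : T) : exists2 s, path (@tree_adj G E i0) tree_root s &
  size s = size (word x) /\ last tree_root s = x.
Proof.
have [u ru <-] := graft_root_word x; rewrite word_graft// cats0.
elim: u ru => [|j u IH] /=; first by exists [::].
move=> /andP[uj ru]; have [s ps [sz ls]] := IH ru.
exists (rcons s (child (graft u tree_root) j)); last first.
  by rewrite size_rcons sz last_rcons.
by rewrite rcons_path ps ls /tree_adj /= is_child_child.
Qed.

Lemma path_tree_adj_size (x : T) s : path (@tree_adj G E i0) x s ->
  (size (word (last x s)) <= size (word x) + size s)%N.
Proof.
elim: s x => [|y s IH] x /=; first by rewrite addn0.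
move=> /andP[xy /IH h]; apply: leq_trans h _.
by case/orP: xy => /size_word_child ->; lia.
Qed.

(** Each edge of the tree changes the word length by exactly one, and the ancestral line attains the
    bound. *)
Lemma heightE (x : T) : height x = size (word x).
Proof.
have [s ps [sz ls]] := path_tree_adj x.
have jx : joined_in (@tree_adj G E i0) tree_root x (size (word x)) by exists s.
have min m : joined_in (@tree_adj G E i0) tree_root x m -> (size (word x) <= m)%N.
  by move=> [r /path_tree_adj_size + [<- lr]]; rewrite lr.
rewrite /height /graph_dist; set D := [set n | _].
have [jg mg] : D (get D) by apply: (@getPex _ D); exists (size (word x)).
by apply/eqP; rewrite eqn_leq mg// min.
Qed.

Lemma length_fun1 (R : realType) (x : T) : length_fun (fun _ _ => 1 : R) x = (height x)%:R.
Proof.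
rewrite heightE /length_fun; elim: (word x) => //= j s ->.
by rewrite natr1.
Qed.

End Tree.

(** * One-step formulas and taboo probabilities on the tree *)

Section Walk.
Variables (R : realType) (G : countType) (E : rel G) (i0 : G).
Variables (pG : G -> G -> R) (pb : G -> R) (eps : R).
Hypothesis pG_ge0 : forall i j, 0 <= pG i j.
Hypothesis pG_stochastic : forall i, (\esum_(j in [set: G]) (pG i j)%:E = 1)%E.
Hypothesis pG_edge : forall i j, 0 < pG i j <-> E i j.
Hypothesis eps_bounds : 0 < eps < 1.
Hypothesis pb_bounds : forall i, eps < pb i < 1 - eps.
Local Notation T := (directed_cover E i0).
Local Notation t := (cover_walk pG pb : T -> T -> R).
Local Notation fwd := (forward pG pb).

Lemma pb01 i : 0 < pb i < 1.
Proof. by have := pb_bounds i; have := eps_bounds; lra. Qed.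

Lemma forward_ge0 i j : 0 <= fwd i j.
Proof. by rewrite mulr_ge0// subr_ge0; have := pb01 i; lra. Qed.

Lemma forward_gt0 i j : (0 < fwd i j) = E i j.
Proof.
have b : 0 < 1 - pb i by rewrite subr_gt0; have := pb01 i; lra.
by rewrite /forward pmulr_rgt0//; apply/idP/idP => /pG_edge.
Qed.

Lemma forward_eq0 i j : ~~ E i j -> fwd i j = 0.
Proof. by rewrite -forward_gt0 lt_def forward_ge0 andbT negbK => /eqP. Qed.

Lemma sum_forward i : (\esum_(j in [set: G]) (fwd i j)%:E = (1 - pb i)%:E)%E.
Proof.
under eq_esum do rewrite EFinM.
rewrite esumZl ?pG_stochastic ?mule1//; last by move=> j _; rewrite lee_fin.
by rewrite subr_ge0; have := pb01 i; lra.
Qed.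

Lemma cover_walk_child x j : E (label x) j -> t x (child x j) = fwd (label x) j.
Proof.
by move=> xj; rewrite /cover_walk is_child_child// label_child.
Qed.

Lemma cover_walk_parent (x : T) : t x (parent x) = pb (label x).
Proof.
rewrite /cover_walk not_child_parent eqxx andbT.
by have [->|//] := eqVneq x tree_root.
Qed.

(** As [parent] fixes the root, the loop at the root is a backward step like any other, and one
    formula covers all vertices. *)
Lemma cover_walk_split x y :
  ((t x y)%:E = (pb (label x) * (y == parent x)%:R)%:E +
    \esum_(j in [set: G]) (fwd (label x) j * (y == child x j)%:R)%:E)%E.
Proof.
have [xy|xy] := boolP (is_child x y).
  have /is_childP[xye yE] := xy.
  rewrite (esum_only (x := label y)).
  - rewrite -yE eqxx mulr1 /cover_walk xy.
    rewrite (_ : y == parent x = false) ?mulr0 ?add0e//.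
    by apply/eqP => yp; move: xy; rewrite yp not_child_parent.
  - by rewrite lee_fin mulr_ge0// forward_ge0.
  - move=> j jy; have [xj|xj] := boolP (E (label x) j); last by rewrite forward_eq0// mul0r.
    rewrite (_ : y == _ = false) ?mulr0//; apply: contraNF jy => /eqP ->.
    by rewrite label_child.
rewrite esum1 ?adde0; last first.
  move=> j _; have [xj|xj] := boolP (E (label x) j); last by rewrite forward_eq0// mul0r.
  rewrite (_ : y == _ = false) ?mulr0//; apply: contraNF xy => /eqP ->.
  exact: is_child_child.
rewrite /cover_walk (negPf xy); have [->|yp] := eqVneq y (parent x).
  by rewrite mulr1 andbT; have [->|//] := eqVneq x tree_root.
rewrite andbF mulr0; case: ifP => // /andP[/eqP x0 /eqP y0].
by move: yp; rewrite x0 y0 (_ : parent _ = tree_root) ?eqxx//; exact: word_inj.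
Qed.

Lemma cover_walk_ge0 x y : 0 <= t x y.
Proof.
rewrite -lee_fin cover_walk_split adde_ge0//.
  by rewrite lee_fin mulr_ge0//; have := pb01 (label x); lra.
by apply: esum_ge0 => j _; rewrite lee_fin mulr_ge0// forward_ge0.
Qed.

Lemma esum_cover_walk (phi : T -> \bar R) x : (forall y, 0 <= phi y)%E ->
  (\esum_(y in [set: T]) (t x y)%:E * phi y =
   (pb (label x))%:E * phi (parent x) +
   \esum_(j in [set: G]) (fwd (label x) j)%:E * phi (child x j))%E.
Proof.
move=> phi0; have pbx : 0 <= pb (label x) by have := pb01 (label x); lra.
have b0 y : (0 <= \esum_(j in [set: G]) (fwd (label x) j * (y == child x j)%:R)%:E)%E.
  by apply: esum_ge0 => j _; rewrite lee_fin mulr_ge0// forward_ge0.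
have a0 y : (0 <= (pb (label x) * (y == parent x)%:R)%:E)%E by rewrite lee_fin mulr_ge0.
have c0 y j : (0 <= (fwd (label x) j * (y == child x j)%:R)%:E * phi y)%E.
  by rewrite mule_ge0// lee_fin mulr_ge0// forward_ge0.
under eq_esum => y _.
  rewrite cover_walk_split ge0_muleDl// -esumZr//; last first.
    by move=> j; rewrite lee_fin mulr_ge0// forward_ge0.
over.
rewrite esumD; first last.
- by move=> y _; exact: esum_ge0.
- by move=> y _; rewrite mule_ge0.
congr (_ + _)%E.
  rewrite (esum_only (x := parent x)) ?eqxx ?mulr1//; first by rewrite mule_ge0.
  by move=> y /negPf ->; rewrite mulr0 mul0e.
rewrite esum_swap//; apply: eq_esum => j _.
rewrite (esum_only (x := child x j)) ?eqxx ?mulr1//.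
  by rewrite mule_ge0// lee_fin forward_ge0.
by move=> y /negPf ->; rewrite mulr0 mul0e.
Qed.

Lemma sum_cover_walk x : (\esum_(y in [set: T]) (t x y)%:E = 1)%E.
Proof.
have := @esum_cover_walk (fun=> 1%E) x (fun=> lee01).
under eq_esum do rewrite mule1.
under [in RHS]eq_esum do rewrite mule1.
by move=> ->; rewrite sum_forward mule1 -EFinD addrC subrK.
Qed.

Local Notation tb x := (taboo t (pred1 (parent x))).

Lemma taboo_hit (y z : T) n : taboo t (pred1 y) y z n = ((n == 0%N) && (y == z))%:R%:E.
Proof. by case: n => [|n]; rewrite ?taboo0 ?tabooS//= ?eqxx//; exact: cover_walk_ge0. Qed.

Lemma graft_eq (x : T) u v : graftable x u -> graftable x v -> (graft u x == graft v x) = (u == v).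
Proof.
move=> xu xv; apply/eqP/eqP => [|->//] /(congr1 (@word _ _ _)).
rewrite !word_graft// => e.
have su : size u = size v by move/(congr1 size): e; rewrite !size_cat => /addIn.
by move/eqP: e; rewrite eqseq_cat// => /andP[/eqP].
Qed.

Lemma graft_neq_parent (x : T) u : x != tree_root -> graftable x u ->
  graft u x != parent x.
Proof.
move=> x0 xu; apply: contraTneq x0 => /(congr1 (fun y => size (word y))).
rewrite word_graft// size_cat word_parent size_behead word_neq0 negbK.
by case: (word x) => //= j s; lia.
Qed.

(** Until it hits the ancestor the walk stays in the cone, whose transition probabilities depend
    only on the label of its top. This makes the choice of [rep] irrelevant. *)
Lemma taboo_label (x y : T) u v n : x != tree_root -> y != tree_root ->
  label x = label y -> graftable x u -> graftable x v ->
  tb x (graft u x) (graft v x) n = tb y (graft u y) (graft v y) n.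
Proof.
move=> x0 y0 xy; have t0 := cover_walk_ge0.
elim: n u v => [|n IH] u v xu xv.
  have yu := graftable_label xy xu; have yv := graftable_label xy xv.
  by rewrite !taboo0 !graft_eq.
have yu := graftable_label xy xu; have yv := graftable_label xy xv.
rewrite !tabooS//= !(negPf (graft_neq_parent _ _))//.
rewrite !esum_cover_walk; do ?by move=> ?; exact: taboo_ge0.
rewrite !label_graft// xy; congr (_ * _ + _)%E.
  (* At the top of the cone a backward step enters the taboo vertex; elsewhere it remains in the
     cone. *)
  case: u xu yu => [|j u] /=.
    rewrite !taboo_hit; case: n {IH} => //=.
    rewrite eq_sym (negPf (graft_neq_parent x0 xv)).
    by rewrite eq_sym (negPf (graft_neq_parent y0 yv)).
  move=> /andP[xj xu] /andP[yj yu].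
  by rewrite !parent_child//; exact: IH.
apply: eq_esum => j _.
have [yj|yj] := boolP (E (head (label y) u) j); last by rewrite forward_eq0// !mul0e.
congr (_ * _)%E; apply: (IH (j :: u)) => //=.
by rewrite label_graft// xy yj.
Qed.

(** The ancestor can be entered from the cone only through x. Since [taboo] unfolds at the first
    step, the last step is isolated by induction over all starting points of the cone. *)
Lemma taboo_last_step (x : T) u n : x != tree_root -> graftable x u ->
  tb x (graft u x) (parent x) n.+1 = ((pb (label x))%:E * tb x (graft u x) x n)%E.
Proof.
move=> x0; have t0 := cover_walk_ge0; have pbx : 0 <= pb (label x) by have := pb01 (label x); lra.
elim: n u => [|n IH] u xu.
  rewrite tabooS//= (negPf (graft_neq_parent _ _))//.
  rewrite esum_cover_walk; last by move=> ?; exact: taboo_ge0.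
  rewrite [X in (_ + X)%E]esum1 ?adde0; last first.
    move=> j _; have [xj|xj] := boolP (E (label (graft u x)) j); last first.
      by rewrite forward_eq0// mul0e.
    rewrite taboo0 (negPf (_ : child _ _ != _)) ?mule0//.
    by apply: (graft_neq_parent (u := j :: u)) => //=; rewrite xj.
  rewrite !taboo0; case: u xu => [|j u] /=; first by rewrite !eqxx.
  move=> /andP[xj xu]; rewrite parent_child// (negPf (graft_neq_parent _ _))//.
  rewrite mule0 (_ : child _ _ == x = false) ?mule0//.
  by apply: (@graft_eq x (j :: u) [::]) => //=; rewrite xj.
rewrite tabooS//= [in RHS]tabooS//= (negPf (graft_neq_parent _ _))//.
rewrite !esum_cover_walk; do ?by move=> ?; exact: taboo_ge0.
rewrite ge0_muleDr; first last.
- by apply: esum_ge0 => j _; rewrite mule_ge0 ?lee_fin ?forward_ge0 ?taboo_ge0//.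
- by rewrite mule_ge0 ?taboo_ge0 ?lee_fin//; have := pb01 (label (graft u x)); lra.
rewrite -[X in _ = (_ + X)%E]esumZl//; last first.
  by move=> j _; rewrite mule_ge0 ?lee_fin ?forward_ge0 ?taboo_ge0//.
congr (_ + _)%E.
  rewrite muleCA; congr (_ * _)%E; case: u xu => [|j u] /=.
    by rewrite !taboo_hit /= (negPf (parent_neq x0)) andbF mule0.
  by move=> /andP[xj xu]; rewrite parent_child//; exact: IH.
apply: eq_esum => j _; rewrite muleCA.
have [xj|xj] := boolP (E (label (graft u x)) j); last by rewrite forward_eq0// !mul0e.
congr (_ * _)%E; apply: (IH (j :: u)) => //=.
by rewrite xj.
Qed.

Lemma F_coef_taboo (x : T) n : F_coef pG pb x n = tb x x (parent x) n.
Proof.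
rewrite -prob_from_taboo; last exact: cover_walk_ge0.
rewrite /F_coef; congr (prob_from _ _ _ _); apply/seteqP.
by split=> Y [? h]; split=> // m /h /eqP.
Qed.

Lemma Gbar_coef_taboo (x : T) n : Gbar_coef pG pb x n = tb x x x n.
Proof.
rewrite -prob_from_taboo; last exact: cover_walk_ge0.
rewrite /Gbar_coef; congr (prob_from _ _ _ _); apply/seteqP.
by split=> Y [? h]; split=> // m /h /eqP.
Qed.

Lemma Gbar_coef_label (x y : T) n : x != tree_root -> y != tree_root ->
  label x = label y -> Gbar_coef pG pb x n = Gbar_coef pG pb y n.
Proof.
by move=> x0 y0 xy; rewrite !Gbar_coef_taboo; exact: (@taboo_label x y [::] [::]).
Qed.

Lemma F_coefS (x : T) n : x != tree_root ->
  F_coef pG pb x n.+1 = ((pb (label x))%:E * Gbar_coef pG pb x n)%E.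
Proof.
by move=> x0; rewrite F_coef_taboo Gbar_coef_taboo; exact: (@taboo_last_step x [::]).
Qed.

Lemma F_coef0 (x : T) : x != tree_root -> F_coef pG pb x 0 = 0%E.
Proof. by move=> x0; rewrite F_coef_taboo taboo0 eq_sym (negPf (parent_neq x0)). Qed.

End Walk.

(** * The exit chain *)

Section RateOfEscape.
Variables (R : realType) (G : countType) (E : rel G) (i0 : G).
Variables (pG : G -> G -> R) (pb : G -> R) (eps : R).
Local Notation T := (directed_cover E i0).
Variables (rep : G -> T).
Hypothesis pG_ge0 : forall i j, 0 <= pG i j.
Hypothesis pG_stochastic : forall i, (\esum_(j in [set: G]) (pG i j)%:E = 1)%E.
Hypothesis pG_edge : forall i j, 0 < pG i j <-> E i j.
Hypothesis eps_bounds : 0 < eps < 1.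
Hypothesis pb_bounds : forall i, eps < pb i < 1 - eps.
Hypothesis repP : forall i, rep i <> tree_root /\ label (rep i) = i.
Hypothesis Qposrec : positive_recurrent (qmat pG pb rep).
Local Notation t := (cover_walk pG pb : T -> T -> R).
Local Notation fwd := (forward pG pb).

Let t0 : forall x y : T, 0 <= t x y.
Proof. exact: (cover_walk_ge0 pG_ge0 pG_edge eps_bounds pb_bounds). Qed.
Let t1 : forall x : T, (\esum_(y in [set: T]) (t x y)%:E = 1)%E.
Proof. exact: (sum_cover_walk pG_ge0 pG_stochastic pG_edge eps_bounds pb_bounds). Qed.
Let fwd0 : forall i j, 0 <= fwd i j.
Proof. exact: (forward_ge0 pG_ge0 eps_bounds pb_bounds). Qed.
Let pb01' i : 0 < pb i < 1.
Proof. exact: (pb01 eps_bounds pb_bounds). Qed.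
Let rep0 i : rep i != tree_root.
Proof. by apply/eqP; case: (repP i). Qed.
Let repl i : label (rep i) = i.
Proof. by case: (repP i). Qed.

Let gen_fun1 (a : nat -> \bar R) : gen_fun a 1 = (\sum_(0 <= n <oo) a n)%E.
Proof. by apply: eq_eseriesr => n _; rewrite expr1n mule1. Qed.

Lemma Gbar_coef_ge0 (x : T) n : (0 <= Gbar_coef pG pb x n)%E.
Proof.
by rewrite (Gbar_coef_taboo pG_ge0 pG_edge eps_bounds pb_bounds) taboo_ge0.
Qed.

Lemma FbackE i : Fback pG pb rep i 1 = ((pb i)%:E * Gbar pG pb rep i 1)%E.
Proof.
rewrite /Fback /Gbar !gen_fun1 nneseries_recl//; last first.
  by move=> n _; rewrite (F_coef_taboo pG_ge0 pG_edge eps_bounds pb_bounds) taboo_ge0.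
rewrite (F_coef0 pG_ge0 pG_edge eps_bounds pb_bounds)// add0e.
rewrite -nneseries_addn; last first.
  by move=> n; rewrite (F_coef_taboo pG_ge0 pG_edge eps_bounds pb_bounds) taboo_ge0.
rewrite -nneseriesZl//; last by move=> n _; exact: Gbar_coef_ge0.
apply: eq_eseriesr => n _.
by rewrite addn1 (F_coefS pG_ge0 pG_edge eps_bounds pb_bounds)// repl.
Qed.

Lemma Fback_le1 i : (Fback pG pb rep i 1 <= 1)%E.
Proof.
rewrite /Fback gen_fun1.
under eq_eseriesr do rewrite (F_coef_taboo pG_ge0 pG_edge eps_bounds pb_bounds).
by apply: nneseries_taboo_le1 => //=.
Qed.

Let f i := fine (Fback pG pb rep i 1).
Let g i := fine (Gbar pG pb rep i 1).
Let gm i n := fine (Gbar_coef pG pb (rep i) n).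

(** An infinite value would make F(-i) = p(-i) Gbar_i(1) infinite, although F(-i) <= 1. *)
Lemma Gbar_fin i : Gbar pG pb rep i 1 \is a fin_num.
Proof.
have G0 : (0 <= Gbar pG pb rep i 1)%E.
  by rewrite /Gbar gen_fun1; apply: nneseries_ge0 => n _ _; exact: Gbar_coef_ge0.
rewrite ge0_fin_numE// ltNge leye_eq; apply/negP => /eqP Gy.
have := Fback_le1 i; rewrite FbackE Gy gt0_muley ?lte_fin; last by case/andP: (pb01' i).
by rewrite leye_eq.
Qed.

Lemma fineGbar i : (g i)%:E = Gbar pG pb rep i 1.
Proof. by rewrite fineK// Gbar_fin. Qed.

Lemma fineFback i : (f i)%:E = Fback pG pb rep i 1.
Proof. by rewrite fineK// FbackE fin_numM ?Gbar_fin. Qed.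

Lemma fE i : f i = pb i * g i.
Proof. by apply: EFin_inj; rewrite EFinM fineFback fineGbar FbackE. Qed.

Lemma Gbar_coef_le i n : (Gbar_coef pG pb (rep i) n <= (g i)%:E)%E.
Proof.
rewrite fineGbar /Gbar gen_fun1 nneseries_esumT; last by move=> k; exact: Gbar_coef_ge0.
by apply: (esum_le_term (a := Gbar_coef pG pb (rep i))) => k; exact: Gbar_coef_ge0.
Qed.

Lemma gmE i n : (gm i n)%:E = Gbar_coef pG pb (rep i) n.
Proof.
by rewrite fineK// ge0_fin_numE ?Gbar_coef_ge0// (le_lt_trans (Gbar_coef_le i n)) ?ltry.
Qed.

Lemma gm_ge0 i n : 0 <= gm i n.
Proof. by rewrite -lee_fin gmE Gbar_coef_ge0. Qed.

Lemma gm0 i : gm i 0 = 1.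
Proof.
apply: EFin_inj; rewrite gmE (Gbar_coef_taboo pG_ge0 pG_edge eps_bounds pb_bounds).
by rewrite taboo0 eqxx.
Qed.

Lemma esum_gm i : (\esum_(n in [set: nat]) (gm i n)%:E = (g i)%:E)%E.
Proof.
rewrite fineGbar /Gbar gen_fun1 nneseries_esumT; last by move=> k; exact: Gbar_coef_ge0.
by apply: eq_esum => n _; rewrite gmE.
Qed.

Lemma g_ge1 i : 1 <= g i.
Proof.
rewrite -(gm0 i) -lee_fin -esum_gm.
by apply: (esum_le_term (a := fun n => (gm i n)%:E)) => n; rewrite lee_fin gm_ge0.
Qed.

Lemma f_gt0 i : 0 < f i.
Proof. by rewrite fE mulr_gt0//; have := pb01' i; have := g_ge1 i; lra. Qed.

(* If F(-i) = 1, then the i-th row of Q vanishes, so i is not recurrent. *)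
Lemma f_lt1 i : f i < 1.
Proof.
rewrite lt_def -lee_fin fineFback Fback_le1 andbT; apply/eqP => f1.
have q0 j : qmat pG pb rep i j = 0.
  (* The quotient with denominator 1 - F(-i) = 0 has the default value 0. *)
  by rewrite /qmat -/(f i) -f1 subrr invr0 mulr0 !mul0r.
have [] := Qposrec i; rewrite /return_prob eseries0.
  by move=> /esym/eqP; rewrite onee_eq0.
move=> [//|n] _ _; apply: esum1 => s _.
by rewrite (tuple_eta s) /= q0 mul0r.
Qed.

Lemma qmatE i j : qmat pG pb rep i j = g i * fwd i j * ((1 - f j) / (1 - f i)).
Proof.
rewrite /qmat -/(f j) -/(f i) -/(g i); set r := _ / _.
by rewrite -mulrA mulrC [fwd i j * _]mulrC.
Qed.

(* The joint law, given that the current exit point has label i, of the number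
   m of steps between the first and the last visit of that exit point and of
   the label j of the next one. *)
Definition kappa i (m : nat) j : R := gm i m * fwd i j * ((1 - f j) / (1 - f i)).

Lemma ratio_gt0 i j : 0 < (1 - f j) / (1 - f i).
Proof. by rewrite divr_gt0// subr_gt0 f_lt1. Qed.

Lemma kappa_ge0 i m j : 0 <= kappa i m j.
Proof.
apply: mulr_ge0; last exact/ltW/ratio_gt0.
by rewrite mulr_ge0// gm_ge0.
Qed.

Lemma kappa_edge i m j : 0 < kappa i m j -> E i j.
Proof.
apply: contraTT => nE; rewrite /kappa.
by rewrite (forward_eq0 pG_ge0 pG_edge eps_bounds pb_bounds)// mulr0 mul0r ltxx.
Qed.

Lemma kappa0_gt0 i j : E i j -> 0 < kappa i 0 j.
Proof.
by move=> ij; rewrite /kappa gm0 mul1r mulr_gt0 ?ratio_gt0//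
  (forward_gt0 pG_edge eps_bounds pb_bounds).
Qed.

Lemma esum_kappa i j :
  (\esum_(m in [set: nat]) (kappa i m j)%:E = (qmat pG pb rep i j)%:E)%E.
Proof.
have r0 : 0 <= fwd i j * ((1 - f j) / (1 - f i)).
  by rewrite mulr_ge0//; exact/ltW/ratio_gt0.
rewrite qmatE -mulrA mulrC EFinM -esum_gm -esumZl//; last first.
  by move=> m _; rewrite lee_fin gm_ge0.
by apply: eq_esum => m _; rewrite -EFinM /kappa; congr EFin; ring.
Qed.

(** * Almost sure path properties and exit points *)

Context d (Omega : measurableType d).
Variables (P : probability Omega R) (X : nat -> Omega -> T).
Hypothesis Xmarkov : markov_chain t P X tree_root.
Hypothesis Xtransient : transient t.

Let mX n x : measurable (X n @^-1` [set x]).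
Proof. by case: Xmarkov. Qed.

Let start := X 0%N @^-1` [set tree_root].

Let start_markov : markov_at P t X 0 tree_root start.
Proof.
have [_ _ law] := Xmarkov; rewrite -[start]setTI.
by apply: markov_at_init => // n s; rewrite !setTI.
Qed.

Let negligible_not_start : P.-negligible (~` start).
Proof.
have [_ P1 _] := Xmarkov; have e : P (~` start) = 0%E.
  by rewrite probability_setC ?P1 ?subee//; exact: mX.
by apply/negligibleP => //; exact/measurableC/mX.
Qed.

Lemma visit_markov n x : markov_at P t X n x (start `&` X n @^-1` [set x]).
Proof.
have [+ _] := markov_at_taboo t0 mX n x pred0 start_markov.
by rewrite add0n (_ : [set w | _] = X n @^-1` [set x])//; apply/seteqP; split=> w // [].
Qed.

(** The events that n is the last visit of x are disjoint, and each has probability P (F n) * (1 -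
    u) with u < 1 the return probability. So the P (F n) are summable, and Borel-Cantelli
    applies. *)
Lemma finite_visits x : P.-negligible
  (start `&` [set w | forall N, exists n, (N <= n)%N /\ X n w = x]).
Proof.
pose F n := start `&` X n @^-1` [set x].
have mF n : measurable (F n) by case: (visit_markov n x).
have nr n := markov_at_no_return t0 mX (visit_markov n x).
exists (lim_sup_set F); split.
- by apply: bigcapT_measurable => n; exact: bigcup_measurable.
- apply: lim_sup_set_cvg0 => //.
  have U0 : (0 <= return_prob t x)%E.
    apply: nneseries_ge0 => n _ _; rewrite /first_return prob_from_expect//.
    by apply: expect_ge0 => // s; rewrite lee_fin.
  have Ufin : return_prob t x \is a fin_num.
    by rewrite ge0_fin_numE// (lt_trans (Xtransient x)) ?ltry.
  have := Xtransient x; rewrite -(fineK Ufin) lte_fin.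
  set u := fine _ => u1; have v0 : 0 < 1 - u by rewrite subr_gt0.
  have : ((\esum_(n in [set: nat]) P (F n)) * (1 - u)%:E <= 1)%E.
    rewrite -esumZr ?lee_fin ?(ltW v0)//.
    rewrite (eq_esum (b := fun n => P (F n `&` [set w | forall q, X (n + q.+1)%N w <> x])))
      ; last by move=> n _; rewrite (nr n).2 -(fineK Ufin).
    rewrite -measure_bigcup_count; [|by move=> n; case: (nr n)|].
      by apply: probability_le1; apply: bigcupT_measurable => n; case: (nr n).
    move=> m n _ _ [w [[[_ Xm] nm] [[_ Xn] nn]]]; apply/eqP; case: ltngtP => // lt.
      by case: (nm (n - m).-1); rewrite prednK ?subn_gt0// subnKC// ltnW.
    by case: (nn (m - n).-1); rewrite prednK ?subn_gt0// subnKC// ltnW.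
  rewrite -lee_pdivlMr// mul1e nneseries_esumT// => /le_lt_trans; apply.
  exact: ltry.
- by move=> w [Sw ex] N _; have [n [Nn Xn]] := ex N; exists n.
Qed.

(** On this event of probability one the exit points and exit times are well defined, and the
    remaining path arguments are deterministic. *)
Definition good : set Omega := [set w | [/\ X 0%N w = tree_root,
  forall n, 0 < t (X n w) (X n.+1 w) &
  forall x, exists N, forall n, (N <= n)%N -> X n w <> x]].

Lemma measurable_good : measurable good.
Proof.
rewrite (_ : good = start `&`
    ((\bigcap_n \bigcup_(z in [set z : T * T | 0 < t z.1 z.2])
      (X n @^-1` [set z.1] `&` X n.+1 @^-1` [set z.2])) `&`
    \bigcap_x \bigcup_N \bigcap_(n in [set n | (N <= n)%N]) ~` (X n @^-1` [set x]))).
  apply: measurableI => //; first exact: mX.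
  apply: measurableI.
    apply: bigcapT_measurable => n; apply: measurable_bigcup_count => z _.
    by apply: measurableI; exact: mX.
  rewrite -[X in measurable X]setCK setC_bigcap; apply: measurableC.
  apply: measurable_bigcup_count => x _; apply: measurableC.
  apply: bigcupT_measurable => N; apply: bigcap_measurable; first by exists N => /=.
  by move=> n _; apply: measurableC; exact: mX.
apply/seteqP; split=> w.
  move=> [w0 st fv]; split=> //; split.
    by move=> n _; exists (X n w, X n.+1 w) => //=.
  by move=> x _; have [N HN] := fv x; exists N.
move=> [w0 [st fv]]; split=> //.
  by move=> n; have [[x y] /= txy [-> ->]] := st n I.
by move=> x; have [N _ HN] := fv x I; exists N.
Qed.

Lemma negligible_not_good : P.-negligible (~` good).
Proof.
pose N2 n (z : T * T) := if t z.1 z.2 == 0 then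
  (start `&` X n @^-1` [set z.1]) `&` X n.+1 @^-1` [set z.2] else set0.
pose N3 x := start `&` [set w | forall N, exists n, (N <= n)%N /\ X n w = x].
apply: (@negligibleS _ _ _ _
    (~` start `|` (\bigcup_n \bigcup_z N2 n z `|` \bigcup_x N3 x))); last first.
  apply: negligibleU => //; apply: negligibleU.
    apply: negligible_bigcup => n; apply: negligible_bigcup_count => -[x y].
    rewrite /N2 /=; case: eqP => [txy|_]; last exact: negligible_set0.
    have [[mH _ _] PH] := markov_at_step mX y (visit_markov n x).
    rewrite txy mule0 in PH.
    by apply/negligibleP => //; exact: PH.
  by apply: negligible_bigcup_count => x; exact: finite_visits.
move=> w ng; apply: contrapT => /not_orP[Sw /not_orP[n2 n3]]; apply: ng.
have w0 : start w by exact: contrapT.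
split=> //.
  move=> n; rewrite lt_def t0 andbT; apply/eqP => t_0; apply: n2.
  by exists n => //; exists (X n w, X n.+1 w) => //; rewrite /N2 /= t_0 eqxx.
move=> x; apply: contrapT => h; apply: n3; exists x => //; split=> // N.
apply: contrapT => h'; apply: h; exists N => n Nn Xn; apply: h'.
by exists n.
Qed.

Lemma step_cases x y : 0 < t x y ->
  y = parent x \/ E (label x) (label y) /\ y = child x (label y).
Proof.
rewrite /cover_walk; case: ifP => [/is_childP ?|_]; first by right.
case: ifP => [/andP[_ /eqP]|_]; first by left.
case: ifP => [/andP[/eqP -> /eqP ->] _|_]; last by rewrite ltxx.
by left; apply: word_inj.
Qed.

Lemma stay_in_cone w N x : good w -> X N w = x ->
  (forall q, X (N + q)%N w <> parent x) ->
  forall q, exists2 u, graftable x u & X (N + q)%N w = graft u x.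
Proof.
move=> [_ st _] XN av; elim=> [|q [u xu Xq]]; first by exists [::] => //; rewrite addn0.
have := st (N + q)%N; rewrite -addnS => /step_cases[|[]].
  rewrite Xq; case: u xu Xq => [|j u] /= xu Xq XS; first by have := av q.+1; rewrite XS.
  by have /andP[uj xu'] := xu; exists u => //; rewrite XS parent_child.
rewrite Xq => uj XS; exists (label (X (N + q.+1)%N w) :: u) => //=.
by rewrite uj.
Qed.

(** Reaching the ancestor of x from below a child of x would require passing through x. *)
Lemma avoid_grandparent w N x j : good w -> x != tree_root -> E (label x) j ->
  X N w = child x j -> (forall q, X (N + q)%N w <> x) ->
  forall q, X (N + q)%N w <> parent x.
Proof.
move=> gw x0 xj XN av q.
have [|u xu ->] := @stay_in_cone w N (child x j) gw XN _ q.
  by move=> r; rewrite parent_child.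
move=> /(congr1 (fun y => size (word y))).
rewrite word_graft// size_cat word_child// word_parent size_behead /=; lia.
Qed.

Definition is_last x w n := X n w = x /\ forall q, (n < q)%N -> X q w <> x.

Lemma is_last_inj x w m n : is_last x w m -> is_last x w n -> m = n.
Proof. by move=> [Xm am] [Xn an]; case: (ltngtP m n) => // [/am|/an]. Qed.

Lemma last_visitP x w n0 : good w -> X n0 w = x ->
  exists2 n, (n0 <= n)%N & is_last x w n.
Proof.
move=> [_ _ fv] X0; have [N HN] := fv x.
have ex : exists n, X n w == x by exists n0; apply/eqP.
have ub n : X n w == x -> (n <= N)%N.
  by move=> /eqP Xn; rewrite leqNgt; apply/negP => /ltnW/HN.
case: (ex_maxnP ex ub) => n /eqP Xn mx; exists n; first by apply: mx; apply/eqP.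
split=> // q nq Xq; have := mx q; rewrite Xq eqxx => /(_ isT).
by rewrite leqNgt nq.
Qed.

(** Arbitrary when no last visit exists; on [good] every visited vertex has one. *)
Definition last_visit x w : nat := get (is_last x w).

Lemma last_visitE x w n : is_last x w n -> last_visit x w = n.
Proof.
move=> xn; apply: (is_last_inj _ xn).
exact: (@getPex _ (is_last x w) (ex_intro _ _ xn)).
Qed.

(* The k-th exit point, i.e. the unique vertex at distance k from the root
   that is visited after the last visit of its ancestor. *)
Fixpoint exit_point k w : T :=
  if k is k'.+1 then X (last_visit (exit_point k' w) w).+1 w else tree_root.

Definition exit_time k w : nat := last_visit (exit_point k w) w.

Lemma exit_pointS k w : exit_point k.+1 w = X (exit_time k w).+1 w.
Proof. by []. Qed.

Lemma exit_time_last k w : good w -> is_last (exit_point k w) w (exit_time k w).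
Proof.
move=> gw; have lst x n : X n w = x -> is_last x w (last_visit x w).
  by move=> /(last_visitP gw)[m _ xm]; rewrite (last_visitE xm).
by case: k => [|k]; [apply: (lst _ 0%N); case: gw|exact: (lst _ (exit_time k w).+1)].
Qed.

Lemma exit_time_lt k w : good w -> (exit_time k w < exit_time k.+1 w)%N.
Proof.
move=> gw; have [n kn xn] := last_visitP gw (erefl (X (exit_time k w).+1 w)).
by rewrite [exit_time k.+1 w](last_visitE xn).
Qed.

(** The step after the last visit of an exit point cannot lead to its ancestor, whose own last visit
    is already past; at the root such a step would be the loop, that is, another visit of the
    root. *)
Lemma exit_pointP k w : good w ->
  E (label (exit_point k w)) (label (exit_point k.+1 w)) /\
  exit_point k.+1 w = child (exit_point k w) (label (exit_point k.+1 w)).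
Proof.
move=> gw; have [_ st _] := gw; elim: k => [|k [IHE IH]].
  have [X0 a0] := exit_time_last 0 gw.
  have := st (exit_time 0 w); rewrite -exit_pointS X0 => /step_cases[|//].
  by move=> e; case: (a0 _ (ltnSn _)); rewrite -exit_pointS e; exact: word_inj.
have [Xk ak] := exit_time_last k.+1 gw; have [_ ak'] := exit_time_last k gw.
have := st (exit_time k.+1 w); rewrite -exit_pointS Xk => /step_cases[|//].
move=> e; case: (ak' (exit_time k.+1 w).+1); first by rewrite ltnS ltnW// exit_time_lt.
by rewrite -exit_pointS e IH parent_child.
Qed.

(** * The skeleton: labels and holding times of the exit points *)

Local Notation S := (G * nat * G)%type.

(** Numbering starts at the first exit point after the root, since the root with its loop follows
    another holding law. The middle entry counts the steps from the arrival just after the last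
    visit of the ancestor to the last visit of the exit point itself. *)
Definition skeleton k w : S := if pselect (good w) then
  (label (exit_point k.+1 w), exit_time k.+1 w - (exit_time k w).+1,
   label (exit_point k.+2 w))%N else (i0, 0%N, i0).

Lemma skeletonE k w : good w -> skeleton k w =
  (label (exit_point k.+1 w), exit_time k.+1 w - (exit_time k w).+1,
   label (exit_point k.+2 w))%N.
Proof. by rewrite /skeleton; case: pselect. Qed.

Lemma measurable_is_last x n : measurable [set w | is_last x w n].
Proof.
rewrite (_ : [set w | _] = X n @^-1` [set x] `&`
    \bigcap_(q in [set q | (n < q)%N]) ~` (X q @^-1` [set x])).
  apply: measurableI; first exact: mX.
  apply: bigcap_measurable; first by exists n.+1 => /=.
  by move=> q _; apply: measurableC; exact: mX.
by apply/seteqP; split=> w [Xn an]; split.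
Qed.

Lemma measurable_exit k x n :
  measurable (good `&` [set w | exit_point k w = x /\ exit_time k w = n]).
Proof.
elim: k x n => [|k IH] x n.
  have [->|x0] := eqVneq x tree_root; last first.
    rewrite (_ : _ `&` _ = set0)//; apply/seteqP; split=> // w [_ [/= e _]].
    by rewrite -e eqxx in x0.
  rewrite (_ : _ `&` _ = good `&` [set w | is_last tree_root w n]).
    by apply: measurableI; [exact: measurable_good|exact: measurable_is_last].
  apply/seteqP; split=> w [gw].
    by move=> [_ <-]; split=> //; exact: (exit_time_last 0 gw).
  by move=> xn; split=> //; split=> //; rewrite /exit_time (last_visitE xn).
rewrite (_ : _ `&` _ = \bigcup_y \bigcup_m
    ((good `&` [set w | exit_point k w = y /\ exit_time k w = m]) `&`
     (X m.+1 @^-1` [set x] `&` [set w | is_last x w n]))).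
  apply: measurable_bigcup_count => y _; apply: bigcupT_measurable => m.
  apply: measurableI => //; apply: measurableI; first exact: mX.
  exact: measurable_is_last.
apply/seteqP; split=> w.
  move=> [gw [ex et]]; exists (exit_point k w) => //; exists (exit_time k w) => //.
  split=> //; split; first by rewrite -ex.
  by rewrite -ex -et; exact: exit_time_last.
move=> [y _ [m _ [[gw [ey em]] [/= Xm xn]]]]; split=> //.
have e : exit_point k.+1 w = x by rewrite exit_pointS em.
by split=> //; rewrite /exit_time e (last_visitE xn).
Qed.

Lemma measurable_skeleton k s : measurable (skeleton k @^-1` [set s]).
Proof.
pose F (z : T * nat * (T * nat) * (T * nat)) :=
  if ((label z.1.2.1, (z.1.2.2 - z.1.1.2.+1)%N, label z.2.1) == s) then
  (good `&` [set w | exit_point k w = z.1.1.1 /\ exit_time k w = z.1.1.2]) `&`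
  ((good `&` [set w | exit_point k.+1 w = z.1.2.1 /\ exit_time k.+1 w = z.1.2.2]) `&`
  (good `&` [set w | exit_point k.+2 w = z.2.1 /\ exit_time k.+2 w = z.2.2]))
  else set0.
have mF z : measurable (F z).
  rewrite /F; case: ifP => // _; apply: measurableI; first exact: measurable_exit.
  by apply: measurableI; exact: measurable_exit.
rewrite (_ : _ @^-1` _ = \bigcup_z F z `|`
    (if s == (i0, 0%N, i0) then ~` good else set0)).
  apply: measurableU; first exact: measurable_bigcup_count.
  by case: ifP => // _; apply: measurableC; exact: measurable_good.
apply/seteqP; split=> w.
  have [gw|gw] := pselect (good w); last first.
    rewrite /= /skeleton; case: pselect => [//|ngw] <-; right.
    by rewrite eqxx.
  rewrite /= skeletonE// => ws; left.
  exists ((exit_point k w, exit_time k w), (exit_point k.+1 w, exit_time k.+1 w),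
    (exit_point k.+2 w, exit_time k.+2 w)) => //.
  by rewrite /F ifT//=; apply/eqP.
move=> [[z _]|].
  rewrite /F; have [zs|_] := eqVneq (_, _, _) s; last by [].
  move=> [[gw [e1 t1']] [[_ [e2 t2]] [_ [e3 t3]]]].
  by rewrite /= skeletonE// e2 e3 t2 t1' zs.
have [->|_] := eqVneq s (i0, 0%N, i0); last by [].
by move=> ngw; rewrite /= /skeleton; case: pselect.
Qed.

Lemma prob_good (B : set Omega) : measurable B -> P (good `&` B) = P B.
Proof.
move=> mB; have mg := measurable_good.
have nB : P (B `\` (good `&` B)) = 0%E.
  apply: (measure_negligible (mu := P)).
    by apply: measurableD => //; exact: measurableI.
  by apply: negligibleS negligible_not_good => w [Bw h] gw; apply: h.
have := nB; rewrite probability_setD_sub//; last exact: measurableI.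
have Pf C : measurable C -> P C \is a fin_num by move=> mC; exact: fin_num_measure.
rewrite -(fineK (Pf _ mB)) -(fineK (Pf _ (measurableI _ _ mg mB))) -EFinB => -[] /eqP.
by rewrite subr_eq0 => /eqP ->.
Qed.

Lemma F_coef_rep (x : T) n : x != tree_root ->
  F_coef pG pb x n = F_coef pG pb (rep (label x)) n.
Proof.
move=> x0; case: n => [|n].
  by rewrite !(F_coef0 pG_ge0 pG_edge eps_bounds pb_bounds).
rewrite !(F_coefS pG_ge0 pG_edge eps_bounds pb_bounds)// repl.
by rewrite (Gbar_coef_label pG_ge0 pG_edge eps_bounds pb_bounds (y := rep (label x))).
Qed.

Lemma taboo_gm (x : T) m : x != tree_root ->
  taboo t (pred1 (parent x)) x x m = (gm (label x) m)%:E.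
Proof.
move=> x0; rewrite gmE -(Gbar_coef_taboo pG_ge0 pG_edge eps_bounds pb_bounds).
exact: (Gbar_coef_label pG_ge0 pG_edge eps_bounds pb_bounds).
Qed.

Lemma markov_at_escape N x H : x != tree_root -> markov_at P t X N x H ->
  let A := good `&` H `&` [set w | forall q, X (N + q)%N w <> parent x] in
  measurable A /\ P A = (P H * (1 - f (label x))%:E)%E.
Proof.
move=> x0 HH; have [mH' PH'] := markov_at_avoid t0 mX (parent x) t1 HH.
rewrite /= -setIA; split; first by apply: measurableI => //; exact: measurable_good.
rewrite prob_good// PH' EFinB fineFback /Fback gen_fun1; congr (_ * (_ - _))%E.
apply: eq_eseriesr => n _.
by rewrite -F_coef_rep// (F_coef_taboo pG_ge0 pG_edge eps_bounds pb_bounds).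
Qed.

(* A forces W_(k+1) = x with exit from the ancestor of x at time N - 1, and
   depends on the future after N only through non-return to the ancestor. *)
Definition exit_event k (x : T) N (A : set Omega) : Prop :=
  [/\ x != tree_root,
      forall w, A w -> exit_point k.+1 w = x /\ (exit_time k w).+1 = N &
      exists2 H, markov_at P t X N x H &
        A = good `&` H `&` [set w | forall q, X (N + q)%N w <> parent x]].

Lemma exit_event_good k x N A : exit_event k x N A -> A `<=` good.
Proof. by move=> [_ _ [H _ ->]] w [[]]. Qed.

Lemma measurable_exit_event k x N A : exit_event k x N A -> measurable A.
Proof. by move=> [x0 _ [H HH ->]]; case: (markov_at_escape x0 HH). Qed.

(** Inside A, the next triple says: at x after m steps without touching the ancestor, then to the
    child, then never back to x. This has probability P H * gm * fwd * (1 - f j), while P A = P H *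
    (1 - f i), whence the factor [kappa]. *)
Lemma exit_event_step k x N A m j : exit_event k x N A -> E (label x) j ->
  let A' := A `&` skeleton k @^-1` [set (label x, m, j)] in
  exit_event k.+1 (child x j) (N + m).+1 A' /\
  P A' = (P A * (kappa (label x) m j)%:E)%E.
Proof.
move=> eA xj; have [x0 Aw [H HH AE]] := eA.
have [HH1 PH1] := markov_at_taboo t0 mX m x (pred1 (parent x)) HH.
set H1 := H `&` _ in HH1 PH1.
have [HH2 PH2] := markov_at_step mX (child x j) HH1.
set H2 := H1 `&` _ in HH2 PH2.
have A'E : A `&` skeleton k @^-1` [set (label x, m, j)] =
    good `&` H2 `&` [set w | forall q, X ((N + m).+1 + q)%N w <> parent (child x j)].
  rewrite parent_child//; apply/seteqP; split=> w.
    move=> [Aww sk]; have [ex et] := Aw _ Aww; have gw := exit_event_good eA Aww.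
    move: Aww; rewrite AE => -[[_ Hw] av].
    move: sk; rewrite /= skeletonE// => -[_ em ej].
    have lt := exit_time_lt k gw.
    have etm : exit_time k.+1 w = (N + m)%N.
      by rewrite -em -et subnKC.
    have [Xm am] := exit_time_last k.+1 gw; rewrite ex etm in Xm am.
    split; last by move=> q; apply: am; rewrite addSn ltnS leq_addr.
    split=> //; split.
      by split=> //; split=> // q qm; apply/eqP; exact: av.
    have [_ e] := exit_pointP k.+1 gw.
    by rewrite /= -etm -exit_pointS e ej ex.
  move=> [[gw [[Hw [Xm am]] /= Xj]] av].
  have Aww : A w.
    (* Up to time N + m the taboo forbids the ancestor; afterwards the walk is confined to the cone
       of the child. *)
    rewrite AE; split=> // q /=; have [qm|mq] := ltnP q m.
      by apply/eqP; exact: am.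
    have [<-|qm] := eqVneq m q; first by rewrite Xm; apply/eqP; rewrite eq_sym parent_neq.
    have mq' : (m < q)%N by rewrite ltn_neqAle qm.
    rewrite (_ : N + q = (N + m).+1 + (q - m.+1))%N; last by lia.
    exact: (avoid_grandparent gw x0 xj Xj av).
  split=> //; have [ex et] := Aw _ Aww.
  have lst : is_last x w (N + m).
    split=> // q Nq; rewrite (_ : q = (N + m).+1 + (q - (N + m).+1))%N; last by lia.
    exact: av.
  have et' : exit_time k.+1 w = (N + m)%N by rewrite /exit_time ex (last_visitE lst).
  suff : skeleton k w = (label x, m, j) by [].
  rewrite skeletonE// (exit_pointS k.+1) et' Xj label_child// ex et; congr (_, _, _); lia.
split; last first.
  rewrite A'E (markov_at_escape _ HH2).2 ?child_neq_root// label_child//.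
  rewrite PH2 PH1 taboo_gm// AE (markov_at_escape x0 HH).2.
  rewrite cover_walk_child// -!muleA -!EFinM; congr (_ * _%:E)%E.
  have n0 : 1 - f (label x) != 0 by rewrite subr_eq0 gt_eqF// f_lt1.
  by rewrite /kappa; field.
split; first exact: child_neq_root.
  move=> w; rewrite A'E => -[[gw [[Hw [Xm am]] Xj]] av].
  have Xj' : X (N + m).+1 w = child x j := Xj; rewrite parent_child// in av.
  have lst : is_last x w (N + m).
    split=> // q Nq; rewrite (_ : q = (N + m).+1 + (q - (N + m).+1))%N; last by lia.
    exact: av.
  have : (A `&` skeleton k @^-1` [set (label x, m, j)]) w.
    by rewrite A'E; split; rewrite ?parent_child//; split.
  move=> [Aww _]; have [ex et] := Aw _ Aww.
  have et' : exit_time k.+1 w = (N + m)%N by rewrite /exit_time ex (last_visitE lst).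
  by rewrite exit_pointS et' Xj'.
by exists H2.
Qed.

Lemma exit_event_skeleton k x N A s : exit_event k x N A ->
  P (A `&` skeleton k @^-1` [set s]) =
  (P A * ((label x == s.1.1)%:R * kappa s.1.1 s.1.2 s.2)%:E)%E.
Proof.
move=> eA; case: s => -[i m] j /=; have [xi|xi] := eqVneq (label x) i.
  rewrite -xi mul1r; have [xj|xj] := boolP (E (label x) j).
    by case: (exit_event_step m eA xj).
  rewrite (_ : _ `&` _ = set0) ?measure0.
    have := kappa_ge0 (label x) m j; rewrite le_eqVlt => /orP[/eqP <-|]; first by rewrite mule0.
    by move=> /kappa_edge; rewrite (negPf xj).
  apply/seteqP; split=> // w [Aw sk]; have gw := exit_event_good eA Aw.
  move: sk; rewrite /preimage /= skeletonE// => -[e1 _ e2].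
  have [] := exit_pointP k.+1 gw; rewrite e1 e2.
  by rewrite (negPf xj).
rewrite mul0r mule0 (_ : _ `&` _ = set0) ?measure0//.
apply/seteqP; split=> // w [Aw sk]; have gw := exit_event_good eA Aw.
move: sk; rewrite /preimage /= skeletonE// => -[e1 _ _].
have [_ /(_ _ Aw)[ex _] _] := eA.
by move: xi; rewrite -e1 -ex eqxx.
Qed.

Definition first_exit n x : set Omega :=
  good `&` (start `&` X n @^-1` [set tree_root] `&` X n.+1 @^-1` [set x])
  `&` [set w | forall q, X (n.+1 + q)%N w <> parent x].

Lemma first_exit_event n x : is_child tree_root x -> exit_event 0 x n.+1 (first_exit n x).
Proof.
move=> rx; have /andP[x0 /eqP px] := rx.
split=> //; last first.
  by eexists; [exact: (markov_at_step mX x (visit_markov n tree_root)).1|].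
move=> w [[gw [[_ Xn] Xn1]] av]; have Xn1' : X n.+1 w = x := Xn1.
have lst : is_last tree_root w n.
  split=> // q nq; rewrite (_ : q = n.+1 + (q - n.+1))%N; last by lia.
  by rewrite -px; exact: av.
have e0 : exit_time 0 w = n by rewrite /exit_time (last_visitE lst).
by rewrite exit_pointS e0.
Qed.

(** Every good path is classified by its last visit of the root and its first exit point. *)
Lemma bigcup_first_exit :
  good = \bigcup_n \bigcup_(x in [set x | is_child tree_root x]) first_exit n x.
Proof.
apply/seteqP; split=> w; last by move=> [n _ [x _ [[]]]].
move=> gw; exists (exit_time 0 w) => //.
have [e0 e1] := exit_pointP 0 gw; have [X0 a0] := exit_time_last 0 gw.
exists (exit_point 1 w); first by apply/is_childP.
split; last first.
  move=> q; have /is_childP/andP[_ /eqP ->] := conj e0 e1.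
  by apply: a0; rewrite addSn ltnS leq_addr.
by split=> //; split=> //; split=> //; case: gw.
Qed.

(** * The skeleton as a Markov chain and its invariant law *)

Variable nu : G -> R.
Hypothesis Gconnected : strongly_connected E.
Hypothesis nu_invariant : invariant_probability (qmat pG pb rep) nu.

Let P_good : P good = 1%E.
Proof. by rewrite -[good]setIT prob_good// probability_setT. Qed.

Lemma exists_first_exit : exists n x, is_child tree_root x /\ (0 < P (first_exit n x))%E.
Proof.
apply: contrapT => h; have : P good = 0%E.
  apply: (measure_negligible (mu := P)); first exact: measurable_good.
  rewrite bigcup_first_exit; apply: negligible_bigcup => n.
  apply: (@negligibleS _ _ _ _ (\bigcup_x (if is_child tree_root x then first_exit n x else set0))).
    by move=> w [x rx xw]; exists x => //; rewrite ifT.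
  apply: negligible_bigcup_count => x; case: ifP => rx; last exact: negligible_set0.
  have mA := measurable_exit_event (first_exit_event n rx).
  apply/negligibleP => //; apply: contrapT => /eqP Pn0; apply: h; exists n, x; split=> //.
  by rewrite lt_def measure_ge0 andbT.
by rewrite P_good => /eqP; rewrite onee_eq0.
Qed.

(** Starting from a first exit of positive probability, a path of G is followed with holding times
    0. Identities for [kappa] can then be read off from actual probabilities, for every label. *)
Lemma exists_exit_event i : exists k x N A,
  [/\ exit_event k x N A, (0 < P A)%E & label x = i].
Proof.
suff step s : forall k x N A, exit_event k x N A -> (0 < P A)%E -> path E (label x) s ->
    exists k x' N A, [/\ exit_event k x' N A, (0 < P A)%E & label x' = last (label x) s].
  have [n [x [rx Px]]] := exists_first_exit; have [s xs <-] := Gconnected (label x) i.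
  exact: (step s _ _ _ _ (first_exit_event n rx)).
elim: s => [|j s IH] k x N A eA PA /=; first by exists k, x, N, A.
move=> /andP[xj js]; have [eA' PA'] := exit_event_step 0 eA xj.
have lj : label (child x j) = j by exact: label_child.
have := IH _ _ _ _ eA'; rewrite lj; apply=> //.
by rewrite PA' mule_gt0// lte_fin kappa0_gt0.
Qed.

Definition skel_step (z s : S) : R := (z.2 == s.1.1)%:R * kappa s.1.1 s.1.2 s.2.

Definition skel_inv (s : S) : R := nu s.1.1 * kappa s.1.1 s.1.2 s.2.

Lemma skel_step_ge0 z s : 0 <= skel_step z s.
Proof. by rewrite mulr_ge0// kappa_ge0. Qed.

(** The skeleton takes some value, so its fibres exhaust an exit event of positive probability
    ending in label z.2; dividing by that probability gives the row sum. *)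
Lemma skel_step_sum z : (\esum_(s in [set: S]) (skel_step z s)%:E = 1)%E.
Proof.
have [k [x [N [A [eA PA xz]]]]] := exists_exit_event z.2.
have mA := measurable_exit_event eA.
have PAf : P A \is a fin_num by exact: fin_num_measure.
have := measure_fibers P mA (measurable_skeleton k).
under eq_esum do rewrite (exit_event_skeleton _ eA) xz -/(skel_step z _).
rewrite -(fineK PAf) esumZl ?fine_ge0//; last by move=> s _; rewrite lee_fin skel_step_ge0.
have PA0 : 0 < fine (P A) by rewrite fine_gt0// PA ltey_eq PAf.
move=> e; have : ((fine (P A))^-1%:E * (fine (P A))%:E = (fine (P A))^-1%:E *
   ((fine (P A))%:E * \esum_(s in [set: S]) (skel_step z s)%:E))%E by rewrite -e.
by rewrite muleA -EFinM mulVf ?gt_eqF// mul1e => <-.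
Qed.

Lemma esum_skel (F : G -> nat -> G -> \bar R) : (forall i m j, 0 <= F i m j)%E ->
  (\esum_(s in [set: S]) F s.1.1 s.1.2 s.2 =
   \esum_(i in [set: G]) \esum_(m in [set: nat]) \esum_(j in [set: G]) F i m j)%E.
Proof.
by move=> F0; rewrite !esum_pair// => z; exact: esum_ge0.
Qed.

Lemma esum_kappa_row i :
  (\esum_(m in [set: nat]) \esum_(j in [set: G]) (kappa i m j)%:E = 1)%E.
Proof.
have k0 k m j : (0 <= ((i == k)%:R * kappa k m j)%:E)%E.
  by rewrite lee_fin mulr_ge0// kappa_ge0.
rewrite -(skel_step_sum (i, 0%N, i)) (esum_skel k0) (esum_only (x := i)).
- by apply: eq_esum => m _; apply: eq_esum => j _; rewrite eqxx mul1r.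
- by do 2![apply: esum_ge0 => ? _].
- move=> k ki; apply: esum1 => m _; apply: esum1 => j _.
  by rewrite eq_sym (negPf ki) mul0r.
Qed.

Let nu0 i : 0 <= nu i. Proof. by case: nu_invariant. Qed.

Lemma qmat_ge0 i j : 0 <= qmat pG pb rep i j.
Proof.
by rewrite -lee_fin -esum_kappa; apply: esum_ge0 => ? _; rewrite lee_fin kappa_ge0.
Qed.

Lemma skel_inv_ge0 s : 0 <= skel_inv s.
Proof. by rewrite mulr_ge0// kappa_ge0. Qed.

Lemma skel_inv_sum : (\esum_(s in [set: S]) (skel_inv s)%:E = 1)%E.
Proof.
have F0 i m j : (0 <= (nu i * kappa i m j)%:E)%E by rewrite lee_fin mulr_ge0// kappa_ge0.
rewrite (esum_skel F0).
have [_ <- _] := nu_invariant; apply: eq_esum => i _.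
rewrite -[RHS]mule1 -(esum_kappa_row i) -esumZl//; last first.
  by move=> m _; apply: esum_ge0 => j _; rewrite lee_fin kappa_ge0.
apply: eq_esum => m _; rewrite -esumZl//.
by move=> j _; rewrite lee_fin kappa_ge0.
Qed.

Lemma skel_inv_invariant s :
  (\esum_(z in [set: S]) (skel_inv z * skel_step z s)%:E = (skel_inv s)%:E)%E.
Proof.
case: s => -[i m] j.
have F0 i' m' j' : (0 <= (nu i' * kappa i' m' j' * ((j' == i)%:R * kappa i m j))%:E)%E.
  by rewrite lee_fin mulr_ge0// mulr_ge0// kappa_ge0.
rewrite (esum_skel F0).
rewrite /skel_inv /= mulrC EFinM; have [_ _ <-] := nu_invariant.
have q0 k : [set: G] k -> (0 <= (nu k * qmat pG pb rep k i)%:E)%E.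
  by move=> _; rewrite lee_fin mulr_ge0// qmat_ge0.
rewrite -(esumZl (kappa_ge0 i m j) q0); apply: eq_esum => k _.
have k0 n : [set: nat] n -> (0 <= (kappa k n i)%:E)%E.
  by move=> _; rewrite lee_fin kappa_ge0.
rewrite (EFinM (nu k)) -esum_kappa muleA -EFinM -(esumZl (mulr_ge0 (kappa_ge0 _ _ _) (nu0 _)) k0).
apply: eq_esum => n _; rewrite (esum_only (x := i)) //.
- by rewrite eqxx mul1r -EFinM; congr EFin; ring.
- by move=> l /negPf ->; rewrite mul0r mulr0.
Qed.

(** Q is positive on every edge, so invariance carries positivity of nu along paths. *)
Lemma nu_gt0 i : 0 < nu i.
Proof.
have [_ nu1 nuQ] := nu_invariant.
have [k nuk] : exists k, 0 < nu k.
  apply: contrapT => h; have := nu1; rewrite esum1; last first.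
    move=> k _; congr EFin; apply/eqP; apply: contrapT => nk; apply: h; exists k.
    by rewrite lt_def nu0 andbT; apply/negP.
  by move=> /esym/eqP; rewrite onee_eq0.
have [s ks <-] := Gconnected k i.
elim: s k nuk ks => [//|j s IH] k nuk /= /andP[kj]; apply: IH.
rewrite -lte_fin -nuQ; apply: (@lt_le_trans _ _ (nu k * qmat pG pb rep k j)%:E).
  rewrite lte_fin mulr_gt0// qmatE; apply: mulr_gt0; last exact: ratio_gt0.
  apply: mulr_gt0; first by have := g_ge1 k; lra.
  by rewrite (forward_gt0 pG_edge eps_bounds pb_bounds).
apply: (esum_le_term (a := fun k => (nu k * qmat pG pb rep k j)%:E)) => l.
by rewrite lee_fin mulr_ge0// qmat_ge0.
Qed.

Lemma skel_inv_gt0 s : (0 < skel_inv s) = (0 < kappa s.1.1 s.1.2 s.2).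
Proof. by rewrite /skel_inv pmulr_rgt0// nu_gt0. Qed.

Lemma skel_irreducible z s : 0 < skel_inv z -> 0 < skel_inv s ->
  exists2 r, path (fun x y => 0 < skel_step x y) z r & last z r = s.
Proof.
rewrite !skel_inv_gt0 => _ ks.
have [p zp lp] := Gconnected z.2 s.1.1.
suff [r zr lr] : exists2 r, path (fun x y => 0 < skel_step x y) z r & (last z r).2 = s.1.1.
  (* Path of triples with holding time 0 up to the label where s begins; the final step is to s
     itself. *)
  exists (rcons r s); last by rewrite last_rcons.
  by rewrite rcons_path zr /skel_step lr eqxx mul1r.
rewrite -lp {ks lp}; elim: p z zp => [|j p IH] z /=; first by exists [::].
move=> /andP[zj jp]; have [r rp rl] := IH (z.2, 0%N, j) jp.
exists ((z.2, 0%N, j) :: r) => //=; rewrite rp andbT.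
by rewrite /skel_step /= eqxx mul1r kappa0_gt0.
Qed.

Lemma exit_event_next k x N A s : exit_event k x N A ->
  P (A `&` skeleton k @^-1` [set s]) = 0%E \/
  exists y M, exit_event k.+1 y M (A `&` skeleton k @^-1` [set s]) /\ label y = s.2.
Proof.
move=> eA; rewrite (exit_event_skeleton _ eA).
case: s => -[i m] j /=; have [xi|xi] := eqVneq (label x) i; last first.
  by left; rewrite mul0r mule0.
have [ij|ij] := boolP (E i j); last first.
  left; rewrite mul1r; have := kappa_ge0 i m j.
  rewrite le_eqVlt => /orP[/eqP <-|/kappa_edge]; first by rewrite mule0.
  by rewrite (negPf ij).
rewrite -xi in ij *; right; exists (child x j), (N + m).+1.
by split; [case: (exit_event_step m eA ij)|exact: label_child].
Qed.

Let past (B : set Omega) (s : nat -> S) n :=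
  B `&` [set w | forall k, (k <= n)%N -> skeleton k w = s k].

Let past0 B s : past B s 0 = B `&` skeleton 0 @^-1` [set s 0%N].
Proof.
apply/seteqP; split=> w [Bw sk]; split=> //; first exact: sk.
by move=> k; rewrite leqn0 => /eqP ->.
Qed.

Let pastS B s n : past B s n.+1 = past B s n `&` skeleton n.+1 @^-1` [set s n.+1].
Proof.
apply/seteqP; split=> w.
  move=> [Bw sk]; split; last exact: sk.
  by split=> // k kn; apply: sk; exact: leqW.
move=> [[Bw sk] sn]; split=> // k; rewrite leq_eqVlt => /orP[/eqP -> //|].
exact: sk.
Qed.

Let measurable_past B s n : measurable B -> measurable (past B s n).
Proof.
move=> mB; elim: n => [|n IH]; rewrite ?past0 ?pastS; apply: measurableI => //;
  exact: measurable_skeleton.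
Qed.

(** A prescribed initial segment of the skeleton is null or again an exit event, so the one-step law
    applies at every time. *)
Lemma skeleton_past x N B n s : exit_event 0 x N B ->
  P (past B s n) = 0%E \/ exists y M, exit_event n.+1 y M (past B s n) /\ label y = (s n).2.
Proof.
move=> eB; have mB := measurable_exit_event eB.
elim: n => [|n [P0|[y [M [eA ys]]]]].
- by rewrite past0; exact: (exit_event_next _ eB).
- left; apply/eqP; rewrite -measure_le0 -P0 pastS; apply: le_measure.
  + by rewrite inE -pastS; exact: measurable_past.
  + by rewrite inE; exact: measurable_past.
  + by move=> w [].
- by rewrite pastS; exact: (exit_event_next _ eA).
Qed.

Lemma skeleton_law x N B n s : exit_event 0 x N B ->
  P (past B s n.+1) = (P (past B s n) * (skel_step (s n) (s n.+1))%:E)%E.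
Proof.
move=> eB; have mB := measurable_exit_event eB.
case: (skeleton_past n s eB) => [P0|[y [M [eA ys]]]]; last first.
  by rewrite pastS (exit_event_skeleton _ eA) ys.
rewrite P0 mul0e; apply/eqP; rewrite -measure_le0 -P0 pastS; apply: le_measure.
+ by rewrite inE -pastS; exact: measurable_past.
+ by rewrite inE; exact: measurable_past.
+ by move=> w [].
Qed.

(** Splits by first exit and first triple. Starting triples without invariant mass have probability
    0, so the ergodic theorem is needed only from states of positive mass. *)
Lemma skeleton_negligible (Q : set Omega) :
  (forall z H, markov_at P skel_step skeleton 0 z H -> 0 < skel_inv z ->
    P.-negligible (H `&` Q)) -> P.-negligible Q.
Proof.
move=> HQ; pose B n x z := if is_child tree_root x then
  (first_exit n x `&` skeleton 0 @^-1` [set z]) `&` Q else set0.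
apply: (@negligibleS _ _ _ _ (~` good `|` \bigcup_n \bigcup_x \bigcup_z B n x z)).
  move=> w Qw; have [|gw] := pselect (good w); last by left.
  rewrite bigcup_first_exit => -[n _ [x rx xw]]; right.
  by exists n => //; exists x => //; exists (skeleton 0 w) => //; rewrite /B ifT.
apply: negligibleU; first exact: negligible_not_good.
apply: negligible_bigcup => n; apply: negligible_bigcup_count => x.
apply: negligible_bigcup_count => z; rewrite /B.
case: ifP => rx; last exact: negligible_set0.
have eB := first_exit_event n rx; have mB := measurable_exit_event eB.
have HH : markov_at P skel_step skeleton 0 z (first_exit n x `&` skeleton 0 @^-1` [set z]).
  by apply: (markov_at_init measurable_skeleton z mB) => k s; exact: (skeleton_law k s eB).
have [zpos|] := boolP (0 < skel_inv z); first exact: (HQ z _ HH zpos).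
rewrite skel_inv_gt0 -leNgt => k0.
apply: (@negligibleS _ _ _ _ (first_exit n x `&` skeleton 0 @^-1` [set z])).
  by move=> w [].
have [mH _ _] := HH; have PH := exit_event_skeleton z eB.
rewrite (le_anti (_ : kappa z.1.1 z.1.2 z.2 <= 0 <= _)) ?k0 ?kappa_ge0// in PH.
by rewrite mulr0 mule0 in PH; apply/negligibleP => //; exact: PH.
Qed.

Lemma skeleton_mean_lower : P.-negligible [set w | ~ forall h : S -> R,
  (forall s, 0 <= h s) -> forall c, (c%:E < mean skel_inv h)%E ->
  exists n0, forall n, (n0 <= n)%N -> c * n%:R <= \sum_(i < n) h (skeleton i w)].
Proof.
apply: skeleton_negligible => z H HH z0.
exact: (negligible_mean_lower skel_step_ge0 skel_step_sum skel_inv_ge0 skel_inv_sum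
  skel_inv_invariant skel_irreducible measurable_skeleton HH z0).
Qed.

Lemma skeleton_mean_upper (h : S -> R) : (forall s, 0 <= h s) ->
  (mean skel_inv h < +oo)%E ->
  P.-negligible [set w | ~ forall c, (mean skel_inv h < c%:E)%E ->
  exists n0, forall n, (n0 <= n)%N -> \sum_(i < n) h (skeleton i w) <= c * n%:R].
Proof.
move=> h0 hfin; apply: skeleton_negligible => z H HH z0.
exact: (negligible_mean_upper skel_step_ge0 skel_step_sum skel_inv_ge0 skel_inv_sum
  skel_inv_invariant skel_irreducible measurable_skeleton HH z0 h0 hfin).
Qed.

(** * Stationary means of holding times and weights *)

Let hold (s : S) : R := s.1.2.+1%:R.

(** Given the label i, [kappa] is a product of a factor in m and a factor in j; its total mass 1 and
    the sum g i over m determine the sum over j. *)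
Lemma esum_step_ratio i :
  (\esum_(j in [set: G]) (fwd i j * ((1 - f j) / (1 - f i)))%:E = ((g i)^-1)%:E)%E.
Proof.
have r0 j : [set: G] j -> (0 <= (fwd i j * ((1 - f j) / (1 - f i)))%:E)%E.
  by move=> _; rewrite lee_fin mulr_ge0//; exact/ltW/ratio_gt0.
set r := esum _ _; have r_ge0 : (0 <= r)%E by exact: esum_ge0.
have g0 : 0 < g i by have := g_ge1 i; lra.
have : ((g i)%:E * r = 1)%E.
  rewrite -(esum_kappa_row i) -esum_gm -esumZr//; last by move=> m; rewrite lee_fin gm_ge0.
  apply: eq_esum => m _; rewrite -(esumZl (gm_ge0 i m) r0).
  by apply: eq_esum => j _; rewrite -EFinM mulrA.
move=> gr; have : (((g i)^-1)%:E * ((g i)%:E * r) = ((g i)^-1)%:E)%E by rewrite gr mule1.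
by rewrite muleA -EFinM mulVf ?gt_eqF// mul1e.
Qed.

Lemma esum_kappa_mark i m :
  (\esum_(j in [set: G]) (kappa i m j)%:E = (gm i m / g i)%:E)%E.
Proof.
rewrite EFinM -esum_step_ratio -esumZl ?gm_ge0//; last first.
  by move=> j _; rewrite lee_fin mulr_ge0//; exact/ltW/ratio_gt0.
by apply: eq_esum => j _; rewrite -EFinM mulrA.
Qed.

(** The coefficient of z^(m+1) in F(-i|z) is p(-i) gm i m, so p(-i) cancels in F' / F, leaving the
    mean of m + 1 under the weights gm i m / g i. *)
Lemma Lambda_mean_hold : Lambda pG pb rep nu =
  (\esum_(i in [set: G]) (nu i)%:E *
    \esum_(m in [set: nat]) (m.+1%:R * (gm i m / g i))%:E)%E.
Proof.
have gm0' i m : [set: nat] m -> (0 <= (m.+1%:R * gm i m)%:E)%E.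
  by move=> _; rewrite lee_fin mulr_ge0// gm_ge0.
apply: eq_esum => i _; congr (_ * _)%E.
have g0 : 0 < g i by have := g_ge1 i; lra.
have F'E : Fback' pG pb rep i 1 =
    ((pb i)%:E * \esum_(m in [set: nat]) (m.+1%:R * gm i m)%:E)%E.
  rewrite /Fback' /gen_fun_deriv nneseries_esumT; last first.
    move=> n; rewrite (F_coef_taboo pG_ge0 pG_edge eps_bounds pb_bounds).
    by apply: mule_ge0; [exact: taboo_ge0|rewrite lee_fin mulr_ge0// exprn_ge0].
  have pbi : 0 <= pb i by have := pb01' i; lra.
  rewrite -(esumZl pbi (gm0' i)); apply: eq_esum => m _.
  rewrite (F_coefS pG_ge0 pG_edge eps_bounds pb_bounds)// repl -gmE expr1n mulr1.
  by rewrite -!EFinM; congr EFin; ring.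
rewrite -fineFback inver gt_eqF ?f_gt0// F'E fE muleAC -EFinM.
have -> : pb i * (pb i * g i)^-1 = (g i)^-1.
  have pbi : pb i != 0 by rewrite gt_eqF//; have := pb01' i; lra.
  by rewrite invfM mulrA mulfV// mul1r.
have gi0 : 0 <= (g i)^-1 by rewrite invr_ge0 ltW.
rewrite -(esumZl gi0 (gm0' i)); apply: eq_esum => m _.
by rewrite -EFinM mulrC -mulrA.
Qed.

Lemma LambdaE : Lambda pG pb rep nu = mean skel_inv hold.
Proof.
have F0 i m j : (0 <= (nu i * kappa i m j * m.+1%:R)%:E)%E.
  by rewrite lee_fin mulr_ge0// mulr_ge0// kappa_ge0.
rewrite Lambda_mean_hold /mean (esum_skel F0); apply: eq_esum => i _.
have g0 : 0 < g i by have := g_ge1 i; lra.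
rewrite -esumZl//; last first.
  by move=> m _; rewrite lee_fin mulr_ge0// divr_ge0 ?gm_ge0// ltW.
apply: eq_esum => m _; rewrite EFinM -esum_kappa_mark muleA -EFinM -esumZl ?mulr_ge0//; last first.
  by move=> j _; rewrite lee_fin kappa_ge0.
by apply: eq_esum => j _; rewrite -EFinM; congr EFin; ring.
Qed.

Lemma mean_cst (c : R) : 0 <= c -> mean skel_inv (fun=> c) = c%:E.
Proof.
move=> c0; rewrite -[RHS]mule1 -skel_inv_sum -esumZl//; last first.
  by move=> s _; rewrite lee_fin skel_inv_ge0.
by apply: eq_esum => s _; rewrite -EFinM mulrC.
Qed.

Lemma Lambda_ge1 : (1 <= Lambda pG pb rep nu)%E.
Proof.
rewrite LambdaE -(mean_cst ler01); apply: le_esum => s _.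
by rewrite lee_fin ler_wpM2l ?skel_inv_ge0// /hold ler1n.
Qed.

Lemma mean_edge (F : G -> G -> R) : (forall i j, 0 <= F i j) ->
  (mean skel_inv (fun s : S => F s.1.1 s.2) =
   \esum_(z in [set: G * G]) (F z.1 z.2 * nu z.1 * qmat pG pb rep z.1 z.2)%:E)%E.
Proof.
move=> F0; have F0' i m j : (0 <= (nu i * kappa i m j * F i j)%:E)%E.
  by rewrite lee_fin mulr_ge0// mulr_ge0// kappa_ge0.
rewrite /mean (esum_skel F0') esum_pair; last first.
  by move=> z; rewrite lee_fin; apply: mulr_ge0; [exact: mulr_ge0|exact: qmat_ge0].
apply: eq_esum => i _; rewrite esum_swap//; apply: eq_esum => j _ /=.
rewrite EFinM -esum_kappa -esumZl ?mulr_ge0//; last first.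
  by move=> m _; rewrite lee_fin kappa_ge0.
by apply: eq_esum => m _; rewrite -EFinM; congr EFin; ring.
Qed.

Local Notation edge_sum w := (real_sum (fun ij : G * G =>
  w ij.1 ij.2 * nu ij.1 * qmat pG pb rep ij.1 ij.2)).

(** The ergodic averages require nonnegative functions, so w is shifted by its bound M; the proof
    matches this with the positive and negative parts in [real_sum]. *)
Lemma mean_weight (w : G -> G -> R) (M : R) : (forall i j, `|w i j| <= M) ->
  mean skel_inv (fun s : S => w s.1.1 s.2 + M) = (edge_sum w + M)%:E.
Proof.
move=> wM; have M0 : 0 <= M := le_trans (normr_ge0 _) (wM i0 i0).
have wM0 i j : 0 <= w i j + M by have := wM i j; rewrite ler_norml; lra.
pose a (z : G * G) := nu z.1 * qmat pG pb rep z.1 z.2.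
have a0 z : 0 <= a z by rewrite mulr_ge0// qmat_ge0.
have suma : (\esum_(z in [set: G * G]) (M * a z)%:E = M%:E)%E.
  rewrite -[RHS](mean_cst M0) (mean_edge (F := fun _ _ => M))//.
  by apply: eq_esum => z _; rewrite mulrA.
pose b (z : G * G) := w z.1 z.2 * nu z.1 * qmat pG pb rep z.1 z.2.
have bE z : b z = w z.1 z.2 * a z by rewrite /b /a mulrA.
set Pp := (\esum_(i in [set: G * G]) (EFin \o b)^\+%E i)%E.
set Nn := (\esum_(i in [set: G * G]) (EFin \o b)^\-%E i)%E.
have Pp0 : (0 <= Pp)%E by apply: esum_ge0 => z _; exact: funepos_ge0.
have Nn0 : (0 <= Nn)%E by apply: esum_ge0 => z _; exact: funeneg_ge0.
have bM z : `|b z| <= M * a z.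
  by rewrite bE normrM [`|a z|]ger0_norm// ler_wpM2r.
have Ppf : Pp \is a fin_num.
  rewrite ge0_fin_numE//; apply: le_lt_trans (ltry M); rewrite -suma.
  apply: le_esum => z _; rewrite funeposE /= ge_max !lee_fin mulr_ge0// andbT.
  by apply: le_trans (ler_norm _) (bM z).
have Nnf : Nn \is a fin_num.
  rewrite ge0_fin_numE//; apply: le_lt_trans (ltry M); rewrite -suma.
  apply: le_esum => z _; rewrite funenegE /= ge_max !lee_fin mulr_ge0// andbT.
  by apply: le_trans (bM z); rewrite -normrN ler_norm.
have key : (mean skel_inv (fun s : S => w s.1.1 s.2 + M)%R + Nn = Pp + M%:E)%E.
  rewrite (mean_edge (F := fun i j => w i j + M))// -[M%:E in RHS]suma -!esumD.
  - apply: eq_esum => z _; rewrite funeposE funenegE /= -!EFin_max -!EFinD.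
    congr EFin; have -> : (w z.1 z.2 + M) * nu z.1 * qmat pG pb rep z.1 z.2 = b z + M * a z.
      by rewrite bE /a; ring.
    by case: (leP (b z) 0) => b0; case: (leP (- b z) 0) => b0'; lra.
  - by move=> z _; exact: funepos_ge0.
  - by move=> z _; rewrite lee_fin mulr_ge0.
  - by move=> z _; rewrite lee_fin; apply: mulr_ge0; [exact: mulr_ge0|exact: qmat_ge0].
  - by move=> z _; exact: funeneg_ge0.
have -> : edge_sum w = fine (Pp - Nn) by [].
move: key; rewrite -(fineK Ppf) -(fineK Nnf) -EFinD.
case: (mean _ _) => [r|//|//]; rewrite -EFinD => -[e]; congr EFin.
by rewrite /=; lra.
Qed.

(** * Transfer from the exit chain to the walk *)

Lemma size_word_exit k w : good w -> size (word (exit_point k w)) = k.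
Proof.
move=> gw; elim: k => // k IH; have [e1 e2] := exit_pointP k gw.
by rewrite e2 word_child//= IH.
Qed.

Lemma exit_time_sum n w : good w ->
  (exit_time n w)%:R = (exit_time 0 w)%:R + \sum_(i < n) hold (skeleton i w) :> R.
Proof.
move=> gw; elim: n => [|n IH]; first by rewrite big_ord0 addr0.
rewrite big_ord_recr /= addrA -IH /hold skeletonE//= -natrD; congr (_%:R).
by rewrite addnS -addSn subnKC// exit_time_lt.
Qed.

Lemma exit_length_sum (wt : G -> G -> R) n w : good w ->
  length_fun wt (exit_point n.+1 w) = length_fun wt (exit_point 1 w) +
    \sum_(i < n) wt (skeleton i w).1.1 (skeleton i w).2.
Proof.
move=> gw; have gen (L a : nat -> R) : (forall k, L k.+2 = L k.+1 + a k) ->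
    L n.+1 = L 1%N + \sum_(i < n) a i.
  move=> La; elim: n => [|k IH]; first by rewrite big_ord0 addr0.
  by rewrite La IH big_ord_recr /= addrA.
apply: (gen (fun k => length_fun wt (exit_point k w))
  (fun k => wt (skeleton k w).1.1 (skeleton k w).2)) => k.
have [e1 e2] := exit_pointP k.+1 gw.
by rewrite skeletonE// e2 length_child// label_child.
Qed.

Lemma length_step (wt : G -> G -> R) (M : R) w n : (forall i j, `|wt i j| <= M) ->
  good w -> `|length_fun wt (X n.+1 w) - length_fun wt (X n w)| <= M.
Proof.
move=> wM [_ st _]; have M0 : 0 <= M := le_trans (normr_ge0 _) (wM i0 i0).
have := st n; move: (X n w) (X n.+1 w) => x y /step_cases[->|[xy ->]]; last first.
  by rewrite length_child// addrAC subrr add0r.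
have [->|x0] := eqVneq x tree_root; first by rewrite subrr normr0.
have /is_childP[px e] := is_child_parent x0.
by rewrite [in X in `|_ - X|]e length_child// opprD addrA subrr add0r normrN.
Qed.

Lemma length_X_exit (wt : G -> G -> R) k w : good w ->
  length_fun wt (X (exit_time k w) w) = length_fun wt (exit_point k w).
Proof. by move=> gw; have [->] := exit_time_last k gw. Qed.

Lemma skeleton_linear_growth (h : S -> R) : (forall s, 0 <= h s) ->
  (mean skel_inv h < +oo)%E ->
  P.-negligible [set w | ~ linear_growth (fun n => \sum_(i < n) h (skeleton i w))
    (fine (mean skel_inv h))].
Proof.
move=> h0 hfin; have hf : mean skel_inv h \is a fin_num.
  rewrite ge0_fin_numE//; apply: esum_ge0 => s _.
  by rewrite lee_fin mulr_ge0// skel_inv_ge0.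
apply: negligibleS (negligibleU skeleton_mean_lower (skeleton_mean_upper h0 hfin)).
move=> w; apply: contra_notP => /not_orP[/contrapT lo /contrapT up].
apply: linear_growth_bounds => c.
  by rewrite -lte_fin fineK// => /(lo _ h0).
by rewrite -lte_fin fineK// => /up.
Qed.

Lemma length_limit (wt : G -> G -> R) (M : R) : (forall i j, `|wt i j| <= M) ->
  (Lambda pG pb rep nu < +oo)%E ->
  P.-negligible [set w | ~ ((fun n => length_fun wt (X n w) / n%:R) @ \oo -->
    edge_sum wt * (fine (Lambda pG pb rep nu))^-1)].
Proof.
move=> wM Lfin; have M0 : 0 <= M := le_trans (normr_ge0 _) (wM i0 i0).
pose hw (s : S) := wt s.1.1 s.2 + M.
have hw0 s : 0 <= hw s by have := wM s.1.1 s.2; rewrite /hw ler_norml; lra.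
have hold0 s : 0 <= hold s by [].
have N1 := skeleton_linear_growth hold0; rewrite -LambdaE in N1.
have N2 := @skeleton_linear_growth hw hw0; rewrite mean_weight// in N2.
apply: negligibleS (negligibleU negligible_not_good
  (negligibleU (N1 Lfin) (N2 (ltry _)))).
move=> w; apply: contra_notP => /not_orP[/contrapT gw /not_orP[/contrapT g1 /contrapT g2]].
have L1 : 1 <= fine (Lambda pG pb rep nu).
  rewrite -lee_fin fineK ?Lambda_ge1// ge0_fin_numE//.
  exact: le_trans Lambda_ge1.
apply: linear_growth_cvg; apply: (@linear_growth_time_change _ (exit_time ^~ w) _ _ _ M).
- lra.
- by move=> k; exact: exit_time_lt.
- by move=> n; exact: length_step.
- rewrite (_ : (fun k => _) = (fun k => (exit_time 0 w)%:R +
      \sum_(i < k) hold (skeleton i w))); first exact: linear_growth_add.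
  by apply/funext => k; exact: exit_time_sum.
(* The skeleton sums describe the length from the first exit point on, one index later. *)
- apply: linear_growth_shift.
  rewrite (_ : (fun k => _) = (fun k => length_fun wt (exit_point 1 w) +
      \sum_(i < k) wt (skeleton i w).1.1 (skeleton i w).2)); last first.
    by apply/funext => k; rewrite length_X_exit// exit_length_sum.
  apply: linear_growth_add => delta d0; have [n0 H0] := g2 _ d0.
  exists n0 => n /H0; rewrite big_split /= sumr_const card_ord -mulr_natr.
  by congr (is_true (`|_| <= _)); ring.
Qed.

(** The k-th exit point has length at most M k in absolute value, while its exit time exceeds any
    multiple of k. The estimate holds along exit times, hence the lower limit. *)
Lemma length_liminf (wt : G -> G -> R) (M : R) : (forall i j, `|wt i j| <= M) ->
  Lambda pG pb rep nu = +oo%E ->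
  P.-negligible [set w | limn_einf (fun n => (`|length_fun wt (X n w)| / n%:R)%:E) <> 0%E].
Proof.
move=> wM Loo; have M0 : 0 <= M := le_trans (normr_ge0 _) (wM i0 i0).
apply: negligibleS (negligibleU negligible_not_good skeleton_mean_lower).
move=> w; apply: contra_notP => /not_orP[/contrapT gw /contrapT lo].
have hold0 s : 0 <= hold s by [].
apply: limn_einf_eq0 => [n|delta n0 d0]; first by rewrite divr_ge0.
(* M / delta brings the quotient below delta; the summand 1 keeps the constant positive when M =
   0. *)
have c0 : 0 < M / delta + 1 by rewrite ltr_wpDl ?divr_ge0// ltW.
have [|n1 H1] := lo _ hold0 (M / delta + 1); first by rewrite -LambdaE Loo ltry.
pose k := (maxn n0 n1).+1; exists (exit_time k w).
  have ek l : (l <= exit_time l w)%N.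
    by elim: l => // l IH; apply: leq_ltn_trans IH (exit_time_lt l gw).
  by apply: leq_trans (ek k); rewrite leqW// leq_maxl.
have k0 : 0 < k%:R :> R by rewrite ltr0n.
have et : (M / delta + 1) * k%:R <= (exit_time k w)%:R.
  rewrite exit_time_sum//; apply: le_trans (H1 k _) _.
    by rewrite leqW// leq_maxr.
  by rewrite lerDr.
have et0 : 0 < (exit_time k w)%:R :> R by apply: lt_le_trans et; rewrite mulr_gt0.
rewrite ler_pdivrMr// length_X_exit//; apply: le_trans (length_bound _ wM) _.
rewrite size_word_exit//; apply: le_trans (ler_wpM2l (ltW d0) et).
rewrite mulrA ler_wpM2r// mulrDr mulr1 mulrC divfK ?gt_eqF//; lra.
Qed.

Lemma edge_sum1 : edge_sum (fun _ _ => 1) = 1.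
Proof.
have h : forall i j : G, `|(1 : R)| <= 1 by move=> _ _; rewrite normr1.
(* With w = M = 1 the shifted weight is the constant 2, whose mean is 2. *)
have := mean_weight h; rewrite mean_cst ?addr_ge0// => -[] {h}; lra.
Qed.

(** * Spectral radius below one *)

Lemma reach (x : T) : exists N H, [/\ markov_at P t X N x H, (0 < P H)%E & H `<=` start].
Proof.
have [u ru <-] := graft_root_word x; elim: u ru => [|j u IH] /= ru.
  exists 0%N, start; split=> //; have [_ -> _] := Xmarkov; exact: lte01.
have /andP[uj /IH [N [H [HH PH Hs]]]] := ru.
have [HH' PH'] := markov_at_step mX (child (graft u tree_root) j) HH.
exists N.+1; eexists; split; [exact: HH'| |by move=> w [/Hs]].
rewrite PH' mule_gt0// lte_fin cover_walk_child//.
by rewrite (forward_gt0 pG_edge eps_bounds pb_bounds).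
Qed.

(** The direct descent along ancestors. The constant c depends on x alone, so it stays fixed while
    the number of preceding loops grows. *)
Lemma back_to_root (x : T) : exists (k : nat) (c : R), 0 < c /\
  forall N H, markov_at P t X N x H ->
    (c%:E * P H <= P (H `&` X (N + k)%N @^-1` [set tree_root]))%E.
Proof.
have [u ru <-] := graft_root_word x; elim: u ru => [|j u IH] /= ru.
  exists 0%N, 1; split=> // N H [_ HN _]; rewrite mul1e addn0 setIidl//.
have /andP[uj /IH [k [c [c0 Hc]]]] := ru; set y := graft u tree_root in uj Hc *.
have pbj : 0 < pb j by have := pb01' j; lra.
exists k.+1, (c * pb j); split; first by rewrite mulr_gt0.
move=> N H HH; have [HH' PH'] := markov_at_step mX y HH.
have := Hc _ _ HH'; rewrite PH' -{2}(parent_child uj) cover_walk_parent label_child//.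
rewrite muleCA -EFinM muleC => /le_trans; apply.
have mR n : measurable (X n @^-1` [set tree_root]) by exact: mX.
have [mH _ _] := HH; have [mH' _ _] := HH'.
rewrite addSnnS; apply: le_measure; rewrite ?inE; try exact: measurableI.
by move=> w [[]].
Qed.

(** Excursions of length m avoiding the ancestor are concatenated by restarting at x. *)
Lemma loops (x : T) m l N H : x != tree_root -> markov_at P t X N x H ->
  exists H', [/\ markov_at P t X (N + l * m) x H',
    P H' = (P H * (gm (label x) m ^+ l)%:E)%E & H' `<=` H].
Proof.
move=> x0 HH; elim: l => [|l [H' [HH' PH' sub]]].
  by exists H; rewrite mul0n addn0 expr0 mule1; split.
have [HH2 PH2] := markov_at_taboo t0 mX m x (pred1 (parent x)) HH'.
set H2 := H' `&` _ in HH2 PH2; exists H2; split.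
- by rewrite mulSn [(m + _)%N]addnC addnA; exact: HH2.
- by rewrite PH2 taboo_gm// PH' exprSr EFinM muleA.
- by move=> w [/sub].
Qed.

Let root : T := tree_root.

Lemma green_visit n : green_coef t root root n = P (start `&` X n @^-1` [set root]).
Proof.
have [_ P1 _] := Xmarkov.
have [_] := markov_at_taboo t0 mX n root pred0 start_markov.
rewrite add0n P1 mul1e -prob_from_taboo// => h.
transitivity (P (start `&` [set w | X n w = root /\
  (forall q : nat, (q < n)%N -> ~~ pred0 (X (0 + q)%N w))])); last first.
  by congr (P (_ `&` _)); apply/seteqP; split=> w // [].
rewrite h; congr (prob_from _ _ _ _); apply/seteqP.
by split=> Y // [].
Qed.

(* If G(o,o|r) is finite for some r > 1, going to a vertex labelled i, looping
   l times there and coming back shows that the l-th power of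
   P[X_m = x, no visit of the ancestor] r^m is bounded in l. *)
Lemma gm_geometric (r : R) i m : 1 < r ->
  (gen_fun (green_coef t root root) r < +oo)%E -> gm i m * r ^+ m <= 1.
Proof.
move=> r1 Gr; have r0 : 0 < r by lra.
have green0 n : (0 <= green_coef t root root n)%E by rewrite green_visit.
have term0 n : (0 <= green_coef t root root n * (r ^+ n)%:E)%E.
  by rewrite mule_ge0// lee_fin exprn_ge0// ltW.
pose C := fine (gen_fun (green_coef t root root) r).
have Gf : gen_fun (green_coef t root root) r \is a fin_num.
  by rewrite ge0_fin_numE//; apply: nneseries_ge0.
have CE n : (green_coef t root root n * (r ^+ n)%:E <= C%:E)%E.
  rewrite fineK// /gen_fun nneseries_esumT//.
  exact: (esum_le_term (a := fun n => (green_coef t root root n * (r ^+ n)%:E)%E)).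
have [N [H [HH PH Hs]]] := reach (rep i).
have [k [c [c0 Hc]]] := back_to_root (rep i).
have [mH _ _] := HH; have PHf : P H \is a fin_num by exact: fin_num_measure.
pose p := fine (P H); have p0 : 0 < p by rewrite fine_gt0// PH ltey_eq PHf.
(* At time n = N + l m + k the term of the Green series is at least c p (gm i m)^l r^n and at most
   C. *)
apply: (@power_bounded_le1 _ _ (C / (c * p * r ^+ (N + k)))) => l.
have [H' [HH' PH' sub]] := loops m l (rep0 i) HH.
have [mH' _ _] := HH'.
have le1 := Hc _ _ HH'.
have le2 : (P (H' `&` X (N + l * m + k)%N @^-1` [set tree_root]) <=
            green_coef t root root (N + l * m + k))%E.
  rewrite green_visit; apply: le_measure; rewrite ?inE; try (apply: measurableI => //; exact: mX).
  by move=> w [/sub/Hs sw Xw].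
have := le_trans le1 le2; rewrite PH' repl -(fineK PHf) -/p -!EFinM => le3.
have rn0 : (0 <= (r ^+ (N + l * m + k))%:E)%E by rewrite lee_fin exprn_ge0// ltW.
have := le_trans (lee_wpmul2r rn0 le3) (CE _).
rewrite -EFinM lee_fin => le4.
rewrite ler_pdivlMr ?mulr_gt0 ?exprn_gt0//; apply: le_trans le4.
rewrite exprMn -exprM !exprD [(m * l)%N]mulnC le_eqVlt; apply/orP; left.
by apply/eqP; ring.
Qed.

Lemma Lambda_finite : (spectral_radius E i0 pG pb < 1)%E ->
  (Lambda pG pb rep nu < +oo)%E.
Proof.
rewrite /spectral_radius; set rho := convergence_radius _ => rho1.
have rho0 : (0 <= rho)%E.
  apply: ereal_sup_ubound; exists 0 => //; split=> //.
  rewrite /gen_fun nneseries_recl//; last first.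
    by move=> n _; rewrite mule_ge0 ?green_visit// lee_fin exprn_ge0.
  rewrite expr0 mule1 eseries0 ?adde0.
    rewrite green_visit (le_lt_trans (probability_le1 _ _)) ?ltry//.
    by apply: measurableI; exact: mX.
  by move=> [//|n] _ _; rewrite expr0n /= mule0.
(* The inverse of 0 is +oo and that of +oo is 0, so the endpoints are treated separately. *)
have rho_gt1 : (1 < rho)%E.
  case: rho rho0 rho1 => [r| |]//; rewrite ?lte_fin ?ltry// lee_fin inver => r0.
  case: eqP => // /eqP rn0; rewrite lte_fin => h.
  have rp : 0 < r by rewrite lt_def rn0.
  by rewrite -[X in X < _]invr1 -[X in _ < X]invrK ltf_pV2 ?posrE ?invr_gt0.
have [_ [r [r0 Gr] <-]] := ereal_sup_gt rho_gt1; rewrite lte_fin => r1.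
pose s := r^-1; have s01 : 0 <= s < 1.
  rewrite invr_ge0 r0 /=; rewrite -[X in _ < X]invr1 ltf_pV2 ?posrE; lra.
have gms i m : gm i m <= s ^+ m.
  rewrite /s exprVn -[leRHS]mul1r ler_pdivlMr ?exprn_gt0//; last by lra.
  exact: gm_geometric.
(* Bounds the sum of (m + 1) s^m; since g i >= 1, it bounds the mean holding time for every i. *)
pose K := ((1 - s) ^+ 2)^-1.
have row i : (\esum_(m in [set: nat]) (m.+1%:R * (gm i m / g i))%:E <= K%:E)%E.
  rewrite -nneseries_esumT; last first.
    by move=> m; rewrite lee_fin mulr_ge0// divr_ge0 ?gm_ge0//; have := g_ge1 i; lra.
  apply: lime_le.
    apply: is_cvg_nneseries => m _ _.
    by rewrite lee_fin mulr_ge0// divr_ge0 ?gm_ge0//; have := g_ge1 i; lra.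
  apply: nearW => n; rewrite sumEFin lee_fin big_mkord.
  apply: le_trans (weighted_geometric_sum n s01); apply: ler_sum => m _.
  rewrite ler_wpM2l//; apply: le_trans (gms i m).
  rewrite ler_pdivrMr; last by have := g_ge1 i; lra.
  by rewrite ler_peMr ?gm_ge0 ?g_ge1.
apply: le_lt_trans (ltry K); rewrite Lambda_mean_hold.
have K0 : 0 <= K by rewrite invr_ge0 sqr_ge0.
have nuE i : [set: G] i -> (0 <= (nu i)%:E)%E by rewrite lee_fin.
have [_ nu1 _] := nu_invariant; rewrite -[K%:E]mule1 -nu1 -(esumZl K0 nuE).
by apply: le_esum => i _; rewrite muleC lee_wpmul2r ?lee_fin//; exact: row.
Qed.

End RateOfEscape.

Theorem theorem3p8 (R : realType) (G : countType) (E : rel G) (i0 : G)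
  (pG : G -> G -> R) (pb : G -> R) (eps : R)
  (d : measure_display) (Omega : measurableType d) (P : probability Omega R)
  (X : nat -> Omega -> directed_cover E i0)
  (rep : G -> directed_cover E i0) (nu : G -> R)
  (Gconnected : strongly_connected E)
  (Gbounded : bounded_geometry E)
  (pG_ge0 : forall i j, 0 <= pG i j)
  (pG_stochastic :
     forall i, (\esum_(j in [set: G]) (pG i j)%:E = 1)%E)
  (pG_edge : forall i j, 0 < pG i j <-> E i j)
  (eps_bounds : 0 < eps < 1)
  (pb_bounds : forall i, eps < pb i < 1 - eps)
  (Xmarkov : markov_chain (cover_walk pG pb) P X tree_root)
  (Xtransient : transient (cover_walk pG pb : directed_cover E i0 -> directed_cover E i0 -> R))
  (repP : forall i, rep i <> tree_root /\ label (rep i) = i)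
  (Qposrec : positive_recurrent (qmat pG pb rep))
  (nu_invariant : invariant_probability (qmat pG pb rep) nu) :
  [/\ (Lambda pG pb rep nu < +oo)%E ->
        (forall w : G -> G -> R,
           (exists M : R, forall i j, `|w i j| <= M) ->
           {ae P, forall omega,
              (fun n : nat => length_fun w (X n omega) / n%:R) @ \oo -->
                real_sum (fun ij : G * G =>
                            w ij.1 ij.2 * nu ij.1 * qmat pG pb rep ij.1 ij.2)
                  * (fine (Lambda pG pb rep nu))^-1})
        /\
        (exists2 v : R, 0 < v &
           {ae P, forall omega,
              (fun n : nat => (height (X n omega))%:R / n%:R : R) @ \oo --> v}),
      (spectral_radius E i0 pG pb < 1)%E ->
        (Lambda pG pb rep nu < +oo)%E
    & Lambda pG pb rep nu = +oo%E ->
        forall w : G -> G -> R,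
          (exists M : R, forall i j, `|w i j| <= M) ->
          {ae P, forall omega,
             limn_einf (fun n : nat => (`|length_fun w (X n omega)| / n%:R)%:E)
               = 0%E}
          /\
          ((forall i j, 0 <= w i j) ->
           {ae P, forall omega,
              limn_einf (fun n : nat => (length_fun w (X n omega) / n%:R)%:E)
                = 0%E})].
Proof.
have L1 := Lambda_ge1 pG_ge0 pG_stochastic pG_edge eps_bounds pb_bounds repP Qposrec
  Xmarkov Xtransient Gconnected nu_invariant.
have limit (w : G -> G -> R) M (wM : forall i j, `|w i j| <= M) :=
  length_limit pG_ge0 pG_stochastic pG_edge eps_bounds pb_bounds repP Qposrec
    Xmarkov Xtransient Gconnected nu_invariant wM.
have liminf (w : G -> G -> R) M (wM : forall i j, `|w i j| <= M) :=
  length_liminf pG_ge0 pG_stochastic pG_edge eps_bounds pb_bounds repP Qposrec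
    Xmarkov Xtransient Gconnected nu_invariant wM.
split.
- move=> Lfin; split=> [w [M wM]|].
    by apply: negligibleS (limit w M wM Lfin) => omega.
  have L0 : 0 < fine (Lambda pG pb rep nu).
    rewrite -lte_fin fineK ?(lt_le_trans lte01)// ge0_fin_numE//.
    exact: le_trans L1.
  (* Height is the length for the constant weight 1, whose edge sum is 1. *)
  exists (fine (Lambda pG pb rep nu))^-1; first by rewrite invr_gt0.
  have h (i j : G) : `|1 : R| <= 1 by rewrite normr1.
  apply: negligibleS (limit (fun _ _ => 1) 1 h Lfin) => omega /=.
  apply: contra_not; rewrite (edge_sum1 pG_ge0 pG_stochastic pG_edge eps_bounds pb_bounds repP
    Qposrec Xmarkov Xtransient Gconnected nu_invariant) mul1r.
  by under eq_fun do rewrite length_fun1.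
- exact: (Lambda_finite pG_ge0 pG_stochastic pG_edge eps_bounds pb_bounds repP
    Xmarkov nu_invariant).
- move=> Loo w [M wM]; have lim0 := liminf w M wM Loo; split.
    by apply: negligibleS lim0 => omega.
  move=> w0; apply: negligibleS lim0 => omega /=; apply: contra_not.
  by under [in X in X -> _]eq_fun do rewrite ger0_norm ?length_ge0//.
Qed.
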